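(* Let $\varphi:M^n=N_T\times_fN_\perp\to\tilde M^{2m}(c)$ be a minimal isometric immersion of a CR-warped product into a complex space form, with $n_1=\dim N_T$ and $n_2=\dim N_\perp\ge2$. Then for each $x\in M^n$, denoting by $q=\mathrm{pr}_{N_\perp}(x)$ the projection of $x$ to $N_\perp$, $$\hat\delta(T_xN_\perp)(x)+\frac{n_2\,\Delta f}{f}\le\frac{n_2(n_2+2n_1-1)}{2}\cdot\frac c4-\frac c4=\frac{n_2(n_2+2n_1-1)-2}{2}\cdot\frac c4.$$ Equivalently, in intrinsic form, $$\delta_{N_\perp}(q)+f^2\,\frac{n_2\,\Delta f}{f}\le f^2\cdot\frac{n_2(n_2+2n_1-1)-2}{2}\cdot\frac c4+\left[\binom{n_2}{2}-1\right]\|\nabla f\|^2.$$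
   Context: A complex space form $\tilde M^{2m}(c)$ is a Kähler manifold $(\tilde M,J,\tilde g)$ of real dimension $2m$ with constant holomorphic sectional curvature $c\in\mathbb R$. Warped product: for Riemannian manifolds $(N_1,g_{N_1})$, $(N_2,g_{N_2})$ and a smooth $f>0$ on $N_1$, $N_1\times_fN_2$ is $N_1\times N_2$ with metric $g_{N_1}+f^2g_{N_2}$. A CR-warped product submanifold is a warped product $M^n=N_T\times_fN_\perp$ (with $f>0$ smooth on $N_T$) isometrically immersed in $\tilde M^{2m}(c)$ such that $\mathfrak D_T=TN_T$ is holomorphic ($J\mathfrak D_T=\mathfrak D_T$) and $\mathfrak D_\perp=TN_\perp$ is totally real ($J\mathfrak D_\perp\subseteq T^\perp M^n$). $T_xN_\perp$ denotes the subspace of $T_xM^n$ tangent to the fiber of $N_\perp$ through $x$. $f$, $\nabla f$ and $\Delta f$ are evaluated at the projection of $x$ to $N_T$; $\nabla f$ is the gradient and $\Delta f$ the Laplacian of $f$ on $N_T$, with the sign convention $\Delta=-\mathrm{div}\,\mathrm{grad}$. The immersion is minimal if its mean curvature vector $\vec H=\frac1n\sum_ih(e_i,e_i)$ vanishes identically. With $K^M$ the sectional curvature of $M^n$ and $\tau^M(V)=\sum_{i<j}K^M(v_i\wedge v_j)$ for an orthonormal basis $\{v_i\}$ of a subspace $V\subseteq T_xM^n$, the leaf-wise first Chen invariant is $\hat\delta(T_xN_\perp)(x)=\tau^M(T_xN_\perp)-\inf\{K^M(\pi):\pi\subseteq T_xN_\perp,\ \dim\pi=2\}$. The (intrinsic)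 Chen first invariant of the Riemannian manifold $(N_\perp,g_{N_\perp})$ is $\delta_{N_\perp}(q)=\tau^{N_\perp}(q)-\inf\{K^{N_\perp}(\pi):\pi\subset T_qN_\perp,\ \dim\pi=2\}$, where $\tau^{N_\perp}(q)=\sum_{i<j}K^{N_\perp}(e_i\wedge e_j)$ for a $g_{N_\perp}$-orthonormal basis of $T_qN_\perp$. *)

(* Defs.v *)
(* Smooth manifolds are given by atlases, tensor fields by their components in
   the charts of the atlas, subject to the transformation law between charts.
   Tangent vectors are row vectors of components, so a linear map with matrix A
   acts by v |-> v *m A. *)
From mathcomp Require Import all_boot all_order all_algebra.
From mathcomp Require Import all_classical all_reals all_analysis.

Set Implicit Arguments.
Unset Strict Implicit.
Unset Printing Implicit Defensive.

Import Order.TTheory GRing.Theory Num.Theory.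
Import numFieldNormedType.Exports.

Local Open Scope classical_set_scope.
Local Open Scope ring_scope.

Section Smoothness.
Context (R : realType) (n : nat).

(* C^k on U; only used for open U. *)
Fixpoint Ck (k : nat) (U : set 'rV[R]_n) (f : 'rV[R]_n -> R) : Prop :=
  match k with
  | 0 => forall u, U u -> {for u, continuous f}
  | k'.+1 => (forall u, U u -> differentiable f u) /\
             (forall i : 'I_n, Ck k' U ('D_(delta_mx 0 i) f))
  end.

Definition smooth (U : set 'rV[R]_n) (f : 'rV[R]_n -> R) : Prop :=
  forall k, Ck k U f.

Definition smooth_mx p q (U : set 'rV[R]_n) (F : 'rV[R]_n -> 'M[R]_(p, q)) :
  Prop := forall i j, smooth U (fun u => F u i j).

End Smoothness.

Section LocalGeometry.
Context (R : realType) (n : nat).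
Implicit Types (g : 'rV[R]_n -> 'M[R]_n) (X Y : 'rV[R]_n -> 'rV[R]_n).
Implicit Types (u x y z : 'rV[R]_n).

Definition inner g u x y : R := (x *m g u *m y^T) 0 0.

Definition christoffel g u (k i j : 'I_n) : R :=
  2^-1 * \sum_(l < n) invmx (g u) k l *
    ('D_(delta_mx 0 i) (fun w => g w j l) u
     + 'D_(delta_mx 0 j) (fun w => g w i l) u
     - 'D_(delta_mx 0 l) (fun w => g w i j) u).

Definition Gamma g u x y : 'rV[R]_n :=
  \row_k \sum_(i < n) \sum_(j < n) christoffel g u k i j * x 0 i * y 0 j.

(* Levi-Civita connection: the field nabla_X Y. *)
Definition nabla g X Y u : 'rV[R]_n := 'D_(X u) Y u + Gamma g u (X u) (Y u).

(* R(x,y)z computed with the constant extensions of x, y, z, whose Lie brackets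
   vanish. *)
Definition curvature g u x y z : 'rV[R]_n :=
  nabla g (cst x) (nabla g (cst y) (cst z)) u
  - nabla g (cst y) (nabla g (cst x) (cst z)) u.

(* Sectional curvature of the plane spanned by independent x, y. *)
Definition sectional g u x y : R :=
  inner g u (curvature g u x y y) x
  / (inner g u x x * inner g u y y - inner g u x y ^+ 2).

(* Subspaces of the tangent space are row spaces of matrices V. *)
Definition plane_curvatures p g u (V : 'M[R]_(p, n)) : set R :=
  [set sectional g u (row 0 P) (row 1 P) |
    P in [set P : 'M[R]_(2, n) | row_free P /\ (P <= V)%MS]].

(* The rows of an orthonormal basis of V: one is chosen, since tau and the mean
   curvature below do not depend on which. *)
Definition orthonormal_basis p g u (V : 'M[R]_(p, n)) : 'M[R]_(\rank V, n) :=
  xget 0 [set E : 'M[R]_(\rank V, n) |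
            E *m g u *m E^T = 1%:M /\ (E == V)%MS].

Definition tau p g u (V : 'M[R]_(p, n)) : R :=
  let E := orthonormal_basis g u V in
  \sum_(i < \rank V) \sum_(j < \rank V | (i < j)%N)
    sectional g u (row i E) (row j E).

Definition chen_delta p g u (V : 'M[R]_(p, n)) : R :=
  tau g u V - inf (plane_curvatures g u V).

Definition grad g (F : 'rV[R]_n -> R) u : 'rV[R]_n :=
  (\row_i 'D_(delta_mx 0 i) F u) *m invmx (g u).

Definition divergence g X u : R :=
  \sum_(i < n) nabla g (cst (delta_mx 0 i)) X u 0 i.

Definition laplacian g (F : 'rV[R]_n -> R) u : R := - divergence g (grad g F) u.

End LocalGeometry.

(* F : (domain, g) -> (range, gt) is the local expression of an isometric
   immersion: h(x,y) is the derivative along x, for the connection of gt, of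
   dF(y), minus dF(nabla_x y), where x and y are extended by constants. *)
Definition second_ff (R : realType) n p (g : 'rV[R]_n -> 'M[R]_n)
    (gt : 'rV[R]_p -> 'M[R]_p) (F : 'rV[R]_n -> 'rV[R]_p) (u x y : 'rV[R]_n) :
    'rV[R]_p :=
  'D_x ('D_y F) u + Gamma gt (F u) ('D_x F u) ('D_y F u)
  - 'D_(nabla g (cst x) (cst y) u) F u.

Definition mean_curvature (R : realType) n p (g : 'rV[R]_n -> 'M[R]_n)
    (gt : 'rV[R]_p -> 'M[R]_p) (F : 'rV[R]_n -> 'rV[R]_p) (u : 'rV[R]_n) :
    'rV[R]_p :=
  let E := orthonormal_basis g u (1%:M : 'M[R]_n) in
  n%:R^-1 *: \sum_i second_ff g gt F u (row i E) (row i E).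

(* Only the values of [chart_map a] on [chart_dom a], and of [chart_inv a] on
   the image [chart_map a @` chart_dom a], are meaningful. *)
Record charted (R : realType) (n : nat) := Charted {
  pt :> topologicalType;
  chart : Type;
  chart_dom : chart -> set pt;
  chart_map : chart -> pt -> 'rV[R]_n;
  chart_inv : chart -> 'rV[R]_n -> pt
}.

Definition chart_range (R : realType) n (M : charted R n) (a : chart M) :
  set 'rV[R]_n := chart_map a @` chart_dom a.

Definition transition (R : realType) n (M : charted R n) (a b : chart M) :
  'rV[R]_n -> 'rV[R]_n := chart_map b \o chart_inv a.

Record is_manifold (R : realType) n (M : charted R n) : Prop := {
  manifold_hausdorff : hausdorff_space M;
  manifold_second_countable : @second_countable M;
  chart_cover : forall x : M, exists a : chart M, chart_dom a x;
  chart_dom_open : forall a : chart M, open (chart_dom a);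
  chart_range_open : forall a : chart M, open (chart_range a);
  chart_mapK : forall (a : chart M) x,
    chart_dom a x -> chart_inv a (chart_map a x) = x;
  chart_map_continuous : forall a : chart M,
    {within chart_dom a, continuous (chart_map a)};
  chart_inv_continuous : forall a : chart M,
    {within chart_range a, continuous (chart_inv a)};
  transition_smooth : forall a b : chart M,
    smooth_mx (chart_map a @` (chart_dom a `&` chart_dom b)) (transition a b)
}.

Record metric_charted (R : realType) (n : nat) := MetricCharted {
  metric_base :> charted R n;
  metric : chart metric_base -> 'rV[R]_n -> 'M[R]_n
}.

Record is_riemannian (R : realType) n (M : metric_charted R n) : Prop := {
  riemannian_manifold : is_manifold M;
  metric_smooth : forall a : chart M, smooth_mx (chart_range a) (metric a);
  metric_sym : forall (a : chart M) u, chart_range a u ->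
    (metric a u)^T = metric a u;
  metric_pos : forall (a : chart M) u, chart_range a u ->
    forall v : 'rV[R]_n, v != 0 -> 0 < inner (metric a) u v v;
  metric_transition : forall (a b : chart M) x,
    chart_dom a x -> chart_dom b x ->
    let D := 'J (transition a b) (chart_map a x) in
    metric a (chart_map a x) = D *m metric b (chart_map b x) *m D^T
}.

Definition smooth_fun (R : realType) n (M : charted R n) (f : M -> R) : Prop :=
  forall a : chart M, smooth (chart_range a) (f \o chart_inv a).

Definition local_map (R : realType) n p (M : charted R n) (N : charted R p)
    (phi : M -> N) (a : chart M) (b : chart N) : 'rV[R]_n -> 'rV[R]_p :=
  chart_map b \o phi \o chart_inv a.

Definition smooth_map (R : realType) n p (M : charted R n) (N : charted R p)
    (phi : M -> N) : Prop :=
  continuous phi /\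
  forall (a : chart M) (b : chart N),
    smooth_mx (chart_map a @` (chart_dom a `&` phi @^-1` chart_dom b))
      (local_map phi a b).

(* Preserving the metrics makes the differential injective, so that phi is an
   immersion. *)
Definition isometric_immersion (R : realType) n p (M : metric_charted R n)
    (N : metric_charted R p) (phi : M -> N) : Prop :=
  smooth_map phi /\
  forall (a : chart M) (b : chart N) x, chart_dom a x -> chart_dom b (phi x) ->
    let D := 'J (local_map phi a b) (chart_map a x) in
    D *m metric b (chart_map b (phi x)) *m D^T = metric a (chart_map a x).

Definition minimal (R : realType) n p (M : metric_charted R n)
    (N : metric_charted R p) (phi : M -> N) : Prop :=
  forall (a : chart M) (b : chart N) x, chart_dom a x -> chart_dom b (phi x) ->
    mean_curvature (metric a) (metric b) (local_map phi a b)
      (chart_map a x) = 0.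

(* J a u is the matrix of the complex structure in the chart a; the last clause
   is nabla_x (J y) = J (nabla_x y) for constant x, y, i.e. nabla J = 0. *)
Record is_kahler (R : realType) n (M : metric_charted R n)
    (J : chart M -> 'rV[R]_n -> 'M[R]_n) : Prop := {
  kahler_riemannian : is_riemannian M;
  J_smooth : forall a : chart M, smooth_mx (chart_range a) (J a);
  J_transition : forall (a b : chart M) x, chart_dom a x -> chart_dom b x ->
    let D := 'J (transition a b) (chart_map a x) in
    J a (chart_map a x) *m D = D *m J b (chart_map b x);
  J_square : forall (a : chart M) u, chart_range a u -> J a u *m J a u = - 1%:M;
  J_isometry : forall (a : chart M) u, chart_range a u ->
    J a u *m metric a u *m (J a u)^T = metric a u;
  J_parallel : forall (a : chart M) u, chart_range a u -> forall x y : 'rV[R]_n,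
    nabla (metric a) (cst x) (fun w => y *m J a w) u
    = nabla (metric a) (cst x) (cst y) u *m J a u
}.

Definition complex_space_form (R : realType) m (M : metric_charted R (2 * m))
    (J : chart M -> 'rV[R]_(2 * m) -> 'M[R]_(2 * m)) (c : R) : Prop :=
  is_kahler J /\
  forall (a : chart M) u, chart_range a u ->
    forall v : 'rV[R]_(2 * m), v != 0 ->
    sectional (metric a) u v (v *m J a u) = c.

Definition prod_charted (R : realType) n1 n2 (M1 : charted R n1)
    (M2 : charted R n2) : charted R (n1 + n2) :=
  @Charted R (n1 + n2) (M1 * M2)%type (chart M1 * chart M2)%type
    (fun ab => chart_dom ab.1 `*` chart_dom ab.2)
    (fun ab x => row_mx (chart_map ab.1 x.1) (chart_map ab.2 x.2))
    (fun ab u => (chart_inv ab.1 (lsubmx u), chart_inv ab.2 (rsubmx u))).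

Definition warped_product (R : realType) n1 n2 (M1 : metric_charted R n1)
    (M2 : metric_charted R n2) (f : M1 -> R) : metric_charted R (n1 + n2) :=
  @MetricCharted R (n1 + n2) (prod_charted M1 M2)
    (fun ab u => block_mx (metric ab.1 (lsubmx u)) 0
       0 (f (chart_inv ab.1 (lsubmx u)) ^+ 2 *: metric ab.2 (rsubmx u))).

(* The tangent spaces, in a product chart, to the copies of the first and of
   the second factor. *)
Definition tangentT (R : realType) n1 n2 : 'M[R]_(n1, n1 + n2) := row_mx 1%:M 0.
Definition tangentP (R : realType) n1 n2 : 'M[R]_(n2, n1 + n2) := row_mx 0 1%:M.

Record is_CR_warped_product (R : realType) n1 n2 m
    (NT : metric_charted R n1) (NP : metric_charted R n2) (f : NT -> R)
    (Mt : metric_charted R (2 * m))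
    (J : chart Mt -> 'rV[R]_(2 * m) -> 'M[R]_(2 * m))
    (phi : warped_product NP f -> Mt) : Prop := {
  CR_riemannianT : is_riemannian NT;
  CR_riemannianP : is_riemannian NP;
  CR_warping_smooth : smooth_fun f;
  CR_warping_pos : forall p, 0 < f p;
  CR_isometric : isometric_immersion phi;
  CR_holomorphic : forall (a : chart (warped_product NP f)) (b : chart Mt) x,
    chart_dom a x -> chart_dom b (phi x) ->
    let DT := tangentT R n1 n2 *m 'J (local_map phi a b) (chart_map a x) in
    (DT *m J b (chart_map b (phi x)) == DT)%MS;
  CR_totally_real : forall (a : chart (warped_product NP f)) (b : chart Mt) x,
    chart_dom a x -> chart_dom b (phi x) ->
    let D := 'J (local_map phi a b) (chart_map a x) in
    tangentP R n1 n2 *m D *m J b (chart_map b (phi x))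
      *m metric b (chart_map b (phi x)) *m D^T = 0
}.

(* Main.v *)
Require Import Defs.
From mathcomp Require Import all_boot all_order all_algebra.
From mathcomp Require Import all_classical all_reals all_analysis.
From mathcomp Require Import ring lra.

Set Implicit Arguments.
Unset Strict Implicit.
Unset Printing Implicit Defensive.

Import Order.TTheory GRing.Theory Num.Theory.
Import numFieldNormedType.Exports.

Local Open Scope classical_set_scope.
Local Open Scope ring_scope.

(** At a point x let t_i and e_j be orthonormal bases of the tangent spaces of
    the leaf N_T and of the fibre N_perp, let h be the second fundamental form,
    and put H_T = sum h(t_i, t_i) and H_P = sum h(e_j, e_j).

    The complex structure maps the vectors e_j to normal vectors, and in a
    complex space form R(x, y, y, x) equals
    c/4 (|x|^2 |y|^2 - <x, y>^2 + 3 <x, J y>^2) ([space_form_riemann]). So every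
    plane that contains a vertical vector has ambient curvature c/4, and Gauss's
    equation ([gauss_equation], [vertical_plane_gauss]) gives
      K(x, e) = c/4 + <h(x, x), h(e, e)> - |h(x, e)|^2
    for vertical e and orthonormal x, e. The mixed planes of a warped product
    have K(t, e) = - Hess f(t, t) / f ([riemann_warped_mixed]), so that the sum
    of all K(t_i, e_j) is n2 Delta f / f ([mixed_curvature_sum]). Adding the
    mixed and the vertical planes and removing one vertical plane pi spanned by
    X and Y, the constants c/4 add up to the right-hand side of the inequality
    and what remains is
      (|H_P|^2 - sum |h(e_i, e_j)|^2) / 2 + <H_T, H_P> - sum |h(t_i, e_j)|^2
        - kappa,
    where kappa = (<h(X, X), h(Y, Y)> - |h(X, Y)|^2) / |X /\ Y|^2. Minimality
    says H_T = - H_P, so the two terms in H_P and H_T add up to - |H_P|^2 / 2;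
    and Bessel's inequality for the components of h along pi
    ([plane_bound]) bounds - kappa by sum |h(e_i, e_j)|^2 / 2. Hence the
    remainder is at most 0 ([chen_algebraic_inequality]). As this holds for
    every plane pi, it bounds the difference of tau and of the infimum of the
    curvatures ([chen_delta_le]).

    The vertical curvatures are K(Y, Z) = (K_P(Y, Z) - |grad f|^2) / f^2
    ([sectional_warped_vertical]). The intrinsic inequality is therefore f^2
    times the same inequality, taken for an orthonormal basis of N_perp divided
    by f; the binomial(n2, 2) planes of tau and the removed plane account for the
    coefficient of |grad f|^2.

    The curvature identities all come from differentiating along a map F into a
    chart: [cov] is the covariant derivative of a field along F, and its
    commutator is the curvature of the target ([curvature_along]). For F the
    identity this yields the symmetries of the curvature tensor
    ([riemann_algebraic]) and, applied to the field z J, that the curvature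
    commutes with a parallel J ([curvature_mulmxJ]); for F the immersion and the
    fields D_z F it yields Gauss's equation, because <cov_x D_y F, D_z F> is
    determined by the induced metric through Koszul's formula
    ([koszul_along]). *)

(** * Directional derivatives of vector and matrix fields *)

Section Calculus.
Context (R : realType).

Lemma differentiable_mxP (V : normedModType R) p q (A : V -> 'M[R]_(p, q)) u :
  (forall i j, differentiable (fun w => A w i j) u) <-> differentiable A u.
Proof.
split=> [dA|dA i j]; last first.
  exact: (@differentiable_comp _ _ _ _ A (fun M : 'M[R]_(p, q) => M i j) u
            dA (differentiable_coord _ _ _)).
have -> : A = \sum_(i < p) \sum_(j < q)
    (fun w => A w i j *: (delta_mx i j : 'M[R]_(p, q))).
  apply/funext => w; rewrite fct_sumE [LHS]matrix_sum_delta.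
  by apply: eq_bigr => i _; rewrite fct_sumE.
apply: differentiable_sum => i; apply: differentiable_sum => j.
exact: differentiableZl.
Qed.

Lemma derive_entry (V : normedModType R) p q (A : V -> 'M[R]_(p, q)) u v i j :
  differentiable A u -> ('D_v A u) i j = 'D_v (fun w => A w i j) u.
Proof. by move=> dA; rewrite derive_mx ?mxE//; exact: diff_derivable. Qed.

Lemma derive_comp (U V W : normedModType R) (f : U -> V) (g : V -> W) u v :
  differentiable f u -> differentiable g (f u) ->
  'D_v (g \o f) u = 'D_('D_v f u) g (f u).
Proof.
move=> df dg; rewrite !deriveE//; last exact: differentiable_comp.
by rewrite diff_comp.
Qed.

Lemma derive_dirD (V W : normedModType R) (f : V -> W) u x y :
  differentiable f u -> 'D_(x + y) f u = 'D_x f u + 'D_y f u.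
Proof. by move=> df; rewrite !(deriveE _ df) linearD. Qed.

Lemma derive_dirZ (V W : normedModType R) (f : V -> W) u (k : R) x :
  differentiable f u -> 'D_(k *: x) f u = k *: 'D_x f u.
Proof. by move=> df; rewrite !(deriveE _ df) linearZ. Qed.

Lemma derive_dir_coord (W : normedModType R) n (f : 'rV[R]_n -> W) u x :
  differentiable f u -> 'D_x f u = \sum_i x 0 i *: 'D_(delta_mx 0 i) f u.
Proof.
move=> df; rewrite (deriveE _ df) [X in 'd f u X]row_sum_delta linear_sum.
by apply: eq_bigr => i _; rewrite linearZ deriveE.
Qed.

(** A plain predicate, since a second fundamental form is bilinear only at points
    where the metrics and the map are smooth. *)
Definition bilinear_at (U V W : lmodType R) (B : U -> V -> W) : Prop :=
  (forall y, linear (B^~ y)) /\ (forall x, linear (B x)).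

Section Bilin.
Context (U V W : lmodType R) (B : U -> V -> W) (hB : bilinear_at B).

Lemma bilD1 x x' y : B (x + x') y = B x y + B x' y.
Proof. by have := hB.1 y 1 x x'; rewrite !scale1r. Qed.
Lemma bil01 y : B 0 y = 0.
Proof. by apply: (addIr (B 0 y)); rewrite -bilD1 !add0r. Qed.
Lemma bilZ1 k x y : B (k *: x) y = k *: B x y.
Proof. by have := hB.1 y k x 0; rewrite bil01 !addr0. Qed.
Lemma bilN1 x y : B (- x) y = - B x y.
Proof. by rewrite -scaleN1r bilZ1 scaleN1r. Qed.
Lemma bilB1 x x' y : B (x - x') y = B x y - B x' y.
Proof. by rewrite bilD1 bilN1. Qed.
Lemma bilD2 x y y' : B x (y + y') = B x y + B x y'.
Proof. by have := hB.2 x 1 y y'; rewrite !scale1r. Qed.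
Lemma bil02 x : B x 0 = 0.
Proof. by apply: (addIr (B x 0)); rewrite -bilD2 !add0r. Qed.
Lemma bilZ2 k x y : B x (k *: y) = k *: B x y.
Proof. by have := hB.2 x k y 0; rewrite bil02 !addr0. Qed.
Lemma bilN2 x y : B x (- y) = - B x y.
Proof. by rewrite -scaleN1r bilZ2 scaleN1r. Qed.
Lemma bilB2 x y y' : B x (y - y') = B x y - B x y'.
Proof. by rewrite bilD2 bilN2. Qed.
Lemma bil_sum1 n (F : 'I_n -> U) y : B (\sum_i F i) y = \sum_i B (F i) y.
Proof. by apply: (big_morph (B^~ y)); [move=> ? ?; exact: bilD1 | exact: bil01]. Qed.
Lemma bil_sum2 n (F : 'I_n -> V) x : B x (\sum_i F i) = \sum_i B x (F i).
Proof. by apply: (big_morph (B x)); [move=> ? ?; exact: bilD2 | exact: bil02]. Qed.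
End Bilin.

Lemma bil_coord n p (W : lmodType R) (B : 'rV[R]_n -> 'rV[R]_p -> W) x y :
  bilinear_at B -> B x y =
  \sum_i \sum_j (x 0 i * y 0 j) *: B (delta_mx 0 i) (delta_mx 0 j).
Proof.
move=> hB; rewrite [X in B X _]row_sum_delta [X in B _ X]row_sum_delta.
rewrite (bil_sum1 hB); apply: eq_bigr => i _; rewrite (bil_sum2 hB).
by apply: eq_bigr => j _; rewrite (bilZ1 hB) (bilZ2 hB) scalerA.
Qed.

Section MatrixProduct.
Context (V : normedModType R).

Lemma differentiable_scalemx p q (f : V -> R) (G : V -> 'M[R]_(p, q)) u :
  differentiable f u -> differentiable G u ->
  differentiable (fun w => f w *: G w) u.
Proof.
move=> df /differentiable_mxP dG; apply/differentiable_mxP => i j.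
rewrite (_ : (fun w => _) = f * (fun w => G w i j)).
  exact: differentiableM.
by apply/funext => w; rewrite mxE.
Qed.

Lemma derive_scalemx p q (f : V -> R) (G : V -> 'M[R]_(p, q)) u v :
  differentiable f u -> differentiable G u ->
  'D_v (fun w => f w *: G w) u = 'D_v f u *: G u + f u *: 'D_v G u.
Proof.
move=> df dG; apply/matrixP => i j.
rewrite derive_entry; last exact: differentiable_scalemx.
have dGij := (differentiable_mxP G u).2 dG i j.
rewrite !mxE (_ : (fun w => _) = f * (fun w => G w i j)); last first.
  by apply/funext => w; rewrite mxE.
rewrite deriveM; [|exact: diff_derivable..].
by rewrite derive_entry// addrC; congr (_ + _); rewrite mulrC.
Qed.

End MatrixProduct.

Lemma bilinear_mx11 n p (B : 'rV[R]_n -> 'rV[R]_p -> R) :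
  bilinear_at B -> bilinear_at (fun x y => (B x y)%:M : 'M[R]_1).
Proof.
by move=> hB; split=> [y|x] k a b /=; rewrite ?hB.1 ?hB.2 raddfD/= -scale_scalar_mx.
Qed.

Section BilinField.
Context (V : normedModType R) (k n p r s : nat).
Context (B : 'rV[R]_k -> 'rV[R]_n -> 'rV[R]_p -> 'M[R]_(r, s)).
Context (F : V -> 'rV[R]_k).
Context (X : V -> 'rV[R]_n) (Y : V -> 'rV[R]_p) (u : V).
Hypothesis hB : forall w, bilinear_at (B w).
Hypothesis dB : forall x y, differentiable (fun w => B w x y) (F u).
Hypothesis (dF : differentiable F u) (dX : differentiable X u).
Hypothesis (dY : differentiable Y u).

Let Bexp : (fun w => B (F w) (X w) (Y w)) = \sum_i \sum_j
  (fun w => (X w 0 i * Y w 0 j) *: B (F w) (delta_mx 0 i) (delta_mx 0 j)).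
Proof.
apply/funext => w; rewrite fct_sumE (bil_coord _ _ (hB (F w))).
by apply: eq_bigr => i _; rewrite fct_sumE.
Qed.

Let dXY i j : differentiable (fun w => X w 0 i * Y w 0 j) u.
Proof.
apply: (@differentiableM _ _ (fun w => X w 0 i) (fun w => Y w 0 j)).
  exact: (differentiable_mxP X u).2.
exact: (differentiable_mxP Y u).2.
Qed.

Let dBF x y : differentiable (fun w => B (F w) x y) u.
Proof. exact: (@differentiable_comp _ _ _ _ F (fun w => B w x y)). Qed.

Lemma differentiable_bilin_field :
  differentiable (fun w => B (F w) (X w) (Y w)) u.
Proof.
rewrite Bexp; apply: differentiable_sum => i; apply: differentiable_sum => j.
exact: differentiable_scalemx.
Qed.

(** The product rule: the coefficients of the bilinear field are differentiated
    through F, the two arguments directly. *)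
Lemma derive_bilin_field v :
  'D_v (fun w => B (F w) (X w) (Y w)) u =
  'D_('D_v F u) (fun w => B w (X u) (Y u)) (F u)
  + B (F u) ('D_v X u) (Y u) + B (F u) (X u) ('D_v Y u).
Proof.
have dd i j : differentiable
    (fun w => (X w 0 i * Y w 0 j) *: B (F w) (delta_mx 0 i) (delta_mx 0 j)) u.
  exact: differentiable_scalemx.
rewrite Bexp derive_sum; last first.
  by move=> i; apply: diff_derivable; apply: differentiable_sum.
have -> : (fun w => B w (X u) (Y u)) = \sum_i \sum_j
    (fun w => (X u 0 i * Y u 0 j) *: B w (delta_mx 0 i) (delta_mx 0 j)).
  apply/funext => w; rewrite fct_sumE (bil_coord _ _ (hB w)).
  by apply: eq_bigr => i _; rewrite fct_sumE.
have dd' i j : differentiable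
    (fun w => (X u 0 i * Y u 0 j) *: B w (delta_mx 0 i) (delta_mx 0 j)) (F u).
  by apply: differentiableZ.
rewrite derive_sum; last first.
  by move=> i; apply: diff_derivable; apply: differentiable_sum.
rewrite [X in _ + X + _](bil_coord _ _ (hB (F u))).
rewrite [X in _ + X](bil_coord _ _ (hB (F u))) -!big_split/=.
apply: eq_bigr => i _.
rewrite !derive_sum; [|by move=> j; exact: diff_derivable..].
rewrite -!big_split/=; apply: eq_bigr => j _.
rewrite derive_scalemx// deriveZ; last exact: diff_derivable.
rewrite -(derive_comp (f := F) (g := fun w => B w _ _))//.
have dXi := (differentiable_mxP X u).2 dX 0 i.
have dYj := (differentiable_mxP Y u).2 dY 0 j.
rewrite (deriveM (f := fun w => X w 0 i) (g := fun w => Y w 0 j));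
  [|exact: diff_derivable..].
rewrite -!derive_entry// !scalerDl addrC -addrA; congr (_ + _).
by rewrite addrC; congr (_ *: _ + _ *: _); exact: mulrC.
Qed.
End BilinField.

End Calculus.

(** * Symmetry of second derivatives *)

Section Schwarz.
Context (R : realType) (V : normedModType R).

Lemma derive_line (f : V -> R) (a v : V) (s : R) :
  differentiable f (a + s *: v) ->
  is_derive s 1 (fun t => f (a + t *: v)) ('D_v f (a + s *: v)).
Proof.
move=> df.
have dl : is_derive s (1 : R) (fun t : R => a + t *: v) v.
  have := (@is_deriveD _ _ _ (cst a) (fun t : R => t *: v) s 1 0 v
    (is_derive_cst _ _ _)).
  rewrite add0r; apply.
  split; first exact: diff_derivable.
  by rewrite deriveE// diff_val scale1r.
have dl' : differentiable (fun t : R => a + t *: v) s.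
  by apply/derivable1_diffP.
split.
  apply/diff_derivable.
  exact: (@differentiable_comp _ _ _ _ (fun t : R => a + t *: v) f).
rewrite (derive_comp (f := fun t : R => a + t *: v) (g := f))//.
by rewrite derive_val.
Qed.

(** Applying the mean value theorem to s |-> f (u + t w + s v) - f (u + s v) turns
    the second difference of f into t times a difference of values of D_v f, which
    the differential of D_v f at u computes up to o(t). *)
Lemma second_difference (f : V -> R) u v w (e : R) :
  (\forall z \near u, differentiable f z) -> differentiable ('D_v f) u ->
  0 < e -> exists2 d : R, 0 < d & forall t, 0 < t -> t < d ->
    `|(f (u + t *: w + t *: v) - f (u + t *: v) - f (u + t *: w) + f u)
      - t ^+ 2 * 'D_w ('D_v f) u| <= e * t ^+ 2.
Proof.
move=> nf dDf e0.
(* Since c and c' lie in [0, t], C t bounds the lengths of all increments. *)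
pose C : R := `|v| + `|v| + `|w| + 1.
have C0 : 0 < C by rewrite ltr_wpDl// !addr_ge0.
have eC : 0 < e / C by rewrite divr_gt0.
have /nbhs_ballP[d1 /= d10 hd1] := nf.
have [rc /= hr] := (diff_locallyP u ('D_v f)).1 dDf.
have : \forall h \near 0, `|('D_v f) (h + u) - ('D_v f) u - 'd ('D_v f) u h|
    <= e / C * `|h|.
  have := hr => /eqaddoP /(_ _ eC); apply: filterS => h /=.
  by rewrite -![(_ - _ : _ -> _) _]/(_ - _) -![(_ + _ : _ -> _) _]/(_ + _) /= opprD addrA.
move=> /nbhs_ballP[d2 /= d20 hd2].
pose d := Num.min d1 d2 / C.
have d0 : 0 < d by rewrite divr_gt0// lt_min d10.
exists d => // t t0 td.
have tC : t * C < Num.min d1 d2 by rewrite -ltr_pdivlMr.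
have small c c' : 0 <= c -> c <= t -> 0 <= c' -> c' <= t ->
    `|c' *: w + c *: v| <= t * (`|w| + `|v|).
  move=> c0 ct c'0 c't; rewrite (le_trans (ler_normD _ _))// !normrZ.
  by rewrite !ger0_norm// mulrDr lerD// ler_wpM2r.
have tC' : t * (`|w| + `|v|) < Num.min d1 d2.
  apply: le_lt_trans tC; rewrite ler_pM2l// /C.
  have := normr_ge0 v; lra.
have hdiff c c' : 0 <= c -> c <= t -> 0 <= c' -> c' <= t ->
    differentiable f (u + c' *: w + c *: v).
  move=> c0 ct c'0 c't; apply: hd1; rewrite -ball_normE/= -addrA opprD addNKr normrN.
  apply: le_lt_trans (small _ _ c0 ct c'0 c't) _.
  by apply: lt_le_trans tC' _; rewrite ge_min lexx.
have hrem c c' : 0 <= c -> c <= t -> 0 <= c' -> c' <= t ->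
    `|'D_v f (u + c' *: w + c *: v) - 'D_v f u - 'd ('D_v f) u (c' *: w + c *: v)|
    <= e / C * `|c' *: w + c *: v|.
  move=> c0 ct c'0 c't.
  have := hd2 (c' *: w + c *: v); rewrite /= [_ + u]addrC addrA; apply.
  rewrite -ball_normE/= sub0r normrN.
  apply: le_lt_trans (small _ _ c0 ct c'0 c't) _.
  by apply: lt_le_trans tC' _; rewrite ge_min lexx orbT.
have t0' := ltW t0.
pose psi (s : R) := f (u + t *: w + s *: v) - f (u + 0 *: w + s *: v).
pose dpsi (s : R) := 'D_v f (u + t *: w + s *: v) - 'D_v f (u + 0 *: w + s *: v).
have dpsiP s : s \in `[0, t]%R -> is_derive s (1 : R) psi (dpsi s).
  rewrite in_itv/= => /andP[s0 st]; apply: is_deriveB.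
    by apply: derive_line; exact: hdiff.
  by apply: derive_line; exact: hdiff.
have cpsi : {within `[0, t], continuous psi}.
  by apply: derivable_within_continuous => s /dpsiP[].
have {}dpsiP s : s \in `]0, t[%R -> is_derive s (1 : R) psi (dpsi s).
  by rewrite in_itv/= => /andP[s0 st]; apply: dpsiP; rewrite in_itv/= !ltW.
have psiE s : psi s = f (u + t *: w + s *: v) - f (u + 0 *: w + s *: v) by [].
have dpsiE s :
  dpsi s = 'D_v f (u + t *: w + s *: v) - 'D_v f (u + 0 *: w + s *: v) by [].
clearbody psi dpsi.
have [c] := @MVT R psi dpsi 0 t t0 dpsiP cpsi.
rewrite in_itv/= => /andP[/ltW c0 /ltW ct].
rewrite subr0 !psiE !dpsiE !scale0r !addr0 => Hc.
set A := 'D_w ('D_v f) u.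
have -> : f (u + t *: w + t *: v) - f (u + t *: v) - f (u + t *: w) + f u
   = ('D_v f (u + t *: w + c *: v) - 'D_v f (u + c *: v)) * t.
  by rewrite -Hc opprB addrA addrAC.
have h1 := hrem c t c0 ct t0' (lexx _).
have h2 := hrem c 0 c0 ct (lexx _) t0'.
move: h2; rewrite scale0r add0r addr0 => h2.
have hA : 'd ('D_v f) u (t *: w + c *: v) - 'd ('D_v f) u (c *: v) = t * A.
  by rewrite linearD addrK linearZ /A deriveE.
set r1 := (X in `|X| <= _) in h1; set r2 := (X in `|X| <= _) in h2.
have -> : ('D_v f (u + t *: w + c *: v) - 'D_v f (u + c *: v)) * t - t ^+ 2 * A
    = (r1 - r2) * t.
  rewrite /r1 /r2 expr2 -mulrA -hA; ring.
rewrite normrM (ger0_norm t0') expr2 mulrA ler_pM2r//.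
have b1 := small c t c0 ct t0' (lexx _).
have b2 := small c 0 c0 ct (lexx _) t0'.
rewrite scale0r add0r in b2.
have b3 : `|c *: v| <= t * `|v| by rewrite normrZ ger0_norm// ler_wpM2r.
apply: (le_trans (ler_normB _ _)); apply: (le_trans (lerD h1 h2)).
rewrite -mulrDr -mulrA ler_pM2l// mulrC ler_pdivrMr//.
apply: (le_trans (lerD b1 b3)); rewrite /C; have := normr_ge0 v; nra.
Qed.

(** Young's theorem: the second difference is symmetric in v and w, so it has both
    iterated derivatives as its limit after division by t^2. *)
Lemma derive_comm (f : V -> R) u v w :
  (\forall z \near u, differentiable f z) ->
  differentiable ('D_v f) u -> differentiable ('D_w f) u ->
  'D_v ('D_w f) u = 'D_w ('D_v f) u.
Proof.
move=> nf dv dw; apply/eqP; rewrite -subr_eq0 -normr_le0.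
apply/ler_addgt0Pr => _/posnumP[e]; rewrite add0r.
have e2 : 0 < e%:num / 2 by rewrite divr_gt0.
have [d1 d10 h1] := second_difference w nf dv e2.
have [d2 d20 h2] := second_difference v nf dw e2.
pose t := Num.min d1 d2 / 2.
have m0 : 0 < Num.min d1 d2 by rewrite lt_min d10.
have t0 : 0 < t by rewrite divr_gt0.
have tm : t < Num.min d1 d2 by rewrite /t; lra.
have td1 : t < d1 by apply: lt_le_trans tm _; rewrite ge_min lexx.
have td2 : t < d2 by apply: lt_le_trans tm _; rewrite ge_min lexx orbT.
have {}h1 := h1 t t0 td1.
have {}h2 := h2 t t0 td2.
have -> : e%:num = e%:num / 2 + e%:num / 2 by rewrite -splitr.
rewrite -(ler_pM2r (exprn_gt0 2 t0)) [leRHS]mulrDl.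
apply: le_trans (lerD h1 h2).
rewrite -[X in _ * X <= _](ger0_norm (ltW (exprn_gt0 2 t0))) -normrM.
apply: le_trans (ler_normB _ _).
rewrite le_eqVlt; apply/orP; left; apply/eqP; congr (`|_|).
rewrite [u + t *: v + t *: w]addrAC.
move: (f _) (f (u + t *: v)) (f (u + t *: w)) (f u) => a1 a2 a3 a4.
move: ('D_v _ u) ('D_w _ u) => x y.
by rewrite mulrC mulrBr; ring.
Qed.

End Schwarz.

(** * Smooth functions on open sets *)

Section SmoothClosure.
Context (R : realType) (n : nat).
Implicit Types (U : set 'rV[R]_n) (f g : 'rV[R]_n -> R).

Lemma near_open U (P : 'rV[R]_n -> Prop) u :
  open U -> U u -> (forall w, U w -> P w) -> \forall w \near u, P w.
Proof. by move=> oU Uu UP; apply: filterS UP _; exact: open_nbhs_nbhs. Qed.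

(** [Ck] prescribes the values of partial derivatives only on U, hence smoothness
    has to be transported along equality on an open set; this is the first step. *)
Lemma near_eq_differentiable (V W : normedModType R) (f g : V -> W) u :
  (\forall w \near u, f w = g w) -> differentiable f u -> differentiable g u.
Proof.
move=> fg df.
have fgu : f u = g u by exact: (nbhs_singleton fg).
have /diff_locallyP[dc he] := df.
have hg : g \o shift u = cst (g u) + 'd f u +o_ 0 id.
  apply/eqaddoP => _/posnumP[e].
  have /eqaddoP /(_ e%:num) /(_ [gt0 of e%:num]) := he.
  have fg0 : \forall h \near 0, f (h + u) = g (h + u).
    have := fg; rewrite (near_shift 0) => H.
    by apply: filterS H => h /=; rewrite subr0.
  apply: filterS2 fg0 => h E.
  by rewrite -![(_ - _ : _ -> _) _]/(_ - _) -![(_ + _ : _ -> _) _]/(_ + _) /= E fgu.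
have E := diff_unique dc hg.
by apply/diff_locallyP; rewrite E.
Qed.

Lemma Ck_eq U k f g : open U -> (forall u, U u -> f u = g u) ->
  Ck k U f -> Ck k U g.
Proof.
move=> oU; elim: k f g => [|k IH] f g fg /=.
  move=> cf u Uu; have := cf u Uu.
  move=> cfu; rewrite /prop_for /continuous_at -(fg u Uu); apply: cvg_trans cfu.
  exact: (@near_eq_cvg _ _ (nbhs u) _ f g (near_open oU Uu fg)).
move=> [df Df]; split=> [u Uu|i].
  by apply: near_eq_differentiable (df u Uu); exact: (near_open oU Uu fg).
apply: IH (Df i) => u Uu; apply: near_eq_derive.
exact: (near_open oU Uu fg).
Qed.

Lemma Ck_sub U U' k f : U' `<=` U -> Ck k U f -> Ck k U' f.
Proof.
move=> UU'; elim: k f => [|k IH] f /=; first by move=> cf u /UU'/cf.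
by move=> [df Df]; split=> [u /UU'/df|i]; last exact: IH.
Qed.

Lemma smooth_eq U f g : open U -> (forall u, U u -> f u = g u) ->
  smooth U f -> smooth U g.
Proof. by move=> oU fg sf k; apply: Ck_eq fg (sf k). Qed.

Lemma smooth_sub U U' f : U' `<=` U -> smooth U f -> smooth U' f.
Proof. by move=> UU' sf k; apply: Ck_sub UU' (sf k). Qed.

Lemma smooth_diff U f u : smooth U f -> U u -> differentiable f u.
Proof. by move=> sf; exact: (sf 1%N).1. Qed.

Lemma smooth_partial U f i : smooth U f -> smooth U ('D_(delta_mx 0 i) f).
Proof. by move=> sf k; exact: (sf k.+1).2. Qed.

Lemma smooth_cst U c : smooth U (cst c).
Proof.
move=> k; elim: k c => [|k IH] c /=; first by move=> u _; exact: cst_continuous.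
split=> [u _|i]; first exact: differentiable_cst.
rewrite (_ : 'D_(delta_mx 0 i) (cst c) = cst 0); first exact: IH.
by apply/funext => u /=; rewrite derive_cst.
Qed.

Lemma smoothD U f g : open U -> smooth U f -> smooth U g ->
  smooth U (fun w => f w + g w).
Proof.
move=> oU sf sg k; elim: k f g sf sg => [|k IH] f g sf sg /=.
  by move=> u Uu; apply: continuousD; [exact: (sf 0%N)|exact: (sg 0%N)].
split=> [u Uu|i].
  by apply: differentiableD; [exact: smooth_diff sf Uu|exact: smooth_diff sg Uu].
apply: (Ck_eq oU _ (IH _ _ (smooth_partial i sf) (smooth_partial i sg))).
move=> u Uu; rewrite deriveD//; apply: diff_derivable.
  exact: smooth_diff sf Uu.
exact: smooth_diff sg Uu.
Qed.

Lemma smoothM U f g : open U -> smooth U f -> smooth U g ->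
  smooth U (fun w => f w * g w).
Proof.
move=> oU sf sg k.
suff: forall f g, smooth U f -> smooth U g -> Ck k U (fun w => f w * g w).
  by apply.
have CkD j f1 f2 : Ck j U f1 -> Ck j U f2 -> Ck j U (fun w => f1 w + f2 w).
  elim: j f1 f2 => [|j IHj] f1 f2 /=.
    by move=> c1 c2 u Uu; apply: continuousD; [exact: c1|exact: c2].
  move=> [d1 D1] [d2 D2]; split=> [u Uu|i].
    by apply: differentiableD; [exact: d1|exact: d2].
  apply: (Ck_eq oU _ (IHj _ _ (D1 i) (D2 i))) => u Uu.
  by rewrite deriveD//; apply: diff_derivable; [exact: d1|exact: d2].
elim: k {f g sf sg} => [|k IH] f g sf sg /=.
  by move=> u Uu; apply: continuousM; [exact: (sf 0%N)|exact: (sg 0%N)].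
split=> [u Uu|i].
  by apply: (@differentiableM _ _ f g);
    [exact: smooth_diff sf Uu|exact: smooth_diff sg Uu].
apply: (Ck_eq oU _ (CkD _ _ _ (IH _ _ sf (smooth_partial i sg))
  (IH _ _ sg (smooth_partial i sf)))) => u Uu.
rewrite (deriveM (f := f) (g := g))//; apply: diff_derivable.
  exact: smooth_diff sf Uu.
exact: smooth_diff sg Uu.
Qed.

Lemma smoothZ U c f : open U -> smooth U f -> smooth U (fun w => c * f w).
Proof. by move=> oU; apply: smoothM => //; exact: smooth_cst. Qed.

Lemma smooth_sum U m (F : 'I_m -> 'rV[R]_n -> R) : open U ->
  (forall i, smooth U (F i)) -> smooth U (fun w => \sum_i F i w).
Proof.
move=> oU sF; rewrite (_ : (fun w => _) = \sum_i F i); last first.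
  by apply/funext => w; rewrite fct_sumE.
elim/big_ind : _ => //; first exact: smooth_cst.
by move=> f g sf sg; exact: smoothD.
Qed.

(** The definition of smoothness mentions only coordinate directions; the other
    directional derivatives are linear combinations of those. *)
Lemma smooth_derive U f v : open U -> smooth U f -> smooth U ('D_v f).
Proof.
move=> oU sf.
apply: (smooth_eq oU _ (f := fun w => \sum_i v 0 i * 'D_(delta_mx 0 i) f w)).
  by move=> u Uu; rewrite derive_dir_coord//; exact: smooth_diff sf Uu.
by apply: smooth_sum => // i; apply: smoothZ => //; exact: smooth_partial.
Qed.

Lemma smooth_mx_diff U p q (F : 'rV[R]_n -> 'M[R]_(p, q)) u :
  smooth_mx U F -> U u -> differentiable F u.
Proof.
by move=> sF Uu; apply/differentiable_mxP => i j; exact: smooth_diff (sF i j) Uu.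
Qed.

Lemma smooth_mx_derive U p q (F : 'rV[R]_n -> 'M[R]_(p, q)) v :
  open U -> smooth_mx U F -> smooth_mx U ('D_v F).
Proof.
move=> oU sF i j.
apply: (smooth_eq oU _ (smooth_derive v oU (sF i j))) => u Uu.
by rewrite derive_entry//; exact: smooth_mx_diff sF Uu.
Qed.

Lemma smooth_derive_comm U f u v w : open U -> smooth U f -> U u ->
  'D_v ('D_w f) u = 'D_w ('D_v f) u.
Proof.
move=> oU sf Uu; apply: derive_comm.
- by apply: (near_open oU Uu) => z; exact: smooth_diff.
- exact: smooth_diff (smooth_derive _ oU sf) Uu.
- exact: smooth_diff (smooth_derive _ oU sf) Uu.
Qed.

Lemma smooth_mx_derive_comm U p q (F : 'rV[R]_n -> 'M[R]_(p, q)) u v w :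
  open U -> smooth_mx U F -> U u -> 'D_v ('D_w F) u = 'D_w ('D_v F) u.
Proof.
move=> oU sF Uu; apply/matrixP => i j.
have dD x : differentiable ('D_x F) u.
  exact: smooth_mx_diff (smooth_mx_derive x oU sF) Uu.
have E x y : ('D_x ('D_y F) u) i j = 'D_x ('D_y (fun z => F z i j)) u.
  rewrite (derive_entry _ _ _ (dD y)).
  apply: near_eq_derive; apply: filterS (near_open oU Uu (fun z Uz => Uz)) => z Uz.
  by rewrite derive_entry//; exact: smooth_mx_diff sF Uz.
apply: etrans (E v w) (etrans _ (esym (E w v))).
exact: smooth_derive_comm (sF i j) Uu.
Qed.

End SmoothClosure.

(** * Metrics, Koszul's formula and Christoffel symbols *)

Section MatrixInverse.
Context (R : realType) (V : normedModType R).

Lemma differentiable_mul (f h : V -> R) u :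
  differentiable f u -> differentiable h u ->
  differentiable (fun w => f w * h w) u.
Proof. exact: differentiableM. Qed.

Lemma differentiable_cmul (c : R) (h : V -> R) u :
  differentiable h u -> differentiable (fun w => c * h w) u.
Proof. by apply: differentiable_mul; exact: differentiable_cst. Qed.

Lemma differentiable_prod (I : Type) (r : seq I) (F : I -> V -> R) u :
  (forall i, differentiable (F i) u) ->
  differentiable (fun w => \prod_(i <- r) F i w) u.
Proof.
move=> dF; elim: r => [|i r IH].
  rewrite (_ : (fun w => _) = cst 1); first exact: differentiable_cst.
  by apply/funext => w; rewrite big_nil.
rewrite (_ : (fun w => _) = F i * (fun w => \prod_(i <- r) F i w)).
  exact: differentiableM.
by apply/funext => w; rewrite big_cons.
Qed.

Lemma differentiable_bigsum (I : Type) (r : seq I) (F : I -> V -> R) u :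
  (forall i, differentiable (F i) u) ->
  differentiable (fun w => \sum_(i <- r) F i w) u.
Proof.
move=> dF; elim: r => [|i r IH].
  rewrite (_ : (fun w => _) = cst 0); first exact: differentiable_cst.
  by apply/funext => w; rewrite big_nil.
rewrite (_ : (fun w => _) = F i + (fun w => \sum_(i <- r) F i w)).
  exact: differentiableD.
by apply/funext => w; rewrite big_cons.
Qed.

Lemma differentiable_det n (A : V -> 'M[R]_n) u :
  differentiable A u -> differentiable (fun w => \det (A w)) u.
Proof.
move=> dA; apply: differentiable_bigsum => s.
apply: differentiable_cmul.
by apply: differentiable_prod => i; exact: (differentiable_mxP A u).2.
Qed.

(** Cramer's rule. *)
Lemma differentiable_invmx n (A : V -> 'M[R]_n) u :
  differentiable A u -> (\forall w \near u, A w \in unitmx) ->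
  differentiable (fun w => invmx (A w)) u.
Proof.
move=> dA uA.
have uAu : A u \in unitmx := nbhs_singleton uA.
apply: (near_eq_differentiable (f := fun w => (\det (A w))^-1 *: \adj (A w))).
  by apply: filterS uA => w Aw; rewrite /invmx Aw.
apply: differentiable_scalemx.
  apply: (@differentiableV _ _ (fun w => \det (A w))).
    exact: differentiable_det.
  by rewrite -unitfE -unitmxE.
apply/differentiable_mxP => i j.
under eq_fun do rewrite mxE /cofactor.
apply: differentiable_cmul; apply: differentiable_det; apply/differentiable_mxP => k l.
under eq_fun do rewrite !mxE.
exact: (differentiable_mxP A u).2.
Qed.

End MatrixInverse.

Section Inner.
Context (R : realType) (n : nat).
Implicit Types (g : 'rV[R]_n -> 'M[R]_n).

Lemma linear_form_coord (f : 'rV[R]_n -> R) z : linear f ->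
  f z = \sum_i z 0 i * f (delta_mx 0 i).
Proof.
move=> lf; have fD x y : f (x + y) = f x + f y.
  by have := lf 1 x y; rewrite !scale1r.
have f0 : f 0 = 0 by apply: (addIr (f 0)); rewrite -fD !add0r.
rewrite [X in f X]row_sum_delta (big_morph f fD f0); apply: eq_bigr => i _.
by have := lf (z 0 i) (delta_mx 0 i) 0; rewrite f0 !addr0.
Qed.

Lemma inner_bilinear g u : bilinear_at (inner g u).
Proof.
split=> [y|x] k a b; rewrite /inner.
  by rewrite !mulmxDl -!scalemxAl mxE mxE.
by rewrite linearD linearZ/= mulmxDr -scalemxAr mxE mxE.
Qed.

Lemma innerC g u x y : (g u)^T = g u -> inner g u x y = inner g u y x.
Proof.
move=> gT; rewrite /inner.
have -> : (x *m g u *m y^T) 0 0 = (x *m g u *m y^T)^T 0 0 by rewrite [RHS]mxE.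
by rewrite !trmx_mul trmxK gT mulmxA.
Qed.

Lemma inner_delta g u i j :
  inner g u (delta_mx 0 i) (delta_mx 0 j) = g u i j.
Proof. by rewrite /inner -rowE trmx_delta -colE !mxE. Qed.

Lemma inner_coord g u x y :
  inner g u x y = \sum_i \sum_j (x 0 i * y 0 j) * g u i j.
Proof.
rewrite (bil_coord _ _ (inner_bilinear g u)); apply: eq_bigr => i _.
by apply: eq_bigr => j _; rewrite inner_delta.
Qed.

Lemma inner_mul k (g : 'rV[R]_n -> 'M[R]_n) u (x y : 'rV[R]_k) (A B : 'M[R]_(k, n)) :
  inner g u (x *m A) (y *m B) = (x *m (A *m g u *m B^T) *m y^T) 0 0.
Proof. by rewrite /inner trmx_mul !mulmxA. Qed.

Lemma differentiable_inner g u x y : differentiable g u ->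
  differentiable (fun w => inner g w x y) u.
Proof.
move=> dg; under eq_fun do rewrite inner_coord.
apply: differentiable_bigsum => i; apply: differentiable_bigsum => j.
apply: differentiable_cmul; exact: (differentiable_mxP g u).2.
Qed.

Lemma derive_inner g u v x y : differentiable g u ->
  'D_v (fun w => inner g w x y) u = inner ('D_v g) u x y.
Proof.
move=> dg; rewrite [RHS]inner_coord.
rewrite (_ : (fun w => _) = \sum_i \sum_j
  ((x 0 i * y 0 j) *: (fun w => g w i j))); last first.
  apply/funext => w; rewrite inner_coord fct_sumE; apply: eq_bigr => i _.
  by rewrite fct_sumE.
have dgij i j := (differentiable_mxP g u).2 dg i j.
rewrite derive_sum; last first.
  move=> i; apply: derivable_sum => j; apply: derivableZ; exact: diff_derivable.
apply: eq_bigr => i _; rewrite derive_sum; last first.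
  move=> j; apply: derivableZ; exact: diff_derivable.
apply: eq_bigr => j _; rewrite deriveZ ?derive_entry//.
exact: diff_derivable.
Qed.

Lemma smooth_inner U g x y : open U -> smooth_mx U g ->
  smooth U (fun w => inner g w x y).
Proof.
move=> oU sg; under eq_fun do rewrite inner_coord.
apply: smooth_sum => // i; apply: smooth_sum => // j.
exact: smoothZ.
Qed.

End Inner.

Section Christoffel.
Context (R : realType) (n : nat).
Implicit Types (g : 'rV[R]_n -> 'M[R]_n) (U : set 'rV[R]_n).

Record metric_on U g : Prop := MetricOn {
  mo_open : open U;
  mo_smooth : smooth_mx U g;
  mo_sym : forall u, U u -> (g u)^T = g u;
  mo_unit : forall u, U u -> g u \in unitmx
}.

(** The value <nabla_x y, z> which Koszul's formula assigns to constant fields. *)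
Definition koszul g u x y z : R :=
  2^-1 * ('D_x (fun w => inner g w y z) u + 'D_y (fun w => inner g w x z) u
          - 'D_z (fun w => inner g w x y) u).

Lemma koszulE g u x y z : differentiable g u -> koszul g u x y z =
  2^-1 * (inner ('D_x g) u y z + inner ('D_y g) u x z - inner ('D_z g) u x y).
Proof. by move=> dg; rewrite /koszul !derive_inner. Qed.

Lemma inner_metricD g1 g2 g3 u x y : g1 u = g2 u + g3 u ->
  inner g1 u x y = inner g2 u x y + inner g3 u x y.
Proof. by rewrite /inner => ->; rewrite mulmxDr mulmxDl mxE. Qed.

Lemma inner_metricZ g1 g2 k u x y : g1 u = k *: g2 u ->
  inner g1 u x y = k * inner g2 u x y.
Proof. by rewrite /inner => ->; rewrite -scalemxAr -scalemxAl mxE. Qed.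

Lemma inner_deriveD g u a b x y : differentiable g u ->
  inner ('D_(a + b) g) u x y = inner ('D_a g) u x y + inner ('D_b g) u x y.
Proof. by move=> dg; apply: inner_metricD; exact: derive_dirD. Qed.

Lemma inner_deriveZ g u k a x y : differentiable g u ->
  inner ('D_(k *: a) g) u x y = k * inner ('D_a g) u x y.
Proof. by move=> dg; apply: inner_metricZ; exact: derive_dirZ. Qed.

Lemma inner_linl g u k a b c :
  inner g u (k *: a + b) c = k * inner g u a c + inner g u b c.
Proof. exact: (inner_bilinear g u).1. Qed.

Lemma inner_linr g u k a b c :
  inner g u c (k *: a + b) = k * inner g u c a + inner g u c b.
Proof. exact: (inner_bilinear g u).2. Qed.

Lemma inner_deriveP g u k a b x y : differentiable g u ->
  inner ('D_(k *: a + b) g) u x y =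
  k * inner ('D_a g) u x y + inner ('D_b g) u x y.
Proof.
move=> dg; rewrite (inner_deriveD (k *: a) b x y dg).
by rewrite (inner_deriveZ k a x y dg).
Qed.

Lemma trilinear_koszul (T : 'rV[R]_n -> 'rV[R]_n -> 'rV[R]_n -> R)
    (K := fun x y z => 2^-1 * (T x y z + T y x z - T z x y)) :
  (forall k a b x y, T (k *: a + b) x y = k * T a x y + T b x y) ->
  (forall k a b x y, T x (k *: a + b) y = k * T x a y + T x b y) ->
  (forall k a b x y, T x y (k *: a + b) = k * T x y a + T x y b) ->
  [/\ forall k a b y z, K (k *: a + b) y z = k * K a y z + K b y z,
      forall k a b x z, K x (k *: a + b) z = k * K x a z + K x b z &
      forall k a b x y, K x y (k *: a + b) = k * K x y a + K x y b].
Proof.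
move=> T1 T2 T3; rewrite /K; split=> k a b x y; rewrite T1.
- by rewrite T2 T2; ring.
- by rewrite T2 T3; ring.
- by rewrite T3 T3; ring.
Qed.

Lemma koszul_trilinear g u : differentiable g u ->
  [/\ forall k a b y z,
        koszul g u (k *: a + b) y z = k * koszul g u a y z + koszul g u b y z,
      forall k a b x z,
        koszul g u x (k *: a + b) z = k * koszul g u x a z + koszul g u x b z &
      forall k a b x y,
        koszul g u x y (k *: a + b) = k * koszul g u x y a + koszul g u x y b].
Proof.
move=> dg.
have [||| K1 K2 K3] := @trilinear_koszul (fun a x y => inner ('D_a g) u x y).
- by move=> *; exact: inner_deriveP.
- by move=> *; exact: inner_linl.
- by move=> *; exact: inner_linr.
have E x y z := koszulE x y z dg.
split=> k a b x y; rewrite !E; [exact: K1|exact: K2|exact: K3].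
Qed.

Lemma koszul_bilinear g u z : differentiable g u ->
  bilinear_at (fun x y => koszul g u x y z).
Proof.
by move=> dg; split=> [y|x] k a b; case: (koszul_trilinear dg).
Qed.

Lemma koszul_linear g u x y : differentiable g u ->
  linear (koszul g u x y).
Proof. by move=> dg k a b; case: (koszul_trilinear dg). Qed.

(** The components of [Gamma] are the values of Koszul's formula on the coordinate
    fields, raised with the inverse metric; bilinearity extends this from
    coordinate vectors to x and y. *)
Lemma Gamma_koszul g u x y : differentiable g u ->
  Gamma g u x y = (\row_l koszul g u x y (delta_mx 0 l)) *m (invmx (g u))^T.
Proof.
move=> dg; apply/rowP => k; rewrite !mxE.
under [RHS]eq_bigr => l _.
  rewrite !mxE (bil_coord _ _ (koszul_bilinear (delta_mx 0 l) dg)).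
  rewrite mulr_suml.
  under eq_bigr => i _ do rewrite mulr_suml.
  over.
rewrite [RHS]exchange_big; apply: eq_bigr => i _.
rewrite [RHS]exchange_big; apply: eq_bigr => j _.
rewrite /christoffel !big_distrr/= !big_distrl/=; apply: eq_bigr => l _.
rewrite /koszul.
have E a b : (fun w => inner g w (delta_mx 0 a) (delta_mx 0 b)) =
    (fun w => g w a b) by apply/funext => w; rewrite inner_delta.
rewrite !E -![_ *: _]/(_ * _). ring.
Qed.

Lemma Gamma_bilinear g u : bilinear_at (Gamma g u).
Proof.
split=> [y|x] k a b; apply/rowP => l; rewrite !mxE big_distrr -big_split/=;
  apply: eq_bigr => i _; rewrite big_distrr -big_split/=;
  apply: eq_bigr => j _; rewrite !mxE; ring.
Qed.

Lemma inner_Gamma g u x y z : differentiable g u -> (g u)^T = g u ->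
  g u \in unitmx -> inner g u (Gamma g u x y) z = koszul g u x y z.
Proof.
move=> dg gT gU; rewrite Gamma_koszul// /inner -(mulmxA _ _ (g u)).
have -> : (invmx (g u))^T *m g u = 1%:M.
  by rewrite -[X in _ *m X]gT -trmx_mul mulmxV// trmx1.
rewrite mulmx1 mxE.
rewrite (linear_form_coord z (koszul_linear x y dg)).
by apply: eq_bigr => i _; rewrite !mxE mulrC.
Qed.

Section OnOpen.
Context (U : set 'rV[R]_n) (g : 'rV[R]_n -> 'M[R]_n) (hg : metric_on U g).

Lemma metric_diff u : U u -> differentiable g u.
Proof. exact: smooth_mx_diff (mo_smooth hg). Qed.

Lemma inner_GammaE u x y z : U u ->
  inner g u (Gamma g u x y) z = koszul g u x y z.
Proof.
move=> Uu; apply: inner_Gamma.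
- exact: metric_diff.
- exact: mo_sym hg _ Uu.
- exact: mo_unit hg _ Uu.
Qed.

Lemma innerCE u x y : U u -> inner g u x y = inner g u y x.
Proof. by move=> Uu; apply: innerC; exact: mo_sym hg _ Uu. Qed.

Lemma derive_innerC u x y z : U u ->
  'D_x (fun w => inner g w y z) u = 'D_x (fun w => inner g w z y) u.
Proof.
move=> Uu; apply: near_eq_derive; apply: (near_open (mo_open hg) Uu) => w Uw.
exact: innerCE.
Qed.

Lemma koszulC u x y z : U u -> koszul g u x y z = koszul g u y x z.
Proof.
move=> Uu; rewrite /koszul (derive_innerC z x y Uu).
by congr (_ * (_ - _)); rewrite addrC.
Qed.

Lemma GammaC u x y : U u -> Gamma g u x y = Gamma g u y x.
Proof.
move=> Uu; rewrite !Gamma_koszul; [|exact: metric_diff..].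
by congr (_ *m _); apply/rowP => l; rewrite !mxE koszulC.
Qed.

(** Metric compatibility for constant fields: in the sum of the two Koszul
    expressions all terms cancel except the derivative along a. *)
Lemma derive_inner_Gamma u a x y : U u ->
  'D_a (fun w => inner g w x y) u =
  inner g u (Gamma g u a x) y + inner g u x (Gamma g u a y).
Proof.
move=> Uu; rewrite (innerCE x _ Uu) !inner_GammaE// /koszul.
rewrite (derive_innerC a y x Uu).
set A := 'D_a _ u; set X := 'D_x _ u; set Y := 'D_y _ u.
by move: A X Y => A X Y; lra.
Qed.

Lemma differentiable_Gamma u x y : U u ->
  differentiable (fun w => Gamma g w x y) u.
Proof.
move=> Uu; apply/differentiable_mxP => i k.
under eq_fun do rewrite mxE.
apply: differentiable_bigsum => a; apply: differentiable_bigsum => b.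
apply: differentiable_mul; last exact: differentiable_cst.
apply: differentiable_mul; last exact: differentiable_cst.
rewrite /christoffel.
apply: differentiable_cmul.
apply: differentiable_bigsum => l; apply: differentiable_mul.
  apply: (differentiable_mxP (fun w => invmx (g w)) u).2.
  apply: differentiable_invmx; first exact: metric_diff.
  exact: (near_open (mo_open hg) Uu (mo_unit hg)).
have dD e c d : differentiable ('D_e (fun w => g w c d)) u.
  exact: smooth_diff (smooth_derive e (mo_open hg) (mo_smooth hg c d)) Uu.
apply: (@differentiableB _ _ _ (fun w => _ + _)); last exact: dD.
by apply: (@differentiableD _ _ _ ('D__ _) ('D__ _)); exact: dD.
Qed.

End OnOpen.
End Christoffel.

(** * Covariant derivatives along a map *)

(** The covariant derivative along x of a field X of tangent vectors of the target
    of F, with base points F u. *)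
Definition cov (R : realType) k n (g : 'rV[R]_n -> 'M[R]_n)
    (F : 'rV[R]_k -> 'rV[R]_n) (x : 'rV[R]_k) (X : 'rV[R]_k -> 'rV[R]_n)
    (u : 'rV[R]_k) : 'rV[R]_n :=
  'D_x X u + Gamma g (F u) ('D_x F u) (X u).

Section CurvatureFormula.
Context (R : realType) (n : nat).

Lemma nabla_cst (g : 'rV[R]_n -> 'M[R]_n) x y u :
  nabla g (cst x) (cst y) u = Gamma g u x y.
Proof. by rewrite /nabla /= derive_cst add0r. Qed.

Lemma curvatureE (g : 'rV[R]_n -> 'M[R]_n) u x y z : curvature g u x y z =
  ('D_x (fun w => Gamma g w y z) u + Gamma g u x (Gamma g u y z))
  - ('D_y (fun w => Gamma g w x z) u + Gamma g u y (Gamma g u x z)).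
Proof.
have E a b : nabla g (cst a) (cst b) = (fun w => Gamma g w a b).
  by apply/funext => w; rewrite nabla_cst.
by rewrite /curvature !E.
Qed.

End CurvatureFormula.

Section AlongMap.
Context (R : realType) (k n : nat) (U : set 'rV[R]_k) (W : set 'rV[R]_n).
Context (g : 'rV[R]_n -> 'M[R]_n) (F : 'rV[R]_k -> 'rV[R]_n).
Hypothesis (oU : open U) (hg : metric_on W g) (sF : smooth_mx U F).
Hypothesis FUW : forall u, U u -> W (F u).

Let dF u (Uu : U u) : differentiable F u := smooth_mx_diff sF Uu.
Let sDF x : smooth_mx U ('D_x F) := smooth_mx_derive x oU sF.
Let dDF x u (Uu : U u) : differentiable ('D_x F) u := smooth_mx_diff (sDF x) Uu.

Section PointFields.
Context (X Y : 'rV[R]_k -> 'rV[R]_n) (u : 'rV[R]_k) (Uu : U u).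
Hypothesis (dX : differentiable X u) (dY : differentiable Y u).

Lemma differentiable_Gamma_field :
  differentiable (fun w => Gamma g (F w) (X w) (Y w)) u.
Proof.
apply: (differentiable_bilin_field (B := Gamma g)) => //.
- by move=> w; exact: Gamma_bilinear.
- by move=> x y; exact: (differentiable_Gamma hg x y (FUW Uu)).
- exact: dF.
Qed.

Lemma derive_Gamma_field v :
  'D_v (fun w => Gamma g (F w) (X w) (Y w)) u =
  'D_('D_v F u) (fun w => Gamma g w (X u) (Y u)) (F u)
  + Gamma g (F u) ('D_v X u) (Y u) + Gamma g (F u) (X u) ('D_v Y u).
Proof.
apply: (derive_bilin_field (B := Gamma g)) => //.
- by move=> w; exact: Gamma_bilinear.
- by move=> x y; exact: (differentiable_Gamma hg x y (FUW Uu)).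
- exact: dF.
Qed.

Let inner1 w x y : 'M[R]_1 := (inner g w x y)%:M.

Let inner1_bil w : bilinear_at (inner1 w).
Proof. by apply: bilinear_mx11; exact: inner_bilinear. Qed.

Let inner1_diff x y v : W v -> differentiable (fun w => inner1 w x y) v.
Proof.
move=> Wv; apply/differentiable_mxP => i j; rewrite !ord1.
under eq_fun do rewrite mxE eqxx mulr1n.
by apply: differentiable_inner; exact: metric_diff hg _ Wv.
Qed.

Lemma derive_inner_field v :
  'D_v (fun w => inner g (F w) (X w) (Y w)) u =
  'D_('D_v F u) (fun w => inner g w (X u) (Y u)) (F u)
  + inner g (F u) ('D_v X u) (Y u) + inner g (F u) (X u) ('D_v Y u).
Proof.
have di : differentiable (fun w => inner1 (F w) (X w) (Y w)) u.
  apply: (differentiable_bilin_field (B := inner1)) => //; last exact: dF.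
  by move=> x y; exact: inner1_diff (FUW Uu).
have dj : differentiable (fun w => inner1 w (X u) (Y u)) (F u).
  exact: inner1_diff (FUW Uu).
have : ('D_v (fun w => inner1 (F w) (X w) (Y w)) u) 0 0 =
  ('D_('D_v F u) (fun w => inner1 w (X u) (Y u)) (F u)
  + inner1 (F u) ('D_v X u) (Y u) + inner1 (F u) (X u) ('D_v Y u)) 0 0.
  congr (fun_of_matrix _ 0 0).
  apply: (derive_bilin_field (B := inner1)) => //; last exact: dF.
  by move=> x y; exact: inner1_diff (FUW Uu).
rewrite (derive_entry _ _ _ di) 2!mxE (derive_entry _ _ _ dj).
under eq_fun do rewrite mxE eqxx mulr1n.
under [X in 'D__ X (F u)]eq_fun do rewrite mxE eqxx mulr1n.
by rewrite !mxE eqxx !mulr1n.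
Qed.

(** Metric compatibility: the derivative of the coefficients of g is absorbed by the
    Christoffel terms of both covariant derivatives. *)
Lemma derive_inner_cov v :
  'D_v (fun w => inner g (F w) (X w) (Y w)) u =
  inner g (F u) (cov g F v X u) (Y u) + inner g (F u) (X u) (cov g F v Y u).
Proof.
rewrite derive_inner_field (derive_inner_Gamma hg _ _ _ (FUW Uu)).
rewrite /cov (bilD1 (inner_bilinear g (F u))) (bilD2 (inner_bilinear g (F u))).
set a := inner g _ (Gamma _ _ _ _) _; set b := inner g _ _ (Gamma _ _ _ _).
set c := inner g _ ('D_v X u) _; set d := inner g _ _ ('D_v Y u).
by move: a b c d => a b c d; ring.
Qed.

End PointFields.

Lemma differentiable_cov X y u : smooth_mx U X -> U u ->
  differentiable (cov g F y X) u.
Proof.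
move=> sX Uu; apply: (@differentiableD _ _ _ ('D_y X)
  (fun w => Gamma g (F w) ('D_y F w) (X w))).
  exact: smooth_mx_diff (smooth_mx_derive y oU sX) Uu.
apply: differentiable_Gamma_field => //; first exact: dDF.
exact: smooth_mx_diff sX Uu.
Qed.

Lemma cov_torsion_free x y u : U u -> cov g F x ('D_y F) u = cov g F y ('D_x F) u.
Proof.
move=> Uu; apply: (f_equal2 +%R); last exact: (GammaC hg _ _ (FUW Uu)).
exact: (smooth_mx_derive_comm x y oU sF Uu).
Qed.

Let cancel_symmetric (p p' q q' d d' r s t t' : 'rV[R]_n) : p = p' -> q = q' ->
  (p + (d + q + r) + (s + t)) - (p' + (d' + q' + s) + (r + t')) =
  (d + t) - (d' + t').
Proof. by move=> -> ->; apply/rowP => j; rewrite !mxE; ring. Qed.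

(** The second derivatives of X and of F cancel by symmetry, and the mixed terms
    Gamma (D_x F, D_y X) + Gamma (D_y F, D_x X) are symmetric in x and y. *)
Lemma curvature_along X x y u : smooth_mx U X -> U u ->
  cov g F x (cov g F y X) u - cov g F y (cov g F x X) u =
  curvature g (F u) ('D_x F u) ('D_y F u) (X u).
Proof.
move=> sX Uu.
have dX := smooth_mx_diff sX Uu.
have E a b : cov g F a (cov g F b X) u = 'D_a ('D_b X) u
   + ('D_('D_a F u) (fun w => Gamma g w ('D_b F u) (X u)) (F u)
      + Gamma g (F u) ('D_a ('D_b F) u) (X u)
      + Gamma g (F u) ('D_b F u) ('D_a X u))
   + (Gamma g (F u) ('D_a F u) ('D_b X u)
      + Gamma g (F u) ('D_a F u) (Gamma g (F u) ('D_b F u) (X u))).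
  rewrite {1}/cov (bilD2 (Gamma_bilinear g (F u))); congr (_ + _).
  have dDX : differentiable ('D_b X) u.
    exact: smooth_mx_diff (smooth_mx_derive b oU sX) Uu.
  rewrite -(derive_Gamma_field Uu (dDF b Uu) dX) -deriveD//.
    exact: diff_derivable.
  apply: diff_derivable; apply: differentiable_Gamma_field => //.
  exact: dDF.
rewrite curvatureE; apply: etrans (f_equal2 (fun a b => a - b) (E x y) (E y x)) _.
apply: cancel_symmetric; first exact: (smooth_mx_derive_comm x y oU sX Uu).
exact: (f_equal (fun z => Gamma g (F u) z (X u))
  (smooth_mx_derive_comm x y oU sF Uu)).
Qed.

(** Differentiating <cov_y X, Y> moves the second covariant derivative off X, so
    that only first covariant derivatives remain besides derivatives of scalars. *)
Lemma riemann_along X Y x y u : smooth_mx U X -> smooth_mx U Y -> U u ->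
  inner g (F u) (curvature g (F u) ('D_x F u) ('D_y F u) (X u)) (Y u) =
  ('D_x (fun w => inner g (F w) (cov g F y X w) (Y w)) u
   - inner g (F u) (cov g F y X u) (cov g F x Y u))
  - ('D_y (fun w => inner g (F w) (cov g F x X w) (Y w)) u
   - inner g (F u) (cov g F x X u) (cov g F y Y u)).
Proof.
move=> sX sY Uu; have dY := smooth_mx_diff sY Uu.
have dc z := differentiable_cov z sX Uu.
have cancel (I D1 D2 p1 p2 q1 q2 : R) : I = q1 - q2 -> D1 = q1 + p1 ->
    D2 = q2 + p2 -> I = (D1 - p1) - (D2 - p2).
  by move=> -> -> ->; ring.
apply: cancel.
- rewrite -(curvature_along x y sX Uu).
  exact: (bilB1 (inner_bilinear g (F u))).
- exact: (derive_inner_cov Uu (dc y) dY x).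
- exact: (derive_inner_cov Uu (dc x) dY y).
Qed.

(** Koszul's argument: metric compatibility and vanishing torsion determine
    <cov_x D_y F, D_z F> from the derivatives of the induced metric h. *)
Lemma koszul_along (h : 'rV[R]_k -> 'M[R]_k) x y z u :
  (forall w, U w -> forall a b,
     inner g (F w) ('D_a F w) ('D_b F w) = inner h w a b) -> U u ->
  inner g (F u) (cov g F x ('D_y F) u) ('D_z F u) = koszul h u x y z.
Proof.
move=> iso Uu.
have E c a b : 'D_c (fun w => inner h w a b) u =
    inner g (F u) (cov g F c ('D_a F) u) ('D_b F u)
    + inner g (F u) ('D_a F u) (cov g F c ('D_b F) u).
  rewrite -(derive_inner_cov Uu (dDF a Uu) (dDF b Uu)).
  apply: near_eq_derive; apply: filterS (near_open oU Uu iso) => w -> //.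
have iC a b := innerCE hg a b (FUW Uu).
have solve (A B C D1 D2 D3 A' B' C' : R) : A = A' -> B = B' -> C = C' ->
    D1 = A + B -> D2 = A' + C -> D3 = B' + C' -> A = 2^-1 * (D1 + D2 - D3).
  by move=> -> -> -> -> -> ->; field.
have T a b c : inner g (F u) (cov g F a ('D_b F) u) ('D_c F u) =
    inner g (F u) (cov g F b ('D_a F) u) ('D_c F u).
  exact: (f_equal (fun v => inner g (F u) v ('D_c F u)) (cov_torsion_free a b Uu)).
have {}E c a b : 'D_c (fun w => inner h w a b) u =
    inner g (F u) (cov g F c ('D_a F) u) ('D_b F u)
    + inner g (F u) (cov g F c ('D_b F) u) ('D_a F u).
  apply: etrans (E c a b) _; apply: (f_equal (+%R _)); exact: iC.
apply: solve (T x y z) (T x z y) (T y z x) (E x y z) (E y x z) (E z x y).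
Qed.

End AlongMap.

(** * Symmetries of the curvature tensor *)

Definition riemann (R : realType) n (g : 'rV[R]_n -> 'M[R]_n) u x y z w : R :=
  inner g u (curvature g u x y z) w.

Lemma sectionalE (R : realType) n (g : 'rV[R]_n -> 'M[R]_n) u x y :
  sectional g u x y = riemann g u x y y x
    / (inner g u x x * inner g u y y - inner g u x y ^+ 2).
Proof. by []. Qed.

(** Linearity in the first argument suffices: the symmetries carry it to the others. *)
Record algebraic_curvature (R : realType) n
    (T : 'rV[R]_n -> 'rV[R]_n -> 'rV[R]_n -> 'rV[R]_n -> R) : Prop := {
  ac_lin : forall k a b y z w, T (k *: a + b) y z w = k * T a y z w + T b y z w;
  ac_anti : forall x y z w, T y x z w = - T x y z w;
  ac_pair : forall x y z w, T x y z w = T z w x y;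
  ac_bianchi : forall x y z w, T x y z w + T y z x w + T z x y w = 0
}.

Section RiemannTensor.
Context (R : realType) (n : nat) (U : set 'rV[R]_n) (g : 'rV[R]_n -> 'M[R]_n).
Hypothesis hg : metric_on U g.
Let oU := mo_open hg.

Lemma smooth_id : smooth_mx U (id : 'rV[R]_n -> 'rV[R]_n).
Proof.
move=> i j k; rewrite ord1.
have dE v : 'D_v (fun w : 'rV[R]_n => w 0 j) = cst (v 0 j).
  apply/funext => w; rewrite -(derive_entry (A := id)) ?derive_id//.
case: k => [|k] /=.
  by move=> u _; exact: coord_continuous.
split=> [u _|l]; first exact: differentiable_coord.
by rewrite dE; exact: smooth_cst.
Qed.

Lemma riemann_koszul u x y z w : U u -> riemann g u x y z w =
  ('D_x (fun v => koszul g v y z w) u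
     - inner g u (Gamma g u y z) (Gamma g u x w))
  - ('D_y (fun v => koszul g v x z w) u
     - inner g u (Gamma g u x z) (Gamma g u y w)).
Proof.
move=> Uu.
have sc c : smooth_mx U (cst c : 'rV[R]_n -> 'rV[R]_n).
  by move=> i j; exact: smooth_cst.
have covE a c v : cov g id a (cst c) v = Gamma g v a c.
  rewrite /cov derive_cst add0r.
  exact: (f_equal (fun b => Gamma g v b c) (derive_id v a)).
have := riemann_along oU hg smooth_id (fun _ h => h) x y (sc z) (sc w) Uu.
have solve (A A' D1 D1' D2 D2' p1 p1' p2 p2' : R) : A' = A -> D1' = D1 ->
    D2' = D2 -> p1' = p1 -> p2' = p2 ->
    A = (D1 - p1) - (D2 - p2) -> A' = (D1' - p1') - (D2' - p2').
  by move=> -> -> -> -> ->.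
have DE a b c : 'D_a (fun v => koszul g v b c w) u =
    'D_a (fun v => inner g v (cov g id b (cst c) v) w) u.
  apply: near_eq_derive; apply: (near_open oU Uu) => v Uv.
  by rewrite covE (inner_GammaE hg).
apply: solve (DE x y z) (DE y x z) _ _.
- exact: (f_equal2 (fun a b => inner g u (curvature g u a b z) w)
    (esym (derive_id u x)) (esym (derive_id u y))).
- exact: (f_equal2 (inner g u) (esym (covE y z u)) (esym (covE x w u))).
- exact: (f_equal2 (inner g u) (esym (covE x z u)) (esym (covE y w u))).
Qed.

Let dd u a b p q := 'D_a ('D_b (fun v => inner g v p q)) u.

Let smooth_g p q : smooth U (fun v => inner g v p q).
Proof. by apply: smooth_inner => //; exact: mo_smooth hg. Qed.

Lemma derive_koszul u a x y z : U u ->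
  'D_a (fun v => koszul g v x y z) u =
  2^-1 * (dd u a x y z + dd u a y x z - dd u a z x y).
Proof.
move=> Uu.
have dD b p q : derivable ('D_b (fun v => inner g v p q)) u a.
  apply: diff_derivable.
  exact: smooth_diff (smooth_derive b oU (smooth_g p q)) Uu.
have := @deriveZ _ _ _ ('D_x (fun v => inner g v y z)
  + 'D_y (fun v => inner g v x z) - 'D_z (fun v => inner g v x y)) 2^-1 u a.
have dDD := derivableD (dD x y z) (dD y x z).
rewrite (deriveB dDD (dD z x y)) (deriveD (dD x y z) (dD y x z)); apply.
exact: derivableB dDD (dD z x y).
Qed.

(** The terms with D_x D_y cancel, and the rest displays the symmetries of the
    curvature tensor. *)
Lemma riemannE u x y z w : U u -> riemann g u x y z w =
  2^-1 * (dd u x z y w - dd u x w y z - dd u y z x w + dd u y w x z)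
  + inner g u (Gamma g u x z) (Gamma g u y w)
  - inner g u (Gamma g u y z) (Gamma g u x w).
Proof.
move=> Uu; apply: etrans (riemann_koszul x y z w Uu) _.
have solve (D1 D2 a b c d f f' P Q : R) : D1 = 2^-1 * (f + a - b) ->
    D2 = 2^-1 * (f' + c - d) -> f = f' ->
    (D1 - Q) - (D2 - P) = 2^-1 * (a - b - c + d) + P - Q.
  by move=> -> -> ->; field.
apply: solve (derive_koszul x y z w Uu) (derive_koszul y x z w Uu) _.
exact: (smooth_derive_comm x y oU (smooth_g z w) Uu).
Qed.

Lemma riemann_lin u k a b y z w : U u -> riemann g u (k *: a + b) y z w =
  k * riemann g u a y z w + riemann g u b y z w.
Proof.
move=> Uu; rewrite /riemann -(inner_linl g u k); congr (inner g u _ w).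
have dG p q := differentiable_Gamma hg p q Uu.
have G1 v c d e : Gamma g v (k *: c + d) e = k *: Gamma g v c e + Gamma g v d e.
  exact: (Gamma_bilinear g v).1.
have G2 v c d e : Gamma g v e (k *: c + d) = k *: Gamma g v e c + Gamma g v e d.
  exact: (Gamma_bilinear g v).2.
have solve (A A1 A2 B B1 B2 C C1 C2 D D1 D2 : 'rV[R]_n) :
    A = k *: A1 + A2 -> B = k *: B1 + B2 -> C = k *: C1 + C2 ->
    D = k *: D1 + D2 ->
    (A + B) - (C + D) = k *: ((A1 + B1) - (C1 + D1)) + ((A2 + B2) - (C2 + D2)).
  by move=> -> -> -> ->; apply/rowP => i; rewrite !mxE; ring.
rewrite !curvatureE; apply: solve.
- rewrite derive_dirD//; congr (_ + _); exact: derive_dirZ.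
- exact: G1.
- have -> : (fun v => Gamma g v (k *: a + b) z) =
      k \*: (fun v => Gamma g v a z) + (fun v => Gamma g v b z).
    by apply/funext => v; rewrite G1.
  have da : derivable (fun v => Gamma g v a z) u y by exact: diff_derivable.
  have db : derivable (fun v => Gamma g v b z) u y by exact: diff_derivable.
  have dka : derivable (k \*: (fun v => Gamma g v a z)) u y.
    exact: derivableZ.
  rewrite (deriveD dka db); congr (_ + _).
  exact: (deriveZ k da).
- by rewrite G1 G2.
Qed.

Lemma riemann_algebraic u : U u -> algebraic_curvature (riemann g u).
Proof.
move=> Uu.
have [d dE] : exists d, forall a b p q, dd u a b p q = d a b p q.
  by exists (dd u).
have [P PE] : exists P, forall a b p q,
    inner g u (Gamma g u a b) (Gamma g u p q) = P a b p q by eexists.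
have dab a b p q : d a b p q = d b a p q.
  by rewrite -!dE; exact: (smooth_derive_comm a b oU (smooth_g p q) Uu).
have dpq a b p q : d a b p q = d a b q p.
  rewrite -!dE; apply: near_eq_derive; apply: (near_open oU Uu) => v Uv.
  exact: derive_innerC Uv.
have Pab a b p q : P a b p q = P b a p q.
  by rewrite -!PE; exact: (f_equal (inner g u ^~ _) (GammaC hg a b Uu)).
have Psw a b p q : P a b p q = P p q a b.
  by rewrite -!PE; exact: innerCE Uu.
have RE x y z w : riemann g u x y z w =
    2^-1 * (d x z y w - d x w y z - d y z x w + d y w x z)
    + P x z y w - P y z x w.
  by rewrite -!dE -!PE; exact: riemannE.
split=> [k a b y z w|x y z w|x y z w|x y z w].
- exact: riemann_lin.
- rewrite !RE; ring.
- rewrite !RE (dab z x) (dab w y) (dab z y) (dab w x) (dpq x z w y) (dpq y z w x).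
  rewrite (dpq x w z y) (dpq y w z x) (Pab z x) (Psw x z w y) (Pab w y).
  by rewrite (Psw y w x z) (Pab w x) (Psw x w z y) (Pab z y); ring.
- rewrite !RE (dab y x) (dab z x) (dab z y) (dpq y w z x) (dpq z w y x).
  by rewrite (dpq x w z y) (Pab y x) (Pab z x) (Pab z y); ring.
Qed.

End RiemannTensor.

Section AlgebraicCurvature.
Context (R : realType) (n : nat).
Context (T : 'rV[R]_n -> 'rV[R]_n -> 'rV[R]_n -> 'rV[R]_n -> R).
Hypothesis hT : algebraic_curvature T.

Lemma ac_anti34 x y z w : T x y w z = - T x y z w.
Proof. by rewrite (ac_pair hT) (ac_anti hT) (ac_pair hT). Qed.

Lemma ac_lin2 k a b x z w : T x (k *: a + b) z w = k * T x a z w + T x b z w.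
Proof.
rewrite (ac_anti hT) (ac_lin hT) (ac_anti hT x a) (ac_anti hT x b); ring.
Qed.

Lemma ac_lin3 k a b x y w : T x y (k *: a + b) w = k * T x y a w + T x y b w.
Proof. by rewrite !(ac_pair hT x y) (ac_lin hT). Qed.

Lemma ac_lin4 k a b x y z : T x y z (k *: a + b) = k * T x y z a + T x y z b.
Proof. by rewrite !(ac_pair hT x y) ac_lin2. Qed.

Lemma ac_zero1 y z w : T 0 y z w = 0.
Proof.
have := ac_lin hT 1 0 0 y z w; rewrite scale1r addr0 mul1r => h.
by apply: (addIr (T 0 y z w)); rewrite add0r -h.
Qed.

Lemma ac_scale1 k x y z w : T (k *: x) y z w = k * T x y z w.
Proof. by rewrite -[k *: x]addr0 (ac_lin hT) ac_zero1 addr0. Qed.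

Lemma ac_scale2 k x y z w : T x (k *: y) z w = k * T x y z w.
Proof. by rewrite (ac_anti hT) ac_scale1 (ac_anti hT x) mulrN opprK. Qed.

Lemma ac_scale3 k x y z w : T x y (k *: z) w = k * T x y z w.
Proof. by rewrite !(ac_pair hT x y) ac_scale1. Qed.

Lemma ac_scale4 k x y z w : T x y z (k *: w) = k * T x y z w.
Proof. by rewrite !(ac_pair hT x y) ac_scale2. Qed.

Lemma ac_add1 a b y z w : T (a + b) y z w = T a y z w + T b y z w.
Proof. by have := ac_lin hT 1 a b y z w; rewrite scale1r mul1r. Qed.

Lemma ac_add2 a b x z w : T x (a + b) z w = T x a z w + T x b z w.
Proof. by have := ac_lin2 1 a b x z w; rewrite scale1r mul1r. Qed.

Lemma ac_add3 a b x y w : T x y (a + b) w = T x y a w + T x y b w.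
Proof. by have := ac_lin3 1 a b x y w; rewrite scale1r mul1r. Qed.

Lemma ac_add4 a b x y z : T x y z (a + b) = T x y z a + T x y z b.
Proof. by have := ac_lin4 1 a b x y z; rewrite scale1r mul1r. Qed.

Lemma ac_opp1 x y z w : T (- x) y z w = - T x y z w.
Proof. by rewrite -scaleN1r ac_scale1 mulN1r. Qed.
Lemma ac_opp2 x y z w : T x (- y) z w = - T x y z w.
Proof. by rewrite -scaleN1r ac_scale2 mulN1r. Qed.
Lemma ac_opp3 x y z w : T x y (- z) w = - T x y z w.
Proof. by rewrite -scaleN1r ac_scale3 mulN1r. Qed.
Lemma ac_opp4 x y z w : T x y z (- w) = - T x y z w.
Proof. by rewrite -scaleN1r ac_scale4 mulN1r. Qed.

Context (s : 'rV[R]_n -> 'rV[R]_n -> R) (J : 'rV[R]_n -> 'rV[R]_n) (c : R).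
Hypothesis s_bil : bilinear_at s.
Hypothesis sC : forall x y, s x y = s y x.
Hypothesis Jadd : forall x y, J (x + y) = J x + J y.
Hypothesis Jopp : forall x, J (- x) = - J x.
Hypothesis JJ : forall x, J (J x) = - x.
Hypothesis sJ : forall x y, s (J x) (J y) = s x y.
Hypothesis TJ : forall x y z w, T x y (J z) (J w) = T x y z w.
Hypothesis hol : forall v, T v (J v) (J v) v = c * s v v ^+ 2.

(** The part of degree (2, 2) in the polarization of
    R(v, J v, J v, v) = c |v|^4; the sum over v = x + y and v = x - y isolates it.
    The Bianchi identity and J-invariance reduce its six terms [C] to two. *)
Lemma holomorphic_polarization x y :
  T x y y x + 3 * T x (J y) (J y) x = c * (s x x * s y y + 2 * s x y ^+ 2).
Proof.
have TJ' a b p q : T (J a) (J b) p q = T a b p q.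
  by rewrite (ac_pair hT) TJ (ac_pair hT).
pose Q v := T v (J v) (J v) v.
pose C := T y (J y) (J x) x + T x (J x) (J y) y + T y (J x) (J y) x
  + T x (J y) (J x) y + T y (J x) (J x) y + T x (J y) (J y) x.
have QE : Q (x + y) + Q (x - y) = 2 * Q x + 2 * Q y + 2 * C.
  rewrite /Q /C !Jadd !Jopp !ac_add1 !ac_add2 !ac_add3 !ac_add4.
  rewrite !ac_opp1 !ac_opp2 !ac_opp3 !ac_opp4; ring.
have CE : C = 2 * (T x y y x + 3 * T x (J y) (J y) x).
  have e1 : T y (J y) (J x) x = T x (J x) (J y) y.
    by rewrite (ac_pair hT) (ac_anti hT) ac_anti34 opprK.
  have e2 : T y (J x) (J y) x = T x (J y) (J x) y.
    by rewrite (ac_pair hT) (ac_anti hT) ac_anti34 opprK.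
  have e3 : T y (J x) (J x) y = T x (J y) (J y) x.
    rewrite -(TJ' y) -(TJ _ _ (J x)) !JJ ac_opp2 ac_opp3 opprK.
    by rewrite (ac_anti hT) ac_anti34 opprK.
  have e4 : T x (J y) (J x) y = T x (J y) (J y) x.
    by rewrite -TJ JJ ac_opp3 ac_anti34 opprK.
  have e5 : T x (J x) (J y) y = T x y y x + T x (J y) (J x) y.
    have := ac_bianchi hT x (J x) (J y) y.
    rewrite TJ' (ac_anti hT x (J y)) (ac_anti34 x y y x). lra.
  rewrite /C e1 e2 e3 e5 e4; ring.
have hx : Q x = c * s x x ^+ 2 by exact: hol.
have hy : Q y = c * s y y ^+ 2 by exact: hol.
have hp : Q (x + y) = c * (s x x + 2 * s x y + s y y) ^+ 2.
  rewrite /Q hol (bilD1 s_bil) !(bilD2 s_bil) (sC y x); ring.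
have hm : Q (x - y) = c * (s x x - 2 * s x y + s y y) ^+ 2.
  rewrite /Q hol (bilB1 s_bil) !(bilB2 s_bil) (sC y x); ring.
move: QE; rewrite hx hy hp hm CE => h.
apply: (@mulfI _ 4); first by rewrite pnatr_eq0.
have -> : 4 * (T x y y x + 3 * T x (J y) (J y) x) =
  2 * (2 * (T x y y x + 3 * T x (J y) (J y) x)) by ring.
apply: (addrI (2 * (c * s x x ^+ 2) + 2 * (c * s y y ^+ 2))).
by rewrite -h; ring.
Qed.

(** The polarized identities for (x, y) and (x, J y) are two linear equations in
    R(x, y, y, x) and R(x, J y, J y, x). *)
Lemma space_form_curvature x y : T x y y x =
  c / 4 * (s x x * s y y - s x y ^+ 2 + 3 * s x (J y) ^+ 2).
Proof.
have h1 := holomorphic_polarization x y.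
have h2 := holomorphic_polarization x (J y).
rewrite JJ ac_opp2 ac_opp3 opprK sJ in h2.
lra.
Qed.

End AlgebraicCurvature.

(** * Gauss equation and Kaehler curvature *)

Section GaussEquation.
Context (R : realType) (k n : nat) (U : set 'rV[R]_k) (W : set 'rV[R]_n).
Context (h : 'rV[R]_k -> 'M[R]_k) (g : 'rV[R]_n -> 'M[R]_n).
Context (F : 'rV[R]_k -> 'rV[R]_n).
Hypothesis (hh : metric_on U h) (hg : metric_on W g) (sF : smooth_mx U F).
Hypothesis FUW : forall u, U u -> W (F u).
Hypothesis iso : forall u, U u -> forall a b,
  inner g (F u) ('D_a F u) ('D_b F u) = inner h u a b.

Let oU := mo_open hh.

Lemma second_ffE u x y : second_ff h g F u x y =
  cov g F x ('D_y F) u - 'D_(Gamma h u x y) F u.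
Proof. by rewrite /second_ff nabla_cst. Qed.

(** Both <cov_x D_y F, D_z F> and <Gamma (x, y), z> are given by Koszul's formula
    for the metric h. *)
Lemma second_ff_normal u x y z : U u ->
  inner g (F u) (second_ff h g F u x y) ('D_z F u) = 0.
Proof.
move=> Uu; rewrite second_ffE (bilB1 (inner_bilinear g (F u))).
apply/eqP; rewrite subr_eq0; apply/eqP.
apply: etrans (koszul_along oU hg sF FUW x y z iso Uu) _.
apply: etrans (esym (iso Uu _ _)).
exact: esym (inner_GammaE hh x y z Uu).
Qed.

Lemma inner_cov_second_ff u x y a b : U u ->
  inner g (F u) (cov g F x ('D_y F) u) (cov g F a ('D_b F) u) =
  inner g (F u) (second_ff h g F u x y) (second_ff h g F u a b)
  + inner h u (Gamma h u x y) (Gamma h u a b).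
Proof.
move=> Uu.
have E c d : cov g F c ('D_d F) u =
    second_ff h g F u c d + 'D_(Gamma h u c d) F u.
  by rewrite second_ffE subrK.
have N1 := second_ff_normal x y (Gamma h u a b) Uu.
have N2 := second_ff_normal a b (Gamma h u x y) Uu.
rewrite (innerCE hg _ _ (FUW Uu)) in N2.
have I := iso Uu (Gamma h u x y) (Gamma h u a b).
have bil := inner_bilinear g (F u).
have solve (A A' B B' : 'rV[R]_n) (r : R) : inner g (F u) A B' = 0 ->
    inner g (F u) A' B = 0 -> inner g (F u) A' B' = r ->
    inner g (F u) (A + A') (B + B') = inner g (F u) A B + r.
  move=> e1 e2 <-; rewrite (bilD1 bil) (bilD2 bil A) (bilD2 bil A') e1 e2.
  by rewrite addr0 add0r.
apply: etrans (f_equal2 (inner g (F u)) (E x y) (E a b)) _.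
exact: solve N1 N2 I.
Qed.

(** [riemann_along] for the fields D_z F and D_w F has the same derivatives of
    Koszul terms as [riemann_koszul] for h. The two formulas differ in the products
    of first covariant derivatives, which [inner_cov_second_ff] splits into tangent
    and normal parts. *)
Lemma gauss_equation u x y z w : U u -> riemann h u x y z w =
  riemann g (F u) ('D_x F u) ('D_y F u) ('D_z F u) ('D_w F u)
  + inner g (F u) (second_ff h g F u y z) (second_ff h g F u x w)
  - inner g (F u) (second_ff h g F u x z) (second_ff h g F u y w).
Proof.
move=> Uu.
have sD a := smooth_mx_derive a oU sF.
have kE a b c d : 'D_a (fun v => inner g (F v) (cov g F b ('D_c F) v) ('D_d F v)) u
    = 'D_a (fun v => koszul h v b c d) u.
  apply: near_eq_derive; apply: (near_open oU Uu) => v Uv.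
  exact: (koszul_along oU hg sF FUW b c d iso Uv).
have solve (T T' D1 D2 D1' D2' P Q P' Q' S S' : R) :
    T' = (D1' - P') - (D2' - Q') -> D1' = D1 -> D2' = D2 -> P' = S + P ->
    Q' = S' + Q -> T = (D1 - P) - (D2 - Q) -> T = T' + S - S'.
  by move=> -> -> -> -> -> ->; ring.
apply: solve (riemann_along oU hg sF FUW x y (sD z) (sD w) Uu) (kE x y z w)
  (kE y x z w) (inner_cov_second_ff y z x w Uu) (inner_cov_second_ff x z y w Uu) _.
exact: (riemann_koszul hh x y z w Uu).
Qed.

Lemma second_ffC u x y : U u -> second_ff h g F u x y = second_ff h g F u y x.
Proof.
move=> Uu; rewrite !second_ffE; apply: (f_equal2 (fun a b => a - b)).
  exact: (cov_torsion_free oU hg sF FUW x y Uu).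
exact: (f_equal (fun v => 'D_v F u) (GammaC hh x y Uu)).
Qed.

Lemma second_ff_bilinear u : U u -> bilinear_at (second_ff h g F u).
Proof.
move=> Uu.
have dF := smooth_mx_diff sF Uu.
have dD y := smooth_mx_diff (smooth_mx_derive y oU sF) Uu.
have P2 y c a b : second_ff h g F u (c *: a + b) y =
    c *: second_ff h g F u a y + second_ff h g F u b y.
  have solve (A A1 A2 B B1 B2 C C1 C2 : 'rV[R]_n) : A = c *: A1 + A2 ->
     B = c *: B1 + B2 -> C = c *: C1 + C2 ->
     (A + B) - C = c *: (A1 + B1 - C1) + (A2 + B2 - C2).
    by move=> -> -> ->; apply/rowP => i; rewrite !mxE; ring.
  rewrite !second_ffE /cov; apply: solve.
  - by rewrite (derive_dirD _ _ (dD y)); congr (_ + _); exact: derive_dirZ.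
  - rewrite (derive_dirD _ _ dF) (derive_dirZ _ _ dF).
    exact: (Gamma_bilinear g (F u)).1.
  - rewrite (_ : Gamma h u (c *: a + b) y = c *: Gamma h u a y + Gamma h u b y).
      by rewrite (derive_dirD _ _ dF) (derive_dirZ _ _ dF).
    exact: (Gamma_bilinear h u).1.
split=> [y|x] c a b; first exact: P2.
apply: etrans (second_ffC _ _ Uu) (etrans (P2 x c a b) _).
exact: (f_equal2 (fun v w => c *: v + w) (second_ffC a x Uu)
  (second_ffC b x Uu)).
Qed.

End GaussEquation.

Section KahlerCurvature.
Context (R : realType) (n : nat) (U : set 'rV[R]_n).
Context (g J : 'rV[R]_n -> 'M[R]_n) (c : R).
Hypothesis (hg : metric_on U g) (sJ : smooth_mx U J).
Hypothesis gpos : forall u, U u -> forall v, v != 0 -> 0 < inner g u v v.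
Hypothesis JJ : forall u, U u -> J u *m J u = - 1%:M.
Hypothesis Jiso : forall u, U u -> J u *m g u *m (J u)^T = g u.
Hypothesis Jpar : forall u, U u -> forall x y,
  nabla g (cst x) (fun w => y *m J w) u = nabla g (cst x) (cst y) u *m J u.
Hypothesis hol : forall u, U u -> forall v, v != 0 ->
  sectional g u v (v *m J u) = c.

Let oU := mo_open hg.

Lemma cov_id x X u : cov g id x X u = 'D_x X u + Gamma g u x (X u).
Proof. exact: (f_equal (fun a => _ + Gamma g u a (X u)) (derive_id u x)). Qed.

Lemma differentiable_mulmxJ (Y : 'rV[R]_n -> 'rV[R]_n) u : differentiable Y u -> U u ->
  differentiable (fun w => Y w *m J w) u.
Proof.
move=> dY Uu; apply/differentiable_mxP => i j.
under eq_fun do rewrite mxE.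
apply: differentiable_bigsum => l; apply: differentiable_mul.
  exact: (differentiable_mxP Y u).2.
exact: smooth_diff (sJ l j) Uu.
Qed.

Lemma derive_mulmxJ (Y : 'rV[R]_n -> 'rV[R]_n) x u : differentiable Y u -> U u ->
  'D_x (fun w => Y w *m J w) u =
  'D_x (fun w => Y u *m J w) u + 'D_x Y u *m J u.
Proof.
move=> dY Uu.
(* A dummy scalar argument makes y |-> y J a field of bilinear maps. *)
pose B w (y : 'rV[R]_n) (z : 'rV[R]_1) : 'rV[R]_n := z 0 0 *: (y *m J w).
have Bbil w : bilinear_at (B w).
  split=> [z|y] k a b; rewrite /B.
    by rewrite mulmxDl -scalemxAl scalerDr !scalerA (mulrC (z 0 0)).
  by rewrite !mxE scalerDl scalerA.
have dB y z : differentiable (fun w => B w y z) u.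
  apply: differentiableZ.
  exact: (differentiable_mulmxJ (Y := cst y) (differentiable_cst y u) Uu).
have did : differentiable (id : 'rV[R]_n -> 'rV[R]_n) u.
  exact: smooth_mx_diff (@smooth_id R n U) Uu.
have := derive_bilin_field (B := B) (F := id) (X := Y) (Y := cst 1%:M) Bbil dB
  did dY (differentiable_cst _ _) x.
rewrite derive_cst.
have -> : (fun w => B (id w) (Y w) (cst 1%:M w)) = (fun w => Y w *m J w).
  by apply/funext => w; rewrite /B /= mxE eqxx scale1r.
have -> : (fun w => B w (Y u) (cst 1%:M u)) = (fun w => Y u *m J w).
  by apply/funext => w; rewrite /B /= mxE eqxx scale1r.
move=> ->; rewrite {2}/B mxE scale0r addr0 /B mxE eqxx scale1r.
exact: (f_equal (fun a => 'D_a (fun w => Y u *m J w) u + _) (derive_id u x)).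
Qed.

(** J is parallel for constant fields by hypothesis; the Leibniz rule extends this
    to all fields. *)
Lemma cov_mulmxJ (Y : 'rV[R]_n -> 'rV[R]_n) x u : differentiable Y u -> U u ->
  cov g id x (fun w => Y w *m J w) u = cov g id x Y u *m J u.
Proof.
move=> dY Uu; rewrite !cov_id.
have := Jpar Uu x (Y u); rewrite nabla_cst /nabla /= => P.
have solve (D D1 D2 G1 G2 : 'rV[R]_n) : D = D1 + D2 *m J u ->
    D1 + G1 = G2 *m J u -> D + G1 = (D2 + G2) *m J u.
  by move=> -> h; rewrite mulmxDl -h [D1 + _]addrC -addrA.
exact: solve (derive_mulmxJ x dY Uu) P.
Qed.

(** The field w |-> z J(w) is not constant, so its curvature is computed by the
    commutator formula along the identity map. *)
Lemma curvature_mulmxJ u x y z : U u ->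
  curvature g u x y (z *m J u) = curvature g u x y z *m J u.
Proof.
move=> Uu.
have sX : smooth_mx U (fun w => z *m J w).
  move=> i j; under eq_fun do rewrite mxE.
  by apply: smooth_sum => // l; exact: smoothZ.
have E a b : cov g id a (cov g id b (fun w => z *m J w)) u =
    ('D_a (fun w => Gamma g w b z) u + Gamma g u a (Gamma g u b z)) *m J u.
  have N v : U v -> cov g id b (fun w => z *m J w) v = Gamma g v b z *m J v.
    move=> Uv; apply: etrans (cov_mulmxJ b (differentiable_cst z v) Uv) _.
    by rewrite cov_id derive_cst add0r.
  have dG := differentiable_Gamma hg b z Uu.
  apply: etrans (etrans (cov_mulmxJ a dG Uu) _).
    apply: etrans (cov_id _ _ _) (etrans _ (esym (cov_id _ _ _))).
    apply: (f_equal2 +%R).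
      by apply: near_eq_derive; exact: near_open N.
    exact: (f_equal (Gamma g u a) (N u Uu)).
  by rewrite cov_id.
have := curvature_along oU hg (@smooth_id R n U) (fun _ h => h) x y sX Uu.
have solve (A B C C' D D' : 'rV[R]_n) : A = C -> B = C' -> A - B = D ->
    D' = C - C' -> D' = D by move=> -> -> -> ->.
move=> H.
have D : curvature g (id u) ('D_x id u) ('D_y id u) (z *m J u) =
    curvature g u x y (z *m J u).
  exact: (f_equal2 (fun a b => curvature g u a b (z *m J u)) (derive_id u x)
    (derive_id u y)).
apply: esym; apply: (solve _ _ _ _ _ _ (E x y) (E y x) (etrans H D)).
by rewrite curvatureE mulmxBl.
Qed.

Lemma space_form_riemann u x y : U u -> riemann g u x y y x =
  c / 4 * (inner g u x x * inner g u y y - inner g u x y ^+ 2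
           + 3 * inner g u x (y *m J u) ^+ 2).
Proof.
move=> Uu.
have iJ a b : inner g u (a *m J u) (b *m J u) = inner g u a b.
  by rewrite inner_mul (Jiso Uu).
have JJv v : v *m J u *m J u = - v.
  by rewrite -mulmxA (JJ Uu) mulmxN mulmx1.
have iC a b := innerCE hg a b Uu.
have bil := inner_bilinear g u.
apply: (space_form_curvature (riemann_algebraic hg Uu) (s := inner g u)
  (J := fun v => v *m J u)) => //.
- by move=> a b; rewrite mulmxDl.
- by move=> a; rewrite mulNmx.
- by move=> a b d e; rewrite /riemann (curvature_mulmxJ a b d Uu) iJ.
- move=> v; have [->|v0] := eqVneq v 0.
    by rewrite (ac_zero1 (riemann_algebraic hg Uu)) (bil01 bil) expr0n mulr0.
  have vJ0 : inner g u v (v *m J u) = 0.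
    have : inner g u v (v *m J u) = - inner g u v (v *m J u).
      rewrite -[LHS]iJ JJv (bilN2 bil) (iC (v *m J u)) //.
    lra.
  have vp := gpos Uu v0.
  have := hol Uu v0; rewrite /sectional iJ vJ0 expr0n subr0 -expr2 => <-.
  by rewrite divfK// expf_eq0 /= gt_eqF.
Qed.

End KahlerCurvature.

(** * Calculus on a product; Hessian and Laplacian *)

Section ProductCalculus.
Context (R : realType) (n1 n2 : nat).
Implicit Types (u : 'rV[R]_(n1 + n2)).

(** A directional derivative sees only the values on a line, so a function of one
    factor of a product is differentiated on that factor alone. *)
Lemma derive_same_line (V V' W : normedModType R) (f : V -> W) (k : V' -> W)
    (u v : V) (u' v' : V') : (forall h : R, f (h *: v + u) = k (h *: v' + u')) ->
  'D_v f u = 'D_v' k u'.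
Proof.
move=> fk; rewrite /derive; congr (lim _).
have -> // : (fun h => h^-1 *: ((f \o shift u) (h *: v) - f u)) =
  (fun h => h^-1 *: ((k \o shift u') (h *: v') - k u')).
apply/funext => h /=; rewrite fk.
by have := fk 0; rewrite !scale0r !add0r => ->.
Qed.

Lemma lsubmx_line (h : R) (v u : 'rV[R]_(n1 + n2)) :
  lsubmx (h *: v + u) = h *: lsubmx v + lsubmx u.
Proof. by rewrite linearD linearZ. Qed.

Lemma rsubmx_line (h : R) (v u : 'rV[R]_(n1 + n2)) :
  rsubmx (h *: v + u) = h *: rsubmx v + rsubmx u.
Proof. by rewrite linearD linearZ. Qed.

Lemma derive_lsubmx (W : normedModType R) (f : 'rV[R]_n1 -> W) v u :
  'D_v (fun w => f (lsubmx w)) u = 'D_(lsubmx v) f (lsubmx u).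
Proof. by apply: derive_same_line => h; rewrite lsubmx_line. Qed.

Lemma derive_rsubmx (W : normedModType R) (f : 'rV[R]_n2 -> W) v u :
  'D_v (fun w => f (rsubmx w)) u = 'D_(rsubmx v) f (rsubmx u).
Proof. by apply: derive_same_line => h; rewrite rsubmx_line. Qed.

Lemma derive_vertical (A : 'rV[R]_n1 -> R) (B : 'rV[R]_n2 -> R) b u :
  differentiable B (rsubmx u) ->
  'D_(row_mx 0 b) (fun w => A (lsubmx w) * B (rsubmx w)) u =
  A (lsubmx u) * 'D_b B (rsubmx u).
Proof.
move=> dB.
have dB' : derivable B (rsubmx u) b by exact: diff_derivable.
apply: etrans (deriveZ (A (lsubmx u)) dB'); apply: derive_same_line => h.
by rewrite lsubmx_line rsubmx_line row_mxKl row_mxKr scaler0 add0r.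
Qed.

Lemma derive_horizontal (A : 'rV[R]_n1 -> R) (B : 'rV[R]_n2 -> R) a u :
  differentiable A (lsubmx u) ->
  'D_(row_mx a 0) (fun w => A (lsubmx w) * B (rsubmx w)) u =
  'D_a A (lsubmx u) * B (rsubmx u).
Proof.
move=> dA.
have dA' : derivable A (lsubmx u) a by exact: diff_derivable.
rewrite [RHS]mulrC.
apply: etrans (deriveZ (B (rsubmx u)) dA'); apply: derive_same_line => h.
rewrite lsubmx_line rsubmx_line row_mxKl row_mxKr scaler0 add0r.
exact: mulrC.
Qed.

Lemma open_lsubmx (U : set 'rV[R]_n1) : open U ->
  open ((lsubmx : 'rV[R]_(n1 + n2) -> _) @^-1` U).
Proof. by move=> oU; apply: open_comp => // x _; exact: continuous_lsubmx. Qed.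

Lemma open_rsubmx (U : set 'rV[R]_n2) : open U ->
  open ((rsubmx : 'rV[R]_(n1 + n2) -> _) @^-1` U).
Proof. by move=> oU; apply: open_comp => // x _; exact: continuous_rsubmx. Qed.

Lemma smooth_lsubmx (U : set 'rV[R]_n1) (f : 'rV[R]_n1 -> R) :
  open U -> smooth U f ->
  smooth ((lsubmx : 'rV[R]_(n1 + n2) -> _) @^-1` U) (fun w => f (lsubmx w)).
Proof.
move=> oU + k; elim: k f => [|k IH] f sf /=.
  move=> u Uu; apply: differentiable_continuous.
  apply: (@differentiable_comp _ _ _ _ lsubmx f).
    exact: differentiable_lsubmx.
  exact: smooth_diff sf Uu.
split=> [u Uu|i].
  apply: (@differentiable_comp _ _ _ _ lsubmx f).
    exact: differentiable_lsubmx.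
  exact: smooth_diff sf Uu.
have -> : 'D_(delta_mx 0 i) (fun w : 'rV[R]_(n1 + n2) => f (lsubmx w)) =
    (fun w => ('D_(lsubmx (delta_mx 0 i)) f) (lsubmx w)).
  by apply/funext => w; exact: derive_lsubmx.
exact: IH (smooth_derive _ oU sf).
Qed.

Lemma smooth_rsubmx (U : set 'rV[R]_n2) (f : 'rV[R]_n2 -> R) :
  open U -> smooth U f ->
  smooth ((rsubmx : 'rV[R]_(n1 + n2) -> _) @^-1` U) (fun w => f (rsubmx w)).
Proof.
move=> oU + k; elim: k f => [|k IH] f sf /=.
  move=> u Uu; apply: differentiable_continuous.
  apply: (@differentiable_comp _ _ _ _ rsubmx f).
    exact: differentiable_rsubmx.
  exact: smooth_diff sf Uu.
split=> [u Uu|i].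
  apply: (@differentiable_comp _ _ _ _ rsubmx f).
    exact: differentiable_rsubmx.
  exact: smooth_diff sf Uu.
have -> : 'D_(delta_mx 0 i) (fun w : 'rV[R]_(n1 + n2) => f (rsubmx w)) =
    (fun w => ('D_(rsubmx (delta_mx 0 i)) f) (rsubmx w)).
  by apply/funext => w; exact: derive_rsubmx.
exact: IH (smooth_derive _ oU sf).
Qed.

End ProductCalculus.

Definition hessian (R : realType) n (g : 'rV[R]_n -> 'M[R]_n) (f : 'rV[R]_n -> R)
    u x y : R :=
  'D_x ('D_y f) u - 'D_(Gamma g u x y) f u.

Section Gradient.
Context (R : realType) (n : nat) (U : set 'rV[R]_n) (g : 'rV[R]_n -> 'M[R]_n).
Context (f : 'rV[R]_n -> R).
Hypothesis (hg : metric_on U g) (sf : smooth U f).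
Let oU := mo_open hg.

Lemma inner_grad u y : U u -> inner g u (grad g f u) y = 'D_y f u.
Proof.
move=> Uu; rewrite /inner /grad mulmxKV; last exact: mo_unit hg _ Uu.
rewrite mxE (derive_dir_coord _ (smooth_diff sf Uu)); apply: eq_bigr => i _.
by rewrite !mxE mulrC.
Qed.

Lemma differentiable_grad u : U u -> differentiable (grad g f) u.
Proof.
move=> Uu; apply/differentiable_mxP => i j.
under eq_fun do rewrite mxE.
apply: differentiable_bigsum => l; apply: differentiable_mul.
  under eq_fun do rewrite mxE.
  exact: smooth_diff (smooth_partial l sf) Uu.
apply: (differentiable_mxP (fun w => invmx (g w)) u).2.
apply: differentiable_invmx; first exact: metric_diff hg _ Uu.
exact: near_open oU Uu (mo_unit hg).
Qed.

(** Differentiate <grad f, y> = D_y f. *)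
Lemma inner_cov_grad u x y : U u ->
  inner g u (cov g id x (grad g f) u) y = hessian g f u x y.
Proof.
move=> Uu.
have H := derive_inner_cov hg (@smooth_id R n U) (fun _ h => h) Uu
  (differentiable_grad Uu) (differentiable_cst y u) x.
have E : 'D_x (fun w => inner g (id w) (grad g f w) (cst y w)) u = 'D_x ('D_y f) u.
  apply: near_eq_derive; apply: (near_open oU Uu) => w Uw.
  exact: inner_grad Uw.
have C : inner g (id u) (grad g f u) (cov g id x (cst y) u) =
    'D_(Gamma g u x y) f u.
  apply: etrans (inner_grad _ Uu); apply: (f_equal (inner g u (grad g f u))).
  by rewrite cov_id derive_cst add0r.
by rewrite /hessian -E H C addrK.
Qed.

(** The divergence is the trace of x |-> nabla_x (grad f), and the trace of an
    endomorphism can be computed in any orthonormal basis. *)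
Lemma laplacianE m (E : 'M[R]_(m, n)) u : U u -> m = n ->
  E *m g u *m E^T = 1%:M ->
  laplacian g f u = - \sum_i hessian g f u (row i E) (row i E).
Proof.
move=> Uu mn; subst m => EgE; rewrite /laplacian; congr (- _).
have dG := differentiable_grad Uu.
pose A : 'M[R]_n := \matrix_(i, j) (cov g id (delta_mx 0 i) (grad g f) u) 0 j.
have AE x : cov g id x (grad g f) u = x *m A.
  rewrite cov_id (derive_dir_coord _ dG).
  rewrite [X in _ + Gamma g u X _]row_sum_delta.
  rewrite (bil_sum1 (Gamma_bilinear g u)) -big_split/=.
  apply/rowP => j; rewrite summxE mxE; apply: eq_bigr => i _.
  by rewrite (bilZ1 (Gamma_bilinear g u)) -scalerDr -cov_id !mxE.
have -> : divergence g (grad g f) u = \tr A.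
  by apply: eq_bigr => i _; rewrite [RHS]mxE cov_id.
have -> : \tr A = \tr (E *m A *m g u *m E^T).
  rewrite -!mulmxA mxtrace_mulC -!mulmxA.
  have -> : g u *m (E^T *m E) = 1%:M.
    by rewrite mulmxA; apply: mulmx1C; rewrite mulmxA.
  by rewrite mulmx1.
apply: eq_bigr => i _; rewrite -(inner_cov_grad _ _ Uu) AE /inner.
rewrite -!row_mul [RHS]mxE [LHS]mxE.
rewrite [RHS]mxE; apply: eq_bigr => l _. by congr (_ * _); rewrite !mxE.
Qed.

End Gradient.

(** * Curvature of warped products *)

Definition warped_metric (R : realType) n1 n2 (g1 : 'rV[R]_n1 -> 'M[R]_n1)
    (g2 : 'rV[R]_n2 -> 'M[R]_n2) (f : 'rV[R]_n1 -> R) (u : 'rV[R]_(n1 + n2)) :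
    'M[R]_(n1 + n2) :=
  block_mx (g1 (lsubmx u)) 0 0 (f (lsubmx u) ^+ 2 *: g2 (rsubmx u)).

Section WarpedCurvature.
Context (R : realType) (n1 n2 : nat).
Context (U1 : set 'rV[R]_n1) (U2 : set 'rV[R]_n2).
Context (g1 : 'rV[R]_n1 -> 'M[R]_n1) (g2 : 'rV[R]_n2 -> 'M[R]_n2).
Context (f : 'rV[R]_n1 -> R).
Hypothesis (h1 : metric_on U1 g1) (h2 : metric_on U2 g2).
Hypothesis (sf : smooth U1 f) (f0 : forall u, U1 u -> f u != 0).

Let U : set 'rV[R]_(n1 + n2) := [set u | U1 (lsubmx u) /\ U2 (rsubmx u)].
Let gw := warped_metric g1 g2 f.
Let hor (x : 'rV[R]_n1) : 'rV[R]_(n1 + n2) := row_mx x 0.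
Let ver (z : 'rV[R]_n2) : 'rV[R]_(n1 + n2) := row_mx 0 z.

Lemma inner_warped u x y : inner gw u x y =
  inner g1 (lsubmx u) (lsubmx x) (lsubmx y)
  + f (lsubmx u) ^+ 2 * inner g2 (rsubmx u) (rsubmx x) (rsubmx y).
Proof.
rewrite /inner -{1}(hsubmxK x) -{1}(hsubmxK y) mul_row_block !mulmx0 addr0 add0r.
by rewrite tr_row_mx mul_row_col mxE -scalemxAr -scalemxAl [X in _ + X]mxE.
Qed.

Lemma inner_hor u x x' :
  inner gw u (hor x) (hor x') = inner g1 (lsubmx u) x x'.
Proof.
rewrite inner_warped !row_mxKl !row_mxKr (bil01 (inner_bilinear g2 _)).
by rewrite mulr0 addr0.
Qed.

Lemma inner_ver u z z' :
  inner gw u (ver z) (ver z') = f (lsubmx u) ^+ 2 * inner g2 (rsubmx u) z z'.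
Proof.
rewrite inner_warped !row_mxKl !row_mxKr (bil01 (inner_bilinear g1 _)).
by rewrite add0r.
Qed.

Lemma inner_hor_ver u x z : inner gw u (hor x) (ver z) = 0.
Proof.
rewrite inner_warped !row_mxKl !row_mxKr (bil02 (inner_bilinear g1 _)).
by rewrite (bil01 (inner_bilinear g2 _)) mulr0 addr0.
Qed.

Lemma inner_ver_hor u x z : inner gw u (ver z) (hor x) = 0.
Proof.
rewrite inner_warped !row_mxKl !row_mxKr (bil01 (inner_bilinear g1 _)).
by rewrite (bil02 (inner_bilinear g2 _)) mulr0 addr0.
Qed.

Lemma hor_add_ver (y : 'rV[R]_(n1 + n2)) : y = hor (lsubmx y) + ver (rsubmx y).
Proof. by rewrite /hor /ver add_row_mx addr0 add0r hsubmxK. Qed.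

Lemma smooth_sqr : smooth U1 (fun v => f v ^+ 2).
Proof. exact: smoothM (mo_open h1) sf sf. Qed.

Lemma metric_on_warped : metric_on U gw.
Proof.
have oU1 := mo_open h1; have oU2 := mo_open h2.
have oU : open U.
  exact: openI (open_lsubmx (n2 := n2) oU1) (open_rsubmx (n1 := n1) oU2).
have sl h : smooth U1 h -> smooth U (fun w => h (lsubmx w)).
  move=> sh; have S := smooth_lsubmx n2 oU1 sh.
  by apply: (smooth_sub _ S) => w [].
have sr h : smooth U2 h -> smooth U (fun w => h (rsubmx w)).
  move=> sh; have S := smooth_rsubmx n1 oU2 sh.
  by apply: (smooth_sub _ S) => w [].
split=> //.
- move=> i j; rewrite /gw /warped_metric.
  have E h : (forall w, block_mx (g1 (lsubmx w)) 0 0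
      (f (lsubmx w) ^+ 2 *: g2 (rsubmx w)) i j = h w) -> smooth U h ->
      smooth U (fun w => block_mx (g1 (lsubmx w)) 0 0
      (f (lsubmx w) ^+ 2 *: g2 (rsubmx w)) i j).
    by move=> eh; apply: smooth_eq.
  case: (split_ordP i) E => i' ->; case: (split_ordP j) => j' -> E.
  + apply: E (fun w => block_mxEul _ _ _ _ i' j') _.
    exact: (sl (fun v => g1 v i' j') (mo_smooth h1 i' j')).
  + apply: (E (cst 0)); last exact: smooth_cst.
    by move=> w; rewrite block_mxEur mxE.
  + apply: (E (cst 0)); last exact: smooth_cst.
    by move=> w; rewrite block_mxEdl mxE.
  + apply: (E (fun w => f (lsubmx w) ^+ 2 * g2 (rsubmx w) i' j')).
      by move=> w; rewrite block_mxEdr mxE.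
    apply: smoothM => //; first exact: (sl _ smooth_sqr).
    exact: (sr (fun v => g2 v i' j') (mo_smooth h2 i' j')).
- move=> u [u1 u2]; rewrite /gw /warped_metric tr_block_mx !trmx0 linearZ/=.
  by rewrite (mo_sym h1 u1) (mo_sym h2 u2).
- move=> u [u1 u2]; rewrite /gw /warped_metric unitmxE det_ublock unitrM.
  rewrite -!unitmxE (mo_unit h1 u1) unitmxZ ?(mo_unit h2 u2)//.
  by rewrite unitfE expf_eq0 /= f0.
Qed.

Let dsqr u : U1 u -> differentiable (fun v => f v ^+ 2) u.
Proof. exact: smooth_diff smooth_sqr. Qed.

Let dg2 u x y : U2 u -> differentiable (fun v => inner g2 v x y) u.
Proof. by move=> Uu; apply: differentiable_inner; exact: metric_diff h2 _ Uu. Qed.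

Let derive_sqr u a : U1 u -> 'D_a (fun v => f v ^+ 2) u = 2 * f u * 'D_a f u.
Proof.
move=> Uu.
have df : derivable f u a by exact: diff_derivable (smooth_diff sf Uu).
rewrite (deriveX 2 df) -[_ *: _]/(_ * _) /= expr1.
by rewrite -mulr_natl.
Qed.

Let D_hh a x y u : 'D_(hor a) (fun w => inner gw w (hor x) (hor y)) u =
  'D_a (fun v => inner g1 v x y) (lsubmx u).
Proof.
have -> : (fun w => inner gw w (hor x) (hor y)) =
    (fun w => inner g1 (lsubmx w) x y).
  by apply/funext => w; rewrite inner_hor.
by rewrite (derive_lsubmx (fun v => inner g1 v x y)) row_mxKl.
Qed.

Let D_vh a x y u : 'D_(ver a) (fun w => inner gw w (hor x) (hor y)) u = 0.
Proof.
have -> : (fun w => inner gw w (hor x) (hor y)) =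
    (fun w => inner g1 (lsubmx w) x y).
  by apply/funext => w; rewrite inner_hor.
by rewrite (derive_lsubmx (fun v => inner g1 v x y)) row_mxKl derive0.
Qed.

Let D_hv a x y u : 'D_a (fun w => inner gw w (hor x) (ver y)) u = 0.
Proof.
have -> : (fun w => inner gw w (hor x) (ver y)) = cst 0.
  by apply/funext => w; rewrite inner_hor_ver.
exact: derive_cst.
Qed.

Let D_vh' a x y u : 'D_a (fun w => inner gw w (ver y) (hor x)) u = 0.
Proof.
have -> : (fun w => inner gw w (ver y) (hor x)) = cst 0.
  by apply/funext => w; rewrite inner_ver_hor.
exact: derive_cst.
Qed.

Let inner_ver_fun y z : (fun w => inner gw w (ver y) (ver z)) =
  (fun w => (fun v => f v ^+ 2) (lsubmx w) * inner g2 (rsubmx w) y z).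
Proof. by apply/funext => w; rewrite inner_ver. Qed.

Let D_hvv a y z u : U u -> 'D_(hor a) (fun w => inner gw w (ver y) (ver z)) u =
  'D_a (fun v => f v ^+ 2) (lsubmx u) * inner g2 (rsubmx u) y z.
Proof.
move=> [u1 u2]; rewrite inner_ver_fun.
exact: (derive_horizontal (fun v => inner g2 v y z) a (dsqr u1)).
Qed.

Let D_vvv a y z u : U u -> 'D_(ver a) (fun w => inner gw w (ver y) (ver z)) u =
  f (lsubmx u) ^+ 2 * 'D_a (fun v => inner g2 v y z) (rsubmx u).
Proof.
move=> [u1 u2]; rewrite inner_ver_fun.
exact: (derive_vertical (fun v => f v ^+ 2) a (dg2 y z u2)).
Qed.

Let inner_ext u v v' : U u ->
  (forall x, inner gw u v (hor x) = inner gw u v' (hor x)) ->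
  (forall z, inner gw u v (ver z) = inner gw u v' (ver z)) -> v = v'.
Proof.
move=> uU eh ev.
have gU := mo_unit metric_on_warped uU.
have e y : inner gw u v y = inner gw u v' y.
  rewrite (hor_add_ver y); have bil := inner_bilinear gw u.
  by rewrite (bilD2 bil v) (bilD2 bil v') eh ev.
suff : v *m gw u = v' *m gw u by move/(can_inj (mulmxK gU)).
apply/rowP => j; have := e (delta_mx 0 j).
by rewrite /inner trmx_delta -!colE !mxE.
Qed.

(** O'Neill's formulas for the Levi-Civita connection of a warped product. Each
    is checked by pairing with horizontal and with vertical vectors, using
    Koszul's formula. *)
Lemma Gamma_warped_hv u x z : U u -> Gamma gw u (hor x) (ver z) =
  ver (('D_x f (lsubmx u) / f (lsubmx u)) *: z).
Proof.
move=> Uu; have [u1 u2] := Uu.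
apply: (inner_ext Uu) => y.
  apply: etrans (inner_GammaE metric_on_warped _ _ _ Uu) _.
  rewrite /koszul D_vh' D_vh D_hv inner_ver_hor; ring.
apply: etrans (inner_GammaE metric_on_warped _ _ _ Uu) _.
rewrite /koszul (D_hvv x z y Uu) D_hv D_hv inner_ver (derive_sqr x u1).
rewrite (bilZ1 (inner_bilinear g2 _)) -[_ *: _]/(_ * _).
move: (inner g2 _ _ _) ('D_x f _) (f0 u1) => r d; move: (f _) => e e0.
by field.
Qed.

Lemma Gamma_warped_hh u x y : U u ->
  Gamma gw u (hor x) (hor y) = hor (Gamma g1 (lsubmx u) x y).
Proof.
move=> Uu; have [u1 u2] := Uu.
apply: (inner_ext Uu) => z.
  apply: etrans (inner_GammaE metric_on_warped _ _ _ Uu) _.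
  rewrite inner_hor (inner_GammaE h1 _ _ _ u1) /koszul.
  by rewrite (D_hh x) (D_hh y) (D_hh z).
apply: etrans (inner_GammaE metric_on_warped _ _ _ Uu) _.
by rewrite /koszul D_hv D_hv D_vh inner_hor_ver; ring.
Qed.

Lemma Gamma_warped_vv u y z : U u -> Gamma gw u (ver y) (ver z) =
  row_mx (- (f (lsubmx u) * inner g2 (rsubmx u) y z) *: grad g1 f (lsubmx u))
         (Gamma g2 (rsubmx u) y z).
Proof.
move=> Uu; have [u1 u2] := Uu.
rewrite -[RHS]hsubmxK row_mxKl row_mxKr.
have -> (a : 'rV[R]_n1) (b : 'rV[R]_n2) : row_mx a b = hor a + ver b.
  by rewrite [LHS]hor_add_ver row_mxKl row_mxKr.
apply: (inner_ext Uu) => x.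
  apply: etrans (inner_GammaE metric_on_warped _ _ _ Uu) _.
  rewrite (bilD1 (inner_bilinear gw u)) inner_hor inner_ver_hor addr0.
  rewrite (bilZ1 (inner_bilinear g1 _)) (inner_grad h1 sf _ u1).
  rewrite /koszul D_vh' D_vh' (D_hvv x y z Uu) (derive_sqr x u1).
  rewrite -[_ *: _]/(_ * _).
  move: (inner g2 _ _ _) ('D_x f _) (f _) => r d e; by field.
apply: etrans (inner_GammaE metric_on_warped _ _ _ Uu) _.
rewrite (bilD1 (inner_bilinear gw u)) inner_hor_ver inner_ver add0r.
rewrite (inner_GammaE h2 _ _ _ u2) /koszul.
have solve (F A B C A' B' C' : R) : A' = F * A -> B' = F * B -> C' = F * C ->
    2^-1 * (A' + B' - C') = F * (2^-1 * (A + B - C)).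
  by move=> -> -> ->; ring.
exact: solve (D_vvv y z x Uu) (D_vvv z y x Uu) (D_vvv x y z Uu).
Qed.

Let dd_vv a b p q u : U u ->
  'D_(ver a) ('D_(ver b) (fun w => inner gw w (ver p) (ver q))) u =
  f (lsubmx u) ^+ 2 * 'D_a ('D_b (fun v => inner g2 v p q)) (rsubmx u).
Proof.
move=> Uu; have [u1 u2] := Uu.
have sg := smooth_inner p q (mo_open h2) (mo_smooth h2).
have dD := smooth_diff (smooth_derive b (mo_open h2) sg) u2.
apply: etrans (derive_vertical (fun v => f v ^+ 2) a dD).
apply: near_eq_derive; apply: (near_open (mo_open metric_on_warped) Uu) => w Uw.
exact: (D_vvv b p q Uw).
Qed.

Let dd_hh x z u : U u ->
  'D_(hor x) ('D_(hor x) (fun w => inner gw w (ver z) (ver z))) u =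
  (2 * 'D_x f (lsubmx u) ^+ 2 + 2 * f (lsubmx u) * 'D_x ('D_x f) (lsubmx u))
  * inner g2 (rsubmx u) z z.
Proof.
move=> Uu; have [u1 u2] := Uu.
have dD := smooth_diff (smooth_derive x (mo_open h1) smooth_sqr) u1.
have df : derivable f (lsubmx u) x by exact: diff_derivable (smooth_diff sf u1).
have dDf : derivable ('D_x f) (lsubmx u) x.
  exact: diff_derivable (smooth_diff (smooth_derive x (mo_open h1) sf) u1).
have E : 'D_x ('D_x (fun v => f v ^+ 2)) (lsubmx u) =
    2 * 'D_x f (lsubmx u) ^+ 2 + 2 * f (lsubmx u) * 'D_x ('D_x f) (lsubmx u).
  have -> : 'D_x ('D_x (fun v => f v ^+ 2)) (lsubmx u) =
      'D_x (2 *: (f * 'D_x f)) (lsubmx u).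
    apply: near_eq_derive; apply: (near_open (mo_open h1) u1) => w Uw.
    by rewrite (derive_sqr x Uw) -mulrA.
  rewrite (deriveZ 2 (derivableM df dDf)) (deriveM df dDf) -![_ *: _]/(_ * _).
  move: ('D_x f (lsubmx u)) ('D_x ('D_x f) (lsubmx u)) => d e; ring.
rewrite -E.
apply: etrans (derive_horizontal (fun v => inner g2 v z z) x dD).
apply: near_eq_derive; apply: (near_open (mo_open metric_on_warped) Uu) => w Uw.
exact: (D_hvv x z z Uw).
Qed.

(** In [riemannE] only the second derivative of f^2 along x survives; its part
    2 (D_x f)^2 cancels against |Gamma (x, z)|^2. *)
Lemma riemann_warped_mixed u x z : U u ->
  riemann gw u (hor x) (ver z) (ver z) (hor x) =
  - (f (lsubmx u) * inner g2 (rsubmx u) z z * hessian g1 f (lsubmx u) x x).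
Proof.
move=> Uu; have [u1 u2] := Uu.
have zero (k : 'rV[R]_(n1 + n2) -> R) v : (forall w, k w = 0) -> 'D_v k u = 0.
  by move=> k0; rewrite (_ : k = cst 0) ?derive_cst//; exact/funext.
have e1 := zero _ (hor x) (fun w => D_vh' (ver z) x z w).
have e3 := zero _ (ver z) (fun w => D_vh z x x w).
have e4 := zero _ (ver z) (fun w => D_hv (hor x) x z w).
have e5 : inner gw u (Gamma gw u (hor x) (ver z)) (Gamma gw u (ver z) (hor x))
   = 'D_x f (lsubmx u) ^+ 2 * inner g2 (rsubmx u) z z.
  rewrite (GammaC metric_on_warped (ver z) _ Uu) (Gamma_warped_hv _ _ Uu) inner_ver.
  rewrite (bilZ1 (inner_bilinear g2 _)) (bilZ2 (inner_bilinear g2 _)).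
  rewrite -![_ *: _]/(_ * _).
  move: (inner g2 _ _ _) ('D_x f _) (f0 u1) => r d; move: (f _) => e e0.
  by field.
have e6 : inner gw u (Gamma gw u (ver z) (ver z)) (Gamma gw u (hor x) (hor x))
   = - (f (lsubmx u) * inner g2 (rsubmx u) z z)
     * 'D_(Gamma g1 (lsubmx u) x x) f (lsubmx u).
  rewrite (Gamma_warped_vv _ _ Uu) (Gamma_warped_hh _ _ Uu) inner_warped.
  rewrite !row_mxKl !row_mxKr (bil02 (inner_bilinear g2 _)) mulr0 addr0.
  by rewrite (bilZ1 (inner_bilinear g1 _)) (inner_grad h1 sf _ u1).
have solve (T A B C D P Q d e G h k : R) : A = 0 -> C = 0 -> D = 0 ->
    B = (2 * d ^+ 2 + 2 * e * h) * G -> P = d ^+ 2 * G -> Q = - (e * G) * k ->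
    T = 2^-1 * (A - B - C + D) + P - Q -> T = - (e * G * (h - k)).
  by move=> -> -> -> -> -> -> ->; field.
apply: (solve _ _ _ _ _ _ _ _ _ _ _ _ e1 e3 e4 (dd_hh x z Uu) e5 e6).
exact: (riemannE metric_on_warped _ _ _ _ Uu).
Qed.

(** The fibre is umbilic: the horizontal part of Gamma (y, z) is
    - f <y, z> grad f, and its products give the correction to f^2 times the
    curvature of the second factor. *)
Lemma riemann_warped_vertical u y z : U u ->
  riemann gw u (ver y) (ver z) (ver z) (ver y) =
  f (lsubmx u) ^+ 2 * (riemann g2 (rsubmx u) y z z y
   + inner g1 (lsubmx u) (grad g1 f (lsubmx u)) (grad g1 f (lsubmx u))
     * (inner g2 (rsubmx u) y z ^+ 2
        - inner g2 (rsubmx u) y y * inner g2 (rsubmx u) z z)).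
Proof.
move=> Uu; have [u1 u2] := Uu.
set N := inner g1 _ _ _.
have P a b p q : inner gw u (Gamma gw u (ver a) (ver b)) (Gamma gw u (ver p) (ver q))
   = f (lsubmx u) ^+ 2 * (inner g2 (rsubmx u) a b * inner g2 (rsubmx u) p q * N
     + inner g2 (rsubmx u) (Gamma g2 (rsubmx u) a b) (Gamma g2 (rsubmx u) p q)).
  rewrite (Gamma_warped_vv a b Uu) (Gamma_warped_vv p q Uu) inner_warped.
  rewrite !row_mxKl !row_mxKr (bilZ1 (inner_bilinear g1 _)).
  rewrite (bilZ2 (inner_bilinear g1 _)) -/N -![_ *: _]/(_ * _).
  rewrite mulrDr; congr (_ + _).
  move: (inner g2 _ a b) (inner g2 _ p q) => r s; ring.
have solve (F T A B C D A' B' C' D' P1 P1' Q1 Q1' T' r r' s t : R) :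
    A' = F * A -> B' = F * B -> C' = F * C -> D' = F * D ->
    P1' = F * (r * r' * N + P1) -> Q1' = F * (s * t * N + Q1) ->
    T = 2^-1 * (A - B - C + D) + P1 - Q1 ->
    T' = 2^-1 * (A' - B' - C' + D') + P1' - Q1' ->
    r' = r -> T' = F * (T + N * (r ^+ 2 - t * s)).
  by move=> -> -> -> -> -> -> -> -> ->; ring.
apply: (solve _ _ _ _ _ _ _ _ _ _ _ _ _ _ _ _ _ _ _
  (dd_vv y z z y Uu) (dd_vv y y z z Uu) (dd_vv z z y y Uu) (dd_vv z y y z Uu)
  (P y z z y) (P z z y y)).
- exact: (riemannE h2 _ _ _ _ u2).
- exact: (riemannE metric_on_warped _ _ _ _ Uu).
- exact: (innerCE h2 _ _ u2).
Qed.

Lemma sectional_warped_vertical u y z : U u ->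
  inner g2 (rsubmx u) y y * inner g2 (rsubmx u) z z
    - inner g2 (rsubmx u) y z ^+ 2 != 0 ->
  sectional gw u (ver y) (ver z) =
  (f (lsubmx u) ^+ 2)^-1 * (sectional g2 (rsubmx u) y z
   - inner g1 (lsubmx u) (grad g1 f (lsubmx u)) (grad g1 f (lsubmx u))).
Proof.
move=> Uu D0; have fn := f0 Uu.1.
rewrite !sectionalE !inner_ver (riemann_warped_vertical _ _ Uu).
move: (riemann _ _ _ _ _ _) (inner g1 _ _ _) => r N.
move: (inner _ _ y y) (inner _ _ z z) (inner _ _ y z) D0 => yy zz yz D0.
move: (f _) fn => e e0; field.
rewrite D0 e0 /=.
have -> : e ^+ 2 * yy * (e ^+ 2 * zz) - (e ^+ 2 * yz) ^+ 2 =
    e ^+ 4 * (yy * zz - yz ^+ 2) by ring.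
by rewrite mulf_neq0// expf_neq0.
Qed.

End WarpedCurvature.

(** * Orthonormal bases and Bessel's inequality *)

Section OrthonormalBases.
Context (R : realType).

Definition posdef n (S : 'M[R]_n) : Prop :=
  S^T = S /\ forall v : 'rV[R]_n, v != 0 -> 0 < (v *m S *m v^T) 0 0.

Lemma posdef_congr m n (S : 'M[R]_n) (P : 'M[R]_(m, n)) :
  posdef S -> row_free P -> posdef (P *m S *m P^T).
Proof.
move=> [ST Spos] fP; split=> [|v v0].
  by rewrite !trmx_mul trmxK ST mulmxA.
have := Spos (v *m P); rewrite trmx_mul !mulmxA; apply.
apply: contraNneq v0 => vP; apply/eqP; apply: (row_free_inj fP).
by rewrite vP mul0mx.
Qed.

(** Gram-Schmidt on block matrices: clear the first row and column and continue
    with the Schur complement [T]. *)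
Lemma posdef_diagonalize n (S : 'M[R]_n) : posdef S ->
  exists L : 'M[R]_n, L *m S *m L^T = 1%:M.
Proof.
elim: n S => [|n IH] S pS; first by exists 0; apply/matrixP => [[]].
pose S' : 'M[R]_(1 + n) := S.
have pS' : posdef S' := pS.
have [ST Spos] := pS'.
pose a := ulsubmx S' 0 0; pose b := ursubmx S'; pose D := drsubmx S'.
have aE : ulsubmx S' = a%:M by rewrite [LHS]mx11_scalar.
have dl : dlsubmx S' = b^T by rewrite /b trmx_ursub ST.
have SE : S' = block_mx a%:M b b^T D by rewrite -aE -dl submxK.
have a0 : 0 < a.
  have e0 : (row_mx 1%:M 0 : 'rV[R]_(1 + n)) != 0.
    apply/eqP => /(congr1 lsubmx)/matrixP/(_ 0 0).
    by rewrite row_mxKl !mxE eqxx => /eqP; rewrite oner_eq0.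
  have := Spos _ e0; rewrite SE mul_row_block tr_row_mx mul_row_col.
  by rewrite !mul0mx !addr0 trmx0 mulmx0 addr0 trmx1 mulmx1 mul1mx mxE eqxx.
pose P : 'M[R]_(1 + n) := block_mx 1%:M 0 (- a^-1 *: b^T) 1%:M.
pose T := D - a^-1 *: (b^T *m b).
have ba : (- a^-1 *: b^T) *m a%:M = - b^T.
  by rewrite mul_mx_scalar scalerA mulrN mulfV ?gt_eqF// scaleN1r.
have PS : P *m S' = block_mx a%:M b 0 T.
  rewrite SE /P mulmx_block !mul1mx !mul0mx !addr0 ba addNr; congr block_mx.
  by rewrite -scalemxAl scaleNr addrC.
have PT : P^T = block_mx 1%:M (- a^-1 *: b) 0 1%:M.
  by rewrite /P tr_block_mx !trmx1 trmx0 linearZ/= trmxK.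
have ab : a%:M *m (- a^-1 *: b) = - b.
  by rewrite mul_scalar_mx scalerA mulrN mulfV ?gt_eqF// scaleN1r.
have PSP : P *m S' *m P^T = block_mx a%:M 0 0 T.
  rewrite PS PT mulmx_block !mulmx1 !mulmx0 !mul0mx !addr0 ab addNr.
  by rewrite add0r.
have fP : row_free P.
  by rewrite row_free_unit unitmxE /P det_lblock !det1 mulr1 unitr1.
have := posdef_congr pS' fP; rewrite PSP => -[TT Tpos].
have pT : posdef T.
  split=> [|v v0].
    by move: TT; rewrite tr_block_mx => /eq_block_mx[].
  have e0 : (row_mx 0 v : 'rV[R]_(1 + n)) != 0.
    apply: contraNneq v0 => /(congr1 rsubmx).
    by rewrite row_mxKr => ->; rewrite linear0.
  have := Tpos _ e0; rewrite mul_row_block tr_row_mx mul_row_col.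
  by rewrite !mul0mx !mulmx0 !add0r trmx0 mulmx0 add0r.
have [L' L'E] := IH T pT.
pose s := (Num.sqrt a)^-1.
have sas : s * a * s = 1.
  rewrite -{1}(sqr_sqrtr (ltW a0)) /s expr2 mulrA mulVf ?mul1r ?mulfV//.
    by rewrite gt_eqF ?sqrtr_gt0.
  by rewrite gt_eqF ?sqrtr_gt0.
pose Q : 'M[R]_(1 + n) := block_mx s%:M 0 0 L'.
suff : (Q *m P) *m S' *m (Q *m P)^T = 1%:M by exists (Q *m P).
rewrite trmx_mul !mulmxA -(mulmxA Q) -(mulmxA Q) PSP /Q.
rewrite tr_block_mx !trmx0 tr_scalar_mx !mulmx_block.
rewrite !(mul0mx, mulmx0, addr0, add0r) L'E.
by rewrite -!scalar_mxM sas -scalar_mx_block.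
Qed.

Lemma orthonormal_complete n (S E : 'M[R]_n) :
  E *m S *m E^T = 1%:M -> S *m (E^T *m E) = 1%:M.
Proof. by move=> h; rewrite mulmxA; apply: mulmx1C; rewrite mulmxA. Qed.

Lemma orthonormal_basisP n p (g : 'rV[R]_n -> 'M[R]_n) u (V : 'M[R]_(p, n)) :
  posdef (g u) ->
  let E := orthonormal_basis g u V in
  E *m g u *m E^T = 1%:M /\ (E == V)%MS.
Proof.
move=> pg E.
have bV := eq_row_base V; have fV := row_base_free V.
move: (row_base V) bV fV => B bV fV.
have [L LE] := posdef_diagonalize (posdef_congr pg fV).
suff : [set E : 'M[R]_(\rank V, n) | E *m g u *m E^T = 1%:M /\ (E == V)%MS]
    (L *m B).
  by move=> H; exact: (xgetPex 0 (ex_intro _ _ H)).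
have uL : L \in unitmx.
  by move: LE; rewrite -!mulmxA => /mulmx1_unit[].
split=> /=.
  by move: LE; rewrite trmx_mul !mulmxA.
apply/eqmxP; apply: eqmx_trans bV.
by apply: eqmxMfull; rewrite row_full_unit.
Qed.

(** Lets inequalities for a general inner product be proved one coordinate at a
    time. *)
Lemma posdef_sum_squares n (S : 'M[R]_n) : posdef S ->
  exists C : 'M[R]_n, forall x y : 'rV[R]_n,
    (x *m S *m y^T) 0 0 = \sum_k (x *m C) 0 k * (y *m C) 0 k.
Proof.
move=> pS; have [L LE] := posdef_diagonalize pS.
have uL : L \in unitmx.
  by move: LE; rewrite -!mulmxA => /mulmx1_unit[].
have SE : S = invmx L *m (invmx L)^T.
  have -> : invmx L *m (invmx L)^T =
      invmx L *m (L *m S *m L^T) *m (invmx L)^T by rewrite LE mulmx1.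
  rewrite !mulmxA mulVmx// mul1mx -mulmxA.
  by rewrite -trmx_mul mulVmx// trmx1 mulmx1.
exists (invmx L) => x y; rewrite SE !mulmxA -mulmxA -trmx_mul mxE.
by apply: eq_bigr => k _; congr (_ * _); rewrite mxE.
Qed.

End OrthonormalBases.

Section PlaneBound.
Context (R : realType) (r : nat).
Implicit Types (M N H : 'M[R]_r) (a b x y : 'rV[R]_r).

Let ip M N := \tr (M *m N^T).

Let ip_bil : bilinear_at ip.
Proof.
split=> [N|M] k A B; rewrite /ip.
  by rewrite mulmxDl -scalemxAl mxtraceD mxtraceZ.
by rewrite linearD linearZ/= mulmxDr -scalemxAr mxtraceD mxtraceZ.
Qed.

Let ipC M N : ip M N = ip N M.
Proof. by rewrite /ip -mxtrace_tr trmx_mul trmxK. Qed.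

Let ip_sum M : ip M M = \sum_i \sum_j M i j ^+ 2.
Proof.
by apply: eq_bigr => i _; rewrite mxE; apply: eq_bigr => j _; rewrite mxE.
Qed.

Let ip_ge0 M : 0 <= ip M M.
Proof. by rewrite ip_sum; do 2!(apply: sumr_ge0 => ? _); exact: sqr_ge0. Qed.

Let dot a b : R := (a *m b^T) 0 0.

Let tr11 (A : 'M[R]_1) : \tr A = A 0 0.
Proof. by rewrite /mxtrace big_ord1. Qed.

Let ip_outer a b x y : ip (a^T *m b) (x^T *m y) = dot b y * dot a x.
Proof.
rewrite /ip trmx_mul trmxK -mulmxA mxtrace_mulC tr11.
rewrite -!mulmxA mulmxA mxE big_ord1; congr (_ * _).
by rewrite /dot -[LHS]mulr1n -[x *m a^T]trmxK trmx_mul trmxK mxE.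
Qed.

Let q H a b : R := (a *m H *m b^T) 0 0.

Let ip_form H a b : ip H (a^T *m b) = q H a b.
Proof. by rewrite /ip trmx_mul trmxK mulmxA mxtrace_mulC tr11 mulmxA. Qed.

Let q_bil H : bilinear_at (q H).
Proof. exact: (inner_bilinear (cst H) 0). Qed.

Let qC H a b : H^T = H -> q H a b = q H b a.
Proof. exact: (innerC (g := cst H) (u := 0)). Qed.

(** [w] is the orthogonal projection of H to the span of the tensors a a, b b and
    a b + b a for the trace form; |w|^2 <= |H|^2 and
    (al / A + be / B)^2 >= 0 together give the bound. *)
(** Replacing b by its component orthogonal to a changes neither the Gram
    determinant nor the determinant of H on the plane. *)
Lemma plane_bound_orthogonal H a b : H^T = H -> dot a b = 0 ->
  0 < dot a a -> 0 < dot b b ->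
  0 <= dot a a * dot b b * ip H H + 2 * (q H a a * q H b b - q H a b ^+ 2).
Proof.
move=> HT ab A0 B0.
have ba : dot b a = 0.
  rewrite -ab /dot.
  have := innerC (g := cst (1%:M : 'M[R]_r)) (u := 0) b a (trmx1 _ _).
  by rewrite /inner /= !mulmx1.
set A := dot a a in A0 *; set B := dot b b in B0 *.
set al := q H a a; set be := q H b b; set ga := q H a b.
pose w := (al / A ^+ 2) *: (a^T *m a) + ((be / B ^+ 2) *: (b^T *m b)
   + (ga / (A * B)) *: (a^T *m b + b^T *m a)).
have Hw : ip H w = al ^+ 2 / A ^+ 2 + be ^+ 2 / B ^+ 2
    + 2 * ga ^+ 2 / (A * B).
  rewrite /w !(bilD2 ip_bil, bilZ2 ip_bil) !ip_form (qC b a HT) -/al -/be -/ga.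
  rewrite -![_ *: _]/(_ * _); field.
  by rewrite !gt_eqF.
have ww : ip w w = ip H w.
  rewrite Hw /w !(bilD2 ip_bil, bilZ2 ip_bil, bilD1 ip_bil, bilZ1 ip_bil).
  rewrite !ip_outer ab ba -/A -/B -![_ *: _]/(_ * _); field.
  by rewrite !gt_eqF.
have := ip_ge0 (H - w).
rewrite (bilB1 ip_bil) !(bilB2 ip_bil) (ipC w H) ww subrr subr0 Hw.
set S := ip H H => h.
have AB0 : 0 < A * B by rewrite mulr_gt0.
have {}h : 0 <= A * B * (S - (al ^+ 2 / A ^+ 2 + be ^+ 2 / B ^+ 2
   + 2 * ga ^+ 2 / (A * B))) by rewrite mulr_ge0// ltW.
have k : 0 <= A * B * (al / A + be / B) ^+ 2 by rewrite mulr_ge0 ?sqr_ge0// ltW.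
have e1 : A * B * (S - (al ^+ 2 / A ^+ 2 + be ^+ 2 / B ^+ 2
   + 2 * ga ^+ 2 / (A * B))) + A * B * (al / A + be / B) ^+ 2 =
   A * B * S + 2 * (al * be - ga ^+ 2).
  by field; rewrite !gt_eqF.
by rewrite -e1 addr_ge0.
Qed.

Lemma plane_bound H a b : H^T = H ->
  0 < dot a a * dot b b - dot a b ^+ 2 ->
  0 <= (dot a a * dot b b - dot a b ^+ 2) * (\sum_i \sum_j H i j ^+ 2)
       + 2 * (q H a a * q H b b - q H a b ^+ 2).
Proof.
move=> HT D0; rewrite -ip_sum.
have dbil : bilinear_at dot.
  have := inner_bilinear (cst (1%:M : 'M[R]_r)) 0.
  by rewrite /inner /= => -[h1 h2]; split=> [y|x] k c d;
    [have := h1 y k c d|have := h2 x k c d]; rewrite !mulmx1.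
have dC x y : dot x y = dot y x.
  by rewrite /dot -[RHS]mulr1n -[x *m y^T]trmxK trmx_mul trmxK mxE.
have dge x : 0 <= dot x x.
  by rewrite /dot mxE; apply: sumr_ge0 => i _; rewrite mxE -expr2 sqr_ge0.
have A0 : 0 < dot a a.
  rewrite lt_def dge andbT; apply/eqP => a0.
  by move: D0; rewrite a0 mul0r add0r oppr_gt0 ltNge sqr_ge0.
pose t := dot a b / dot a a; pose b' := b - t *: a.
have ab' : dot a b' = 0.
  rewrite /b' (bilB2 dbil) (bilZ2 dbil) /t -[_ *: _]/(_ * _) divfK ?subrr//.
  by rewrite gt_eqF.
have bb' : dot a a * dot b' b' = dot a a * dot b b - dot a b ^+ 2.
  rewrite {1}/b' (bilB1 dbil) (bilZ1 dbil) ab' scaler0 subr0.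
  rewrite /b' (bilB2 dbil) (bilZ2 dbil) /t (dC b a) -[_ *: _]/(_ * _).
  by field; rewrite gt_eqF.
have B0 : 0 < dot b' b' by rewrite -(pmulr_rgt0 _ A0) bb'.
have := plane_bound_orthogonal HT ab' A0 B0; rewrite bb'.
suff -> : q H a a * q H b' b' - q H a b' ^+ 2 = q H a a * q H b b - q H a b ^+ 2.
  by [].
rewrite /b' !(bilB1 (q_bil H), bilB2 (q_bil H), bilZ1 (q_bil H), bilZ2 (q_bil H)).
rewrite (qC b a HT) -![_ *: _]/(_ * _); ring.
Qed.

End PlaneBound.

(** * The algebraic form of Chen's inequality *)

Section RowSums.
Context (R : realType).

Lemma bil_rows n p q r (W : lmodType R) (B : 'rV[R]_n -> 'rV[R]_p -> W)
    (a : 'rV[R]_q) (b : 'rV[R]_r) (E : 'M[R]_(q, n)) (E' : 'M[R]_(r, p)) :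
  bilinear_at B -> B (a *m E) (b *m E') =
  \sum_i \sum_j (a 0 i * b 0 j) *: B (row i E) (row j E').
Proof.
move=> hB; rewrite !mulmx_sum_row (bil_sum1 hB); apply: eq_bigr => i _.
rewrite (bil_sum2 hB); apply: eq_bigr => j _.
by rewrite (bilZ1 hB) (bilZ2 hB) scalerA.
Qed.

Lemma bil_trace m n (W : lmodType R) (B : 'rV[R]_n -> 'rV[R]_n -> W)
    (E : 'M[R]_(m, n)) : bilinear_at B ->
  \sum_i B (row i E) (row i E) =
  \sum_p \sum_q ((E^T *m E) p q) *: B (delta_mx 0 p) (delta_mx 0 q).
Proof.
move=> hB.
under eq_bigr => i _.
  rewrite (bil_coord _ _ hB).
  over.
rewrite exchange_big; apply: eq_bigr => p _.
rewrite exchange_big; apply: eq_bigr => q _.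
rewrite -scaler_suml mxE; congr (_ *: _).
by apply: eq_bigr => i _; rewrite !mxE.
Qed.

(** The trace depends on E only through E^T E, which is the inverse of S. *)
Lemma bil_trace_eq m m' n (W : lmodType R) (B : 'rV[R]_n -> 'rV[R]_n -> W)
    (S : 'M[R]_n) (E : 'M[R]_(m, n)) (E' : 'M[R]_(m', n)) : bilinear_at B ->
  m = n -> m' = n -> E *m S *m E^T = 1%:M -> E' *m S *m E'^T = 1%:M ->
  \sum_i B (row i E) (row i E) = \sum_i B (row i E') (row i E').
Proof.
move=> hB mn m'n; subst m m' => h h'; rewrite !(bil_trace _ hB).
have k := orthonormal_complete h; have k' := orthonormal_complete h'.
suff -> : E^T *m E = E'^T *m E' by [].
have uS : S \in unitmx by case/mulmx1_unit: k.
by apply: (can_inj (mulKmx uS)); rewrite k k'.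
Qed.

Lemma sum_upper_triangle m (phi : 'I_m -> 'I_m -> R) :
  (forall i j, phi i j = phi j i) ->
  \sum_(i < m) \sum_(j < m | (i < j)%N) phi i j =
  2^-1 * (\sum_i \sum_j phi i j - \sum_i phi i i).
Proof.
move=> sym.
have E : \sum_i \sum_j phi i j = \sum_(i < m) \sum_(j < m | (i < j)%N) phi i j
    + \sum_(i < m) \sum_(j < m | (j < i)%N) phi i j + \sum_i phi i i.
  rewrite -!big_split/=; apply: eq_bigr => i _.
  rewrite (bigID (fun j : 'I_m => (i < j)%N))/= -addrA; congr (_ + _).
  rewrite (bigID (fun j : 'I_m => (j < i)%N))/=; congr (_ + _).
    by apply: eq_bigl => j; rewrite -leqNgt; case: ltngtP.
  rewrite (big_pred1 i)// => j; rewrite -!leqNgt -eqn_leq.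
  by rewrite eq_sym.
have E2 : \sum_(i < m) \sum_(j < m | (j < i)%N) phi i j =
    \sum_(i < m) \sum_(j < m | (i < j)%N) phi i j.
  rewrite (exchange_big_dep predT)//=; apply: eq_bigr => i _.
  by apply: eq_bigr => j _.
by rewrite E E2; field.
Qed.

End RowSums.

Section ChenAlgebra.
Context (R : realType) (r N : nat) (S : 'M[R]_N) (h : 'I_r -> 'I_r -> 'rV[R]_N).
Hypothesis (pS : posdef S) (hC : forall i j, h i j = h j i).

Let s (x y : 'rV[R]_N) : R := (x *m S *m y^T) 0 0.
Let form (a b : 'rV[R]_r) : 'rV[R]_N := \sum_i \sum_j (a 0 i * b 0 j) *: h i j.
Let dot (a b : 'rV[R]_r) : R := (a *m b^T) 0 0.

(** In each coordinate of an orthonormal frame of the target, T is minus the trace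
    of h, so the expression is - (tr H)^2 / 2 - |H|^2 / 2 - kappa / D, where kappa
    is the determinant of H on the plane; [plane_bound] estimates the last term. *)
Lemma chen_algebraic_inequality (T : 'rV[R]_N) (a b : 'rV[R]_r) :
  T + \sum_j h j j = 0 -> 0 < dot a a * dot b b - dot a b ^+ 2 ->
  2^-1 * (\sum_i \sum_j (s (h i i) (h j j) - s (h i j) (h i j)))
  + s T (\sum_j h j j)
  - (s (form a a) (form b b) - s (form a b) (form a b))
    / (dot a a * dot b b - dot a b ^+ 2) <= 0.
Proof.
move=> T0 D0; set D := (X in _ / X); have [C sE] := posdef_sum_squares pS.
pose xi k (v : 'rV[R]_N) : R := (v *m C) 0 k.
have {}sE x y : s x y = \sum_k xi k x * xi k y by exact: sE.
have xiD k x y : xi k (x + y) = xi k x + xi k y by rewrite /xi mulmxDl mxE.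
have xi0 k : xi k 0 = 0 by rewrite /xi mul0mx mxE.
have xi_sum k m (G : 'I_m -> 'rV[R]_N) : xi k (\sum_i G i) = \sum_i xi k (G i).
  exact: (big_morph (xi k) (xiD k) (xi0 k)).
have xiZ k c x : xi k (c *: x) = c * xi k x by rewrite /xi -scalemxAl mxE.
pose H k : 'M[R]_r := \matrix_(i, j) xi k (h i j).
have HT k : (H k)^T = H k by apply/matrixP => i j; rewrite !mxE hC.
have formE k x y : xi k (form x y) = (x *m H k *m y^T) 0 0.
  rewrite -[RHS]/(inner (fun _ : 'rV[R]_r => H k) 0 x y) inner_coord xi_sum.
  apply: eq_bigr => i _; rewrite xi_sum; apply: eq_bigr => j _.
  by rewrite xiZ mxE.
pose tr k := \sum_j xi k (h j j).
have trE k : xi k (\sum_j h j j) = tr k by rewrite xi_sum.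
have TE k : xi k T = - tr k.
  by apply/eqP; rewrite -addr_eq0 -trE -xiD T0 xi0.
have e1 : \sum_i \sum_j (s (h i i) (h j j) - s (h i j) (h i j)) =
    \sum_k (tr k ^+ 2 - \sum_i \sum_j H k i j ^+ 2).
  under eq_bigr => i _.
    under eq_bigr => j _ do rewrite !sE -sumrB.
    rewrite exchange_big.
    over.
  rewrite exchange_big; apply: eq_bigr => k _ /=.
  rewrite expr2 {1}/tr mulr_suml -sumrB; apply: eq_bigr => i _.
  rewrite mulr_sumr -sumrB; apply: eq_bigr => j _.
  by rewrite mxE expr2.
have e2 : s T (\sum_j h j j) = \sum_k - tr k ^+ 2.
  by rewrite sE; apply: eq_bigr => k _; rewrite TE trE mulNr expr2.
have e3 : s (form a a) (form b b) - s (form a b) (form a b) =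
    \sum_k ((a *m H k *m a^T) 0 0 * (b *m H k *m b^T) 0 0
            - (a *m H k *m b^T) 0 0 ^+ 2).
  by rewrite !sE -sumrB; apply: eq_bigr => k _; rewrite !formE expr2.
rewrite e1 e2 e3 mulr_sumr mulr_suml -big_split/= -sumrB; apply: sumr_le0 => k _.
have := plane_bound (HT k) D0.
rewrite -/D.
set SS := \sum_i _; set ka := (_ - _ ^+ 2 : R) => pb.
have t2 : 0 <= tr k ^+ 2 by exact: sqr_ge0.
suff : - (ka / D) <= 2^-1 * SS by lra.
rewrite -mulNr ler_pdivrMr//; lra.
Qed.

End ChenAlgebra.

(** * The inequality at a point of a chart *)

Lemma metric_on_sub (R : realType) n (U U' : set 'rV[R]_n) g :
  open U' -> U' `<=` U -> metric_on U g -> metric_on U' g.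
Proof.
move=> oU' UU' hg; split=> //.
- by move=> i j; exact: (smooth_sub UU' (mo_smooth hg i j)).
- by move=> u U'u; exact: (mo_sym hg (UU' _ U'u)).
- by move=> u U'u; exact: (mo_unit hg (UU' _ U'u)).
Qed.

(** With v the multiple |x|^2 y - <x, y> x of the component of y orthogonal to x,
    the Gram determinant is |v|^2 / |x|^2. *)
Lemma gram_gt0 (R : realType) n (S : 'M[R]_n) (P : 'M[R]_(2, n)) :
  posdef S -> row_free P ->
  let s x y : R := (x *m S *m y^T) 0 0 in
  is_true (0 < s (row 0 P) (row 0 P) * s (row 1 P) (row 1 P)
               - s (row 0 P) (row 1 P) ^+ 2).
Proof.
move=> [ST Spos] fP s; set x := row 0 P; set y := row 1 P.
have bil : bilinear_at s := inner_bilinear (cst S) 0.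
have sC a b : s a b = s b a by exact: (innerC (g := cst S) (u := 0)).
have lin0 (k l : R) : k *: x + l *: y = 0 -> k = 0 /\ l = 0.
  move=> kl; pose w : 'rV[R]_2 := \row_i (if i == 0 then k else l).
  have : w *m P = 0.
    by rewrite mulmx_sum_row !big_ord_recl big_ord0 addr0 !mxE/= -kl;
      congr (_ *: row _ _ + _ *: row _ _); apply/val_inj.
  move=> wP; have w0 : w = 0 by apply: (row_free_inj fP); rewrite wP mul0mx.
  split; first by have := congr1 (fun M : 'rV_2 => M 0 0) w0; rewrite !mxE.
  by have := congr1 (fun M : 'rV_2 => M 0 1) w0; rewrite !mxE.
have x0 : x != 0.
  apply: contraTneq isT => x0; have [|/eqP] := lin0 1 0.
    by rewrite x0 scaler0 scale0r addr0.
  by rewrite oner_eq0.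
have xx : 0 < s x x by exact: Spos.
pose v := - s x y *: x + s x x *: y.
have v0 : v != 0.
  by apply: contraTneq xx => /lin0[_ ->]; rewrite ltxx.
have := Spos v v0; rewrite -[(_ *m _ *m _) 0 0]/(s v v).
have -> : s v v = s x x * (s x x * s y y - s x y ^+ 2).
  rewrite /v !(bilD1 bil, bilD2 bil, bilZ1 bil, bilZ2 bil) (sC y x).
  rewrite -![_ *: _]/(_ * _); ring.
by rewrite pmulr_rgt0.
Qed.

Lemma minimal_trace (R : realType) n N (g : 'rV[R]_n -> 'M[R]_n)
    (gt : 'rV[R]_N -> 'M[R]_N) F u m (E : 'M[R]_(m, n)) :
  (0 < n)%N -> posdef (g u) -> bilinear_at (second_ff g gt F u) ->
  mean_curvature g gt F u = 0 -> m = n -> E *m g u *m E^T = 1%:M ->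
  \sum_i second_ff g gt F u (row i E) (row i E) = 0.
Proof.
move=> n0 pg hB /eqP; rewrite /mean_curvature scaler_eq0 invr_eq0 pnatr_eq0.
rewrite eqn0Ngt n0 /= => /eqP H mn hE.
have [hE' _] := orthonormal_basisP (1%:M : 'M[R]_n) pg.
apply: etrans H; apply: (bil_trace_eq hB mn _ hE hE').
exact: mxrank1.
Qed.

Lemma posdef_warped (R : realType) n1 n2 (g1 : 'rV[R]_n1 -> 'M[R]_n1)
    (g2 : 'rV[R]_n2 -> 'M[R]_n2) (f : 'rV[R]_n1 -> R) u :
  f (lsubmx u) != 0 -> posdef (g1 (lsubmx u)) -> posdef (g2 (rsubmx u)) ->
  posdef (warped_metric g1 g2 f u).
Proof.
move=> f0 p1 p2; split=> [|v v0].
  by rewrite /warped_metric tr_block_mx !trmx0 linearZ/= p1.1 p2.1.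
have F0 : 0 < f (lsubmx u) ^+ 2 by rewrite lt_def sqr_ge0 expf_neq0.
rewrite -[(_ *m _ *m _) 0 0]/(inner (warped_metric g1 g2 f) u v v) inner_warped.
have [v1|v1] := eqVneq (lsubmx v) 0; last first.
  apply: ltr_pwDl; first exact: p1.2.
  have [->|v2] := eqVneq (rsubmx v) 0.
    by rewrite (bil01 (inner_bilinear g2 _)) mulr0.
  by rewrite mulr_ge0 ?sqr_ge0// ltW//; exact: p2.2.
have v2 : rsubmx v != 0.
  by apply: contraNneq v0 => v2; rewrite -(hsubmxK v) v1 v2 row_mx0.
by rewrite v1 (bil01 (inner_bilinear g1 _)) add0r mulr_gt0//; exact: p2.2.
Qed.

Section PointwiseInequality.
Context (R : realType) (n1 n2 N : nat) (hn2 : (2 <= n2)%N).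
Context (U1 : set 'rV[R]_n1) (U2 : set 'rV[R]_n2).
Context (g1 : 'rV[R]_n1 -> 'M[R]_n1) (g2 : 'rV[R]_n2 -> 'M[R]_n2).
Context (f : 'rV[R]_n1 -> R).
Hypothesis (h1 : metric_on U1 g1) (h2 : metric_on U2 g2).
Hypothesis (sf : smooth U1 f) (f0 : forall u, U1 u -> 0 < f u).
Let gw := warped_metric g1 g2 f.

Context (W : set 'rV[R]_N) (gt Jt : 'rV[R]_N -> 'M[R]_N) (c : R).
Hypothesis (ht : metric_on W gt).
Hypothesis (kahler : forall v, W v -> forall x y, riemann gt v x y y x =
  c / 4 * (inner gt v x x * inner gt v y y - inner gt v x y ^+ 2
           + 3 * inner gt v x (y *m Jt v) ^+ 2)).

Context (S : set 'rV[R]_(n1 + n2)) (F : 'rV[R]_(n1 + n2) -> 'rV[R]_N).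
Hypothesis (oS : open S) (SU1 : forall u, S u -> U1 (lsubmx u)).
Hypothesis (SU2 : forall u, S u -> U2 (rsubmx u)).
Hypothesis (sF : smooth_mx S F) (FW : forall u, S u -> W (F u)).
Hypothesis iso : forall u, S u -> forall a b,
  inner gt (F u) ('D_a F u) ('D_b F u) = inner gw u a b.

Context (u : 'rV[R]_(n1 + n2)) (Su : S u).
Hypothesis (p1 : posdef (g1 (lsubmx u))) (p2 : posdef (g2 (rsubmx u))).
Hypothesis (pt : posdef (gt (F u))).
Hypothesis real : forall x z,
  inner gt (F u) ('D_x F u) ('D_(row_mx 0 z) F u *m Jt (F u)) = 0.
Hypothesis minF : mean_curvature gw gt F u = 0.

Let fn0 v : U1 v -> f v != 0.
Proof. by move=> /f0; rewrite lt0r => /andP[]. Qed.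

Let hw : metric_on S gw.
Proof.
by apply: (metric_on_sub oS _ (metric_on_warped h1 h2 sf fn0)) => w Sw;
  split; [exact: SU1|exact: SU2].
Qed.

Let u1 := lsubmx u.
Let u2 := rsubmx u.
Let U1u : U1 u1 := SU1 Su.
Let U2u : U2 u2 := SU2 Su.
Let Uu : U1 (lsubmx u) /\ U2 (rsubmx u) := conj U1u U2u.
Let II := second_ff gw gt F u.
Let st (x y : 'rV[R]_N) : R := (x *m gt (F u) *m y^T) 0 0.

Let II_bil : bilinear_at II.
Proof. exact: (second_ff_bilinear hw ht sF FW Su). Qed.

Let IIC x y : II x y = II y x.
Proof. exact: (second_ffC hw ht sF FW x y Su). Qed.

(** The term 3 <x, J z>^2 of the ambient curvature vanishes because J z is
    normal. *)
Lemma vertical_plane_gauss x z :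
  riemann gw u x (row_mx 0 z) (row_mx 0 z) x =
  c / 4 * (inner gw u x x * inner gw u (row_mx 0 z) (row_mx 0 z)
           - inner gw u x (row_mx 0 z) ^+ 2)
  + st (II x x) (II (row_mx 0 z) (row_mx 0 z))
  - st (II x (row_mx 0 z)) (II x (row_mx 0 z)).
Proof.
have solve (T T' k k' A A' B a b d e : R) : T = T' + A - B -> A = A' ->
    T' = k * (a * b - d ^+ 2 + 3 * e ^+ 2) -> e = 0 ->
    k' = k * (a * b - d ^+ 2) -> T = k' + A' - B.
  by move=> -> -> -> -> ->; ring.
apply: solve.
- apply: etrans (gauss_equation hw ht sF FW iso x _ _ x Su) _.
  rewrite -/II (IIC (row_mx 0 z) x); reflexivity.
- exact: (innerCE ht _ _ (FW Su)).
- exact: (kahler (FW Su)).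
- exact: real.
- by rewrite !(iso Su).
Qed.

Context (E : 'M[R]_n2).
Hypothesis onE : f u1 ^+ 2 *: (E *m g2 u2 *m E^T) = 1%:M.

Let e j : 'rV[R]_(n1 + n2) := row_mx 0 (row j E).
Let Eh : 'M[R]_(n2, n1 + n2) := row_mx 0 E.

Let eE j : e j = row j Eh.
Proof. by rewrite /Eh row_row_mx row0. Qed.

Let verE a : row_mx 0 (a *m E) = a *m Eh :> 'rV[R]_(n1 + n2).
Proof. by rewrite /Eh mul_mx_row mulmx0. Qed.

Let inner_vE a b : inner gw u (row_mx 0 (a *m E)) (row_mx 0 (b *m E)) =
  (a *m b^T) 0 0.
Proof.
rewrite inner_ver inner_mul -/u1 -/u2.
have -> : (f u1 ^+ 2 * (a *m (E *m g2 u2 *m E^T) *m b^T) 0 0) =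
    (a *m (f u1 ^+ 2 *: (E *m g2 u2 *m E^T)) *m b^T) 0 0.
  by rewrite -scalemxAr -scalemxAl [RHS]mxE.
by rewrite onE mulmx1.
Qed.

Let inner_e i j : inner gw u (e i) (e j) = (i == j)%:R.
Proof.
by rewrite /e !rowE inner_vE trmx_delta mul_delta_mx_cond mulmxnE mxE eqxx.
Qed.

Let inner_g2 j : inner g2 u2 (row j E) (row j E) = (f u1 ^+ 2)^-1.
Proof.
have fn := fn0 U1u.
have := inner_e j j; rewrite inner_ver eqxx -/u1 -/u2 => h.
by rewrite -[LHS](mulKf (expf_neq0 2 fn)) h mulr1.
Qed.

Section HorizontalBasis.
Context (L : 'M[R]_n1).
Hypothesis onL : L *m g1 u1 *m L^T = 1%:M.

Let t i : 'rV[R]_(n1 + n2) := row_mx (row i L) 0.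

Let inner_t i : inner gw u (t i) (t i) = 1.
Proof.
rewrite inner_hor !rowE inner_mul onL mulmx1 trmx_delta mul_delta_mx.
by rewrite mxE !eqxx.
Qed.

Let inner_te i j : inner gw u (t i) (e j) = 0.
Proof. exact: inner_hor_ver. Qed.

Lemma horizontal_vertical_trace :
  \sum_i II (t i) (t i) + \sum_j II (e j) (e j) = 0.
Proof.
have pw : posdef (gw u) := posdef_warped (fn0 U1u) p1 p2.
pose B : 'M[R]_(n1 + n2) := block_mx L 0 0 E.
have onB : B *m gw u *m B^T = 1%:M.
  rewrite /B /gw /warped_metric tr_block_mx !trmx0 !mulmx_block.
  rewrite !(mulmx0, mul0mx, addr0, add0r) -/u1 -/u2 onL.
  by rewrite -scalemxAr -scalemxAl onE -scalar_mx_block.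
have n0 : (0 < n1 + n2)%N by rewrite addn_gt0 (ltnW hn2) orbT.
have := minimal_trace n0 pw II_bil minF erefl onB.
rewrite big_split_ord /= => H; apply: etrans H.
have rt i : t i = row (lshift n2 i) B by rewrite /B /block_mx rowKu row_row_mx row0.
have re i : e i = row (rshift n1 i) B by rewrite /B /block_mx rowKd row_row_mx row0.
apply: (f_equal2 +%R); apply: eq_bigr => i _.
  exact: (f_equal2 II (rt i) (rt i)).
exact: (f_equal2 II (re i) (re i)).
Qed.

(** The mixed curvatures are computed once from the warped metric and once from
    the immersion. *)
Lemma mixed_curvature_sum :
  n2%:R * laplacian g1 f u1 / f u1 =
  \sum_i \sum_j (c / 4 + st (II (t i) (t i)) (II (e j) (e j))
                 - st (II (t i) (e j)) (II (t i) (e j))).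
Proof.
have fn := fn0 U1u.
have E1 i j : c / 4 + st (II (t i) (t i)) (II (e j) (e j))
    - st (II (t i) (e j)) (II (t i) (e j)) =
    - (hessian g1 f u1 (row i L) (row i L) / f u1).
  have := vertical_plane_gauss (t i) (row j E).
  rewrite inner_te -/(e j) inner_e eqxx inner_t expr0n subr0 !mulr1 => <-.
  have := riemann_warped_mixed h1 h2 sf fn0 (row i L) (row j E) Uu.
  rewrite -/u1 -/u2 inner_g2 => ->.
  by move: (hessian _ _ _ _ _) fn => h; move: (f u1) => a a0; field.
under eq_bigr => i _ do under eq_bigr => j _ do rewrite E1.
rewrite (laplacianE h1 sf U1u erefl onL).
under eq_bigr => i _ do rewrite sumr_const card_ord -mulr_natl.
rewrite -mulr_sumr sumrN -mulr_suml; field.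
exact: fn.
Qed.

Lemma chen_inequality_basis (P : 'M[R]_(2, n2)) : row_free P ->
  \sum_(i < n2) \sum_(j < n2 | (i < j)%N) sectional gw u (e i) (e j)
  - sectional gw u (row_mx 0 (row 0 P)) (row_mx 0 (row 1 P))
  + n2%:R * laplacian g1 f u1 / f u1
  <= n2%:R * (n2%:R + 2 * n1%:R - 1) / 2 * (c / 4) - c / 4.
Proof.
move=> fP.
have uE : E \in unitmx.
  have : f u1 ^+ 2 *: E *m (g2 u2 *m E^T) = 1%:M by rewrite -scalemxAl mulmxA onE.
  case/mulmx1_unit; rewrite unitmxZ// unitfE expf_neq0//.
  exact: fn0 U1u.
pose a := row 0 P *m invmx E; pose b := row 1 P *m invmx E.
have aE : row 0 P = a *m E by rewrite mulmxKV.
have bE : row 1 P = b *m E by rewrite mulmxKV.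
pose h i j := II (e i) (e j).
pose form (x y : 'rV[R]_n2) := \sum_i \sum_j (x 0 i * y 0 j) *: h i j.
have IIform x y : II (row_mx 0 (x *m E)) (row_mx 0 (y *m E)) = form x y.
  rewrite !verE (bil_rows _ _ _ _ II_bil); apply: eq_bigr => i _.
  by apply: eq_bigr => j _; rewrite -!eE.
have D0 : 0 < (a *m a^T) 0 0 * (b *m b^T) 0 0 - (a *m b^T) 0 0 ^+ 2.
  rewrite -!inner_vE -aE -bE !inner_ver -/u1 -/u2.
  have : 0 < inner g2 u2 (row 0 P) (row 0 P) * inner g2 u2 (row 1 P) (row 1 P)
      - inner g2 u2 (row 0 P) (row 1 P) ^+ 2 := gram_gt0 p2 fP.
  have : 0 < (f u1 ^+ 2) ^+ 2 by rewrite !exprn_gt0// f0.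
  set x := inner _ _ (row 0 P) (row 0 P); set y := inner _ _ (row 1 P) _.
  set z := inner _ _ _ (row 1 P); move: x y z (f u1 ^+ 2) => x y z F2 F0 G0.
  have -> : F2 * x * (F2 * y) - (F2 * z) ^+ 2 = F2 ^+ 2 * (x * y - z ^+ 2) by ring.
  by rewrite mulr_gt0.
set D := (_ - _ : R) in D0.
have secP : sectional gw u (row_mx 0 (row 0 P)) (row_mx 0 (row 1 P)) =
   c / 4 + (st (form a a) (form b b) - st (form a b) (form a b)) / D.
  rewrite sectionalE vertical_plane_gauss aE bE !IIform !inner_vE -/D.
  by rewrite -addrA mulrDl mulfK// gt_eqF.
have sece (i j : 'I_n2) : (i < j)%N -> sectional gw u (e i) (e j) =
   c / 4 + (st (h i i) (h j j) - st (h i j) (h i j)).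
  move=> ij; have nij : (i == j) = false.
    by apply/negbTE; apply: contraTneq ij => ->; rewrite ltnn.
  rewrite sectionalE vertical_plane_gauss -/(e j) !inner_e !eqxx nij expr0n subr0 !mulr1.
  by rewrite divr1 addrA.
have hC i j : h i j = h j i by exact: IIC.
have stC x y : st x y = st y x by exact: (innerCE ht _ _ (FW Su)).
pose phi i j := st (h i i) (h j j) - st (h i j) (h i j).
have tauE : \sum_(i < n2) \sum_(j < n2 | (i < j)%N) sectional gw u (e i) (e j) =
    2^-1 * (n2%:R * n2%:R - n2%:R) * (c / 4)
    + 2^-1 * \sum_i \sum_j phi i j.
  have phiC i j : c / 4 + phi i j = c / 4 + phi j i.
    exact: (f_equal2 (fun x y => c / 4 + (x - y)) (stC (h i i) (h j j))
      (f_equal2 st (hC i j) (hC i j))).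
  apply: etrans (eq_bigr _ (fun i _ => eq_bigr _ (fun j ij => sece i j ij))) _.
  apply: etrans (sum_upper_triangle phiC) _.
  have phi0 i : phi i i = 0 by rewrite /phi subrr.
  move: phi phi0 {phiC} => phi phi0.
  under [X in _ - X]eq_bigr => i _ do rewrite phi0 addr0.
  rewrite sumr_const card_ord.
  under eq_bigr => i _ do rewrite big_split/= sumr_const card_ord.
  rewrite big_split/= sumr_const card_ord.
  have N0 x : x *+ n2 = n2%:R * x :> R by rewrite mulr_natl.
  rewrite (N0 (c / 4)) (N0 (n2%:R * (c / 4))); ring.
have T0 := horizontal_vertical_trace.
set T := \sum_i II (t i) (t i) in T0; pose Hv := \sum_j h j j.
have CA : 2^-1 * (\sum_i \sum_j phi i j)
    + st T Hv - (st (form a a) (form b b) - st (form a b) (form a b)) / D <= 0.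
  exact: (chen_algebraic_inequality pt hC T0 D0).
have st_bil : bilinear_at st := inner_bilinear gt (F u).
have st_ge0 x : 0 <= st x x.
  by have [->|x0] := eqVneq x 0; [rewrite (bil01 st_bil)|apply/ltW/pt.2].
have mix : n2%:R * laplacian g1 f u1 / f u1 <= n1%:R * n2%:R * (c / 4) + st T Hv.
  have -> : n1%:R * n2%:R * (c / 4) + st T Hv =
      \sum_i \sum_j (c / 4 + st (II (t i) (t i)) (h j j)).
    have stT : st T Hv = \sum_i \sum_j st (II (t i) (t i)) (h j j).
      by rewrite /T (bil_sum1 st_bil); apply: eq_bigr => i _; rewrite (bil_sum2 st_bil).
    have G (psi : 'I_n1 -> 'I_n2 -> R) : \sum_i \sum_j (c / 4 + psi i j) =
        n1%:R * n2%:R * (c / 4) + \sum_i \sum_j psi i j.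
      under eq_bigr => i _ do rewrite big_split/= sumr_const card_ord.
      rewrite big_split/= sumr_const card_ord.
      have N0 k x : x *+ k = k%:R * x :> R by rewrite mulr_natl.
      by rewrite (N0 n2 (c / 4)) (N0 n1 (n2%:R * (c / 4))) mulrA.
    by rewrite stT; exact: (esym (G _)).
  rewrite mixed_curvature_sum; apply: ler_sum => i _; apply: ler_sum => j _.
  by rewrite gerBl.
rewrite tauE secP.
move: mix CA; set X := \sum_i _; set Y := _ / D; set Z := st T Hv.
set m := _ / f u1; move: X Y Z m => X Y Z m mix CA.
have -> : n2%:R * (n2%:R + 2 * n1%:R - 1) / 2 * (c / 4) - c / 4 =
    2^-1 * (n2%:R * n2%:R - n2%:R) * (c / 4) + n1%:R * n2%:R * (c / 4) - c / 4 :> R.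
  by field.
lra.
Qed.

End HorizontalBasis.
End PointwiseInequality.

(** * Chen invariants and charts *)

Section ChenInvariant.
Context (R : realType).

(** The infimum is bounded below by a bound for every plane because there is a
    plane: without one it would be 0. *)
Lemma chen_delta_le n p (g : 'rV[R]_n -> 'M[R]_n) u (V : 'M[R]_(p, n)) B :
  (2 <= \rank V)%N ->
  (forall P : 'M[R]_(2, n), row_free P -> (P <= V)%MS ->
     tau g u V - sectional g u (row 0 P) (row 1 P) <= B) ->
  chen_delta g u V <= B.
Proof.
move=> rV hB; rewrite /chen_delta lerBlDr -lerBlDl; apply: lb_le_inf; last first.
  by move=> _ [P [fP PV] <-]; rewrite lerBlDl -lerBlDr; exact: hB.
pose P : 'M[R]_(2, n) := (pid_mx 2 : 'M[R]_(2, \rank V)) *m row_base V.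
exists (sectional g u (row 0 P) (row 1 P)), P => //; split.
  by rewrite /row_free /P mxrankMfree ?row_base_free// rank_pid_mx.
by rewrite (submx_trans (submxMl _ _))// eq_row_base.
Qed.

(** The dimension of V is only propositionally equal to m, so the sum over the
    chosen basis is bounded by a bound for all orthonormal families of size m. *)
Lemma tau_le n p m (g : 'rV[R]_n -> 'M[R]_n) u (V : 'M[R]_(p, n)) B :
  \rank V = m ->
  (forall E : 'M[R]_(m, n), E *m g u *m E^T = 1%:M -> (E <= V)%MS ->
    \sum_(i < m) \sum_(j < m | (i < j)%N) sectional g u (row i E) (row j E)
      <= B) ->
  posdef (g u) -> tau g u V <= B.
Proof.
move=> rV hB pg; have [onE EV] := orthonormal_basisP V pg.
rewrite /tau; move: (orthonormal_basis g u V) onE EV; rewrite rV => E onE EV.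
by apply: hB onE _; case/andP: EV.
Qed.

Lemma row_free_tangentP n1 n2 : row_free (tangentP R n1 n2).
Proof.
apply/row_freeP; exists (col_mx 0 1%:M).
by rewrite /tangentP mul_row_col mul0mx mulmx1 add0r.
Qed.

Lemma sub_tangentP n1 n2 m (E : 'M[R]_(m, n1 + n2)) :
  (E <= tangentP R n1 n2)%MS -> E = row_mx 0 (rsubmx E).
Proof.
case/submxP => D ->.
by rewrite /tangentP mul_mx_row mulmx0 mulmx1 row_mxKr.
Qed.

Lemma binomial2 n : 'C(n, 2)%:R = 2^-1 * (n%:R * n%:R - n%:R) :> R.
Proof.
elim: n => [|n IH]; first by rewrite bin0n mul0r subr0 mulr0.
have -> : n.+1%:R = n%:R + 1 :> R by rewrite -natr1.
by rewrite binS bin1 natrD IH; move: (n%:R) => x; field.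
Qed.

Lemma posdef_unit n (S : 'M[R]_n) : posdef S -> S \in unitmx.
Proof.
by case/posdef_diagonalize => L; rewrite -mulmxA => /mulmx1_unit[_];
  rewrite unitmx_mul => /andP[].
Qed.

Lemma scale_row_mx0 n1 n2 (k : R) (x : 'rV[R]_n2) :
  row_mx 0 (k *: x) = k *: row_mx 0 x :> 'rV[R]_(n1 + n2).
Proof. by rewrite scale_row_mx scaler0. Qed.

Lemma sectional_scale n (U : set 'rV[R]_n) (g : 'rV[R]_n -> 'M[R]_n) u k x y :
  metric_on U g -> U u -> k != 0 ->
  sectional g u (k *: x) (k *: y) = sectional g u x y.
Proof.
move=> hg Uu k0; rewrite !sectionalE; have hR := riemann_algebraic hg Uu.
rewrite (ac_scale1 hR) (ac_scale2 hR) (ac_scale3 hR) (ac_scale4 hR).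
have bil := inner_bilinear g u.
rewrite !(bilZ1 bil) !(bilZ2 bil) -![_ *: _]/(_ * _).
move: (riemann _ _ _ _ _ _) (inner _ _ x x) (inner _ _ y y) (inner _ _ x y).
move=> r a b d.
have -> : k * (k * a) * (k * (k * b)) - (k * (k * d)) ^+ 2 =
  k ^+ 4 * (a * b - d ^+ 2) by ring.
have -> : k * (k * (k * (k * r))) = k ^+ 4 * r by ring.
by rewrite invfM mulrACA mulfV ?mul1r// expf_neq0.
Qed.

End ChenInvariant.

Section ChartData.
Context (R : realType).

Lemma riemannian_posdef n (M : metric_charted R n) (a : chart M) u :
  is_riemannian M -> chart_range a u -> posdef (metric a u).
Proof.
by move=> hM ua; split; [exact: (Defs.metric_sym hM ua)|exact: (metric_pos hM ua)].
Qed.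

Lemma riemannian_metric_on n (M : metric_charted R n) (a : chart M) :
  is_riemannian M -> metric_on (chart_range a) (metric a).
Proof.
move=> hM; split.
- by apply: chart_range_open; exact: riemannian_manifold.
- exact: (metric_smooth hM a).
- by move=> u; exact: (Defs.metric_sym hM).
- by move=> u ua; apply: posdef_unit; exact: riemannian_posdef.
Qed.

Lemma chart_range_inv n (M : charted R n) (a : chart M) u :
  is_manifold M -> chart_range a u ->
  chart_dom a (chart_inv a u) /\ chart_map a (chart_inv a u) = u.
Proof.
by move=> hM [x ax <-]; rewrite (chart_mapK hM ax).
Qed.

Lemma chart_inv_continuous_at n (M : charted R n) (a : chart M) u :
  is_manifold M -> chart_range a u -> {for u, continuous (chart_inv a)}.
Proof.
move=> hM ua; have : {within chart_range a, continuous (chart_inv a)}.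
  exact: chart_inv_continuous.
rewrite continuous_open_subspace; last exact: chart_range_open.
by apply; rewrite inE.
Qed.

End ChartData.

Section LocalExpression.
Context (R : realType) (n1 n2 N : nat).
Context (NT : charted R n1) (NP : charted R n2) (Mt : charted R N).
Hypothesis (hT : is_manifold NT) (hP : is_manifold NP) (ht : is_manifold Mt).
Context (phi : prod_charted NT NP -> Mt).
Hypothesis cphi : continuous phi.
Context (ab : chart (prod_charted NT NP)) (bt : chart Mt).

Let S := chart_map ab @` (chart_dom ab `&` phi @^-1` chart_dom bt).

Lemma local_domainE u : S u <-> [/\ chart_range ab.1 (lsubmx u),
  chart_range ab.2 (rsubmx u) & chart_dom bt (phi (chart_inv ab u))].
Proof.
split=> [[[x y] [[/= ax ay] xy] <-]|[u1 u2 uphi]].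
  rewrite /= !row_mxKl !row_mxKr; split; [by exists x|by exists y|].
  by rewrite (chart_mapK hT ax) (chart_mapK hP ay).
have [d1 e1] := chart_range_inv hT u1; have [d2 e2] := chart_range_inv hP u2.
by exists (chart_inv ab u) => //=; rewrite e1 e2 hsubmxK.
Qed.

(** The inverse charts and phi are continuous, so the conditions of
    [local_domainE] are open. *)
Lemma open_local_domain : open S.
Proof.
rewrite openE => u Su; have [u1 u2 uphi] := (local_domainE u).1 Su.
have n1u : \forall w \near u, chart_range ab.1 (lsubmx w).
  have o1 : open (chart_range ab.1) by exact: chart_range_open.
  exact: (near_open (open_lsubmx (n2 := n2) o1) u1 (fun _ h => h)).
have n2u : \forall w \near u, chart_range ab.2 (rsubmx w).
  have o2 : open (chart_range ab.2) by exact: chart_range_open.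
  exact: (near_open (open_rsubmx (n1 := n1) o2) u2 (fun _ h => h)).
have c1 : {for u, continuous (fun w => chart_inv ab.1 (lsubmx w))}.
  apply: (@continuous_comp _ _ _ (@lsubmx R 1 n1 n2) (chart_inv ab.1)).
    exact: continuous_lsubmx.
  exact: chart_inv_continuous_at.
have c2 : {for u, continuous (fun w => chart_inv ab.2 (rsubmx w))}.
  apply: (@continuous_comp _ _ _ (@rsubmx R 1 n1 n2) (chart_inv ab.2)).
    exact: continuous_rsubmx.
  exact: chart_inv_continuous_at.
have c : {for u, continuous (fun w => phi (chart_inv ab w))}.
  apply: (@continuous_comp _ _ _ (chart_inv ab) phi); last exact: cphi.
  exact: cvg_pair c1 c2.
have nphi : \forall w \near u, chart_dom bt (phi (chart_inv ab w)).
  apply: c; apply: open_nbhs_nbhs; split=> //.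
  exact: chart_dom_open.
apply: filterS3 n1u n2u nphi => w w1 w2 w3.
by apply/local_domainE.
Qed.

End LocalExpression.

(** * The theorem *)

(** The pointwise inequality for one plane and one vertical orthonormal basis. The
    basis is arbitrary so that both the basis of the fibre for the warped metric
    and the rescaled basis of the second factor can be used. *)
Lemma chen_inequality_charts (R : realType) (n1 n2 m : nat) (hn2 : (2 <= n2)%N)
  (NT : metric_charted R n1) (NP : metric_charted R n2) (f : NT -> R)
  (Mt : metric_charted R (2 * m))
  (J : chart Mt -> 'rV[R]_(2 * m) -> 'M[R]_(2 * m)) (c : R)
  (hMt : complex_space_form J c)
  (phi : warped_product NP f -> Mt)
  (hphi : is_CR_warped_product J phi)
  (hmin : minimal phi)
  (p : NT) (q : NP) (a : chart NT) (b : chart NP)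
  (ha : chart_dom a p) (hb : chart_dom b q)
  (g := warped_metric (metric a) (metric b) (f \o chart_inv a))
  (u := row_mx (chart_map a p) (chart_map b q))
  (E : 'M[R]_n2) (P : 'M[R]_(2, n2)) :
  f p ^+ 2 *: (E *m metric b (chart_map b q) *m E^T) = 1%:M -> row_free P ->
  \sum_(i < n2) \sum_(j < n2 | (i < j)%N)
    sectional g u (row_mx 0 (row i E)) (row_mx 0 (row j E))
  - sectional g u (row_mx 0 (row 0 P)) (row_mx 0 (row 1 P))
  + n2%:R * laplacian (metric a) (f \o chart_inv a) (chart_map a p) / f p
  <= n2%:R * (n2%:R + 2 * n1%:R - 1) / 2 * (c / 4) - c / 4.
Proof.
move=> onE fP.
have rT := CR_riemannianT hphi; have rP := CR_riemannianP hphi.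
have rM := kahler_riemannian hMt.1.
have mT := riemannian_manifold rT; have mP := riemannian_manifold rP.
have mM := riemannian_manifold rM.
have [[cphi sphi] isom] := CR_isometric hphi.
pose x : warped_product NP f := (p, q).
pose ab : chart (warped_product NP f) := (a, b).
have [bt hbt] := chart_cover mM (phi x).
pose F := local_map phi ab bt.
pose S := chart_map ab @` (chart_dom ab `&` phi @^-1` chart_dom bt).
have oS : open S by exact: (open_local_domain mT mP mM cphi).
have SE := local_domainE mT mP (phi : prod_charted NT NP -> Mt) ab bt.
have hab : chart_dom ab x by [].
have Su : S u by exists x.
have sF : smooth_mx S F by exact: sphi.
have up : lsubmx u = chart_map a p by rewrite /u row_mxKl.
have uq : rsubmx u = chart_map b q by rewrite /u row_mxKr.
have dom y : chart_dom ab y -> chart_inv ab (chart_map ab y) = y.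
  case: y => y1 y2 [/= d1 d2].
  by rewrite row_mxKl row_mxKr (chart_mapK mT d1) (chart_mapK mP d2).
have FE y : chart_dom ab y -> F (chart_map ab y) = chart_map bt (phi y).
  by move=> dy; exact: (f_equal (fun z => chart_map bt (phi z)) (dom y dy)).
have FW w : S w -> chart_range bt (F w).
  by case=> y [dy phiy] <-; rewrite FE//; exists (phi y).
have iso w : S w -> forall v v',
    inner (metric bt) (F w) ('D_v F w) ('D_v' F w) = inner g w v v'.
  move=> Sw v v'; have dF := smooth_mx_diff sF Sw.
  rewrite (deriveEjacobian _ dF) (deriveEjacobian _ dF) inner_mul.
  case: Sw => y [dy phiy] yw; rewrite -yw FE//.
  by have := isom ab bt y dy phiy => /= ->.
have fp : (f \o chart_inv a) (lsubmx u) = f p.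
  by rewrite up /= (chart_mapK mT ha).
have ra : chart_range a (lsubmx u) by rewrite up; exists p.
have rb : chart_range b (rsubmx u) by rewrite uq; exists q.
have [hk hol] := hMt.
have oT := riemannian_metric_on a rT; have oP := riemannian_metric_on b rP.
have oM := riemannian_metric_on bt rM.
have pL := riemannian_posdef rT ra.
have [L onL] := posdef_diagonalize pL.
have real v z : inner (metric bt) (F u) ('D_v F u)
    ('D_(row_mx 0 z) F u *m J bt (F u)) = 0.
  have dF := smooth_mx_diff sF Su.
  rewrite (innerCE oM _ _ (FW _ Su)).
  rewrite (deriveEjacobian _ dF) (deriveEjacobian _ dF).
  have -> : row_mx 0 z = z *m tangentP R n1 n2.
    by rewrite /tangentP mul_mx_row mulmx0 mulmx1.
  have Fu : F u = chart_map bt (phi x) by exact: (FE x hab).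
  have tr : tangentP R n1 n2 *m 'J F u *m J bt (F u) *m metric bt (F u)
      *m ('J F u)^T = 0.
    by rewrite Fu; exact: (CR_totally_real hphi hab hbt).
  rewrite /inner trmx_mul !mulmxA.
  have -> : z *m tangentP R n1 n2 *m 'J F u *m J bt (F u) *m metric bt (F u)
      *m ('J F u)^T *m v^T = z *m (tangentP R n1 n2 *m 'J F u *m J bt (F u)
      *m metric bt (F u) *m ('J F u)^T) *m v^T by rewrite !mulmxA.
  by rewrite tr mulmx0 mul0mx mxE.
have kah v : chart_range bt v -> forall y z, riemann (metric bt) v y z z y =
  c / 4 * (inner (metric bt) v y y * inner (metric bt) v z z
           - inner (metric bt) v y z ^+ 2
           + 3 * inner (metric bt) v y (z *m J bt v) ^+ 2).
  move=> rv y z; apply: (space_form_riemann oM (J_smooth hk bt)) => //.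
  - by move=> w rw; exact: (metric_pos rM rw).
  - by move=> w; exact: (J_square hk).
  - by move=> w; exact: (J_isometry hk).
  - by move=> w; exact: (J_parallel hk).
  - by move=> w; exact: hol.
have f0 w : chart_range a w -> 0 < (f \o chart_inv a) w.
  by move=> _; exact: (CR_warping_pos hphi).
have SU1 w : S w -> chart_range a (lsubmx w) by move=> /SE[].
have SU2 w : S w -> chart_range b (rsubmx w) by move=> /SE[].
have minF : mean_curvature g (metric bt) F u = 0 by exact: (hmin ab bt x).
have onE' : (f \o chart_inv a) (lsubmx u) ^+ 2
    *: (E *m metric b (rsubmx u) *m E^T) = 1%:M by rewrite fp uq.
have := chen_inequality_basis hn2 oT oP (CR_warping_smooth hphi a) f0 oM kah oS
  SU1 SU2 sF FW iso Su pL (riemannian_posdef rP rb)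
  (riemannian_posdef rM (FW _ Su)) real minF onE' onL fP.
by rewrite fp up.
Qed.

Theorem corollary5p2 (R : realType) (n1 n2 m : nat) (hn2 : (2 <= n2)%N)
  (NT : metric_charted R n1) (NP : metric_charted R n2) (f : NT -> R)
  (Mt : metric_charted R (2 * m))
  (J : chart Mt -> 'rV[R]_(2 * m) -> 'M[R]_(2 * m)) (c : R)
  (hMt : complex_space_form J c)
  (phi : warped_product NP f -> Mt)
  (hphi : is_CR_warped_product J phi)
  (hmin : minimal phi)
  (p : NT) (q : NP) (a : chart NT) (b : chart NP)
  (ha : chart_dom a p) (hb : chart_dom b q) :
  let M := warped_product NP f in
  let x : M := (p, q) in
  let ab : chart M := (a, b) in
  let f_loc := f \o chart_inv a in
  let Delta_f := laplacian (metric a) f_loc (chart_map a p) in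
  let nabla_f := grad (metric a) f_loc (chart_map a p) in
  let norm2_nabla_f := inner (metric a) (chart_map a p) nabla_f nabla_f in
  let delta_hat := chen_delta (metric ab) (chart_map ab x) (tangentP R n1 n2) in
  let delta_P := chen_delta (metric b) (chart_map b q) (1%:M : 'M[R]_n2) in
  [/\ delta_hat + n2%:R * Delta_f / f p
        <= n2%:R * (n2%:R + 2 * n1%:R - 1) / 2 * (c / 4) - c / 4,
      n2%:R * (n2%:R + 2 * n1%:R - 1) / 2 * (c / 4) - c / 4
        = (n2%:R * (n2%:R + 2 * n1%:R - 1) - 2) / 2 * (c / 4)
    & delta_P + f p ^+ 2 * (n2%:R * Delta_f / f p)
        <= f p ^+ 2 * ((n2%:R * (n2%:R + 2 * n1%:R - 1) - 2) / 2 * (c / 4))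
           + ('C(n2, 2)%:R - 1) * norm2_nabla_f].
Proof.
move=> M x ab f_loc Delta_f nabla_f norm2_nabla_f delta_hat delta_P.
have key := chen_inequality_charts hn2 hMt hphi hmin ha hb.
have rT := CR_riemannianT hphi; have rP := CR_riemannianP hphi.
have mT := riemannian_manifold rT.
pose g := warped_metric (metric a) (metric b) f_loc.
pose u := row_mx (chart_map a p) (chart_map b q).
have up : lsubmx u = chart_map a p by rewrite /u row_mxKl.
have uq : rsubmx u = chart_map b q by rewrite /u row_mxKr.
have ra : chart_range a (lsubmx u) by rewrite up; exists p.
have rb : chart_range b (rsubmx u) by rewrite uq; exists q.
have oT := riemannian_metric_on a rT; have oP := riemannian_metric_on b rP.
have p1 := riemannian_posdef rT ra; have p2 := riemannian_posdef rP rb.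
have f0 w : chart_range a w -> f_loc w != 0.
  by move=> _; rewrite gt_eqF//; exact: (CR_warping_pos hphi).
have fp : f_loc (lsubmx u) = f p.
  by rewrite up /f_loc /= (chart_mapK mT ha).
have fpos : 0 < f p := CR_warping_pos hphi p.
have gw := metric_on_warped oT oP (CR_warping_smooth hphi a) f0.
have mid : n2%:R * (n2%:R + 2 * n1%:R - 1) / 2 * (c / 4) - c / 4
    = (n2%:R * (n2%:R + 2 * n1%:R - 1) - 2) / 2 * (c / 4) :> R by field.
have pg : posdef (g u).
  by apply: posdef_warped => //; exact: f0.
have rowsE k (E : 'M[R]_(k, n1 + n2)) i : (E <= tangentP R n1 n2)%MS ->
    row i E = row_mx 0 (row i (rsubmx E)).
  by move=> /sub_tangentP {1}->; rewrite row_row_mx row0.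
split => //.
- rewrite -lerBrDr; apply: chen_delta_le => [|P fP PV].
    by rewrite (eqP (row_free_tangentP R n1 n2)).
  rewrite lerBlDr; apply: (tau_le (m := n2)) pg.
    exact: (eqP (row_free_tangentP R n1 n2)).
  move=> E onE EV.
  have fP' : row_free (rsubmx P).
    have := fP; rewrite /row_free (sub_tangentP PV).
    have -> : row_mx 0 (rsubmx P) = rsubmx P *m tangentP R n1 n2.
      by rewrite /tangentP mul_mx_row mulmx0 mulmx1.
    by rewrite mxrankMfree ?row_free_tangentP// /tangentP mul_mx_row mulmx0
      mulmx1 row_mxKr.
  have onE' : f p ^+ 2 *: (rsubmx E *m metric b (chart_map b q) *m (rsubmx E)^T)
      = 1%:M.
    have : E *m g u *m E^T = 1%:M by exact: onE.
    rewrite (sub_tangentP EV) /g /warped_metric mul_row_block tr_row_mx.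
    rewrite mul_row_col !mul0mx !add0r !mulmx0 mul0mx add0r fp uq row_mxKr.
    by rewrite -scalemxAr -scalemxAl.
  have := key _ _ onE' fP'; rewrite -/g -/u.
  under eq_bigr => i _ do under eq_bigr => j _ do rewrite -!rowsE//.
  rewrite -!rowsE// -lerBrDr lerBlDr; exact.
- pose N := norm2_nabla_f; pose F := f p ^+ 2.
  have F0 : 0 < F by rewrite exprn_gt0.
  have secW y z : inner (metric b) (rsubmx u) y y
      * inner (metric b) (rsubmx u) z z
      - inner (metric b) (rsubmx u) y z ^+ 2 != 0 ->
      sectional g u (row_mx 0 y) (row_mx 0 z) =
      F^-1 * (sectional (metric b) (chart_map b q) y z - N).
    move=> D0; have := sectional_warped_vertical oT oP
      (CR_warping_smooth hphi a) f0 (conj ra rb) D0.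
    by rewrite -/f_loc fp up uq.
  have fn : f p != 0 by rewrite gt_eqF.
  rewrite -lerBrDr; apply: chen_delta_le => [|P fP _]; first by rewrite mxrank1.
  rewrite lerBlDr; apply: (tau_le (m := n2)); first exact: mxrank1.
    move=> E onE _.
    (* Vectors of length 1 for the second factor have length f in the fibre. *)
    have onE' : F *: (((f p)^-1 *: E) *m metric b (chart_map b q)
        *m ((f p)^-1 *: E)^T) = 1%:M.
      rewrite linearZ/= -!scalemxAl -!scalemxAr scalerA scalerA onE.
      rewrite /F (_ : _ * _ * _ = 1) ?scale1r//; move: (f p) fn => e e0.
      by field.
    have innE i j : inner (metric b) (rsubmx u) (row i E) (row j E) = (i == j)%:R.
      rewrite uq !rowE inner_mul onE mulmx1 trmx_delta mul_delta_mx_cond.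
      by rewrite mulmxnE mxE eqxx.
    have secE (i j : 'I_n2) : (i < j)%N ->
        sectional g u (row_mx 0 (row i ((f p)^-1 *: E)))
          (row_mx 0 (row j ((f p)^-1 *: E))) =
        F^-1 * (sectional (metric b) (chart_map b q) (row i E) (row j E) - N).
      move=> ij; have nij : (i == j) = false.
        by apply/negbTE; apply: contraTneq ij => ->; rewrite ltnn.
      rewrite !linearZ/= !scale_row_mx0 (sectional_scale _ _ gw) ?invr_eq0//.
      by apply: secW; rewrite !innE !eqxx nij expr0n subr0 mulr1 oner_eq0.
    have secP : sectional g u (row_mx 0 (row 0 P)) (row_mx 0 (row 1 P)) =
        F^-1 * (sectional (metric b) (chart_map b q) (row 0 P) (row 1 P) - N).
      by apply: secW; rewrite gt_eqF//; exact: (gram_gt0 p2 fP).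
    have cst_sum : \sum_(i < n2) \sum_(j < n2 | (i < j)%N) N = 'C(n2, 2)%:R * N.
      rewrite (sum_upper_triangle (phi := fun _ _ => N))//.
      rewrite !sumr_const !card_ord -!mulrnA binomial2.
      have N0 k : N *+ k = k%:R * N by rewrite mulr_natl.
      by rewrite !N0 natrM; ring.
    have := key _ _ onE' fP; rewrite -/g -/u.
    under eq_bigr => i _ do under eq_bigr => j ij do rewrite (secE i j ij) mulrBr.
    rewrite secP.
    under eq_bigr => i _ do rewrite sumrB -!mulr_sumr.
    rewrite sumrB -!mulr_sumr cst_sum -mid.
    set X := \sum_(i < n2) _; set Y := sectional _ _ _ _.
    set Z := n2%:R * laplacian _ _ _ / f p.
    rewrite -(ler_pM2l F0) -/F -/N.
    have -> : F * (F^-1 * X - F^-1 * ('C(n2, 2)%:R * N) - F^-1 * (Y - N) + Z) =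
        X - 'C(n2, 2)%:R * N - (Y - N) + F * Z.
      by field; rewrite gt_eqF.
    have fin (A B C D G H : R) : A - B - (C - D) + G <= H ->
        A <= H + (B - D) - G + C by lra.
    by move=> /fin; rewrite mulrBl mul1r.
  by have := p2; rewrite uq.
Qed.
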